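(* The quantity $\log h(\Delta_{\mathbf K})/\log T$ converges in probability to $1$, that is, for all $\eta>0$, $$\lim_{T\to+\infty}\mathbb{P}_T\left(\left|\frac{\log h(\Delta_{\mathbf K})}{\log T}-1\right|>\eta\right)=0.$$ Similarly, for all $\eta>0$, $$\lim_{T\to+\infty}\mathbb{P}_T\left(\left|\frac{\log h(\Delta_\gamma)}{\log T}-1\right|>\eta\right)=0.$$
   Context: $\Gamma=\mathbf{SL}(2,\mathbf Z)$, $\|\gamma\|=\sqrt{\mathrm{Tr}({}^t\gamma\gamma)}$ is the Frobenius norm, $\Gamma_T=\{\gamma\in\Gamma: \|\gamma\|\le T\}$, and $\mathbb{P}_T$ is the uniform probability measure on $\Gamma_T$. A matrix $\gamma\in\Gamma$ is hyperbolic if $|\mathrm{Tr}(\gamma)|>2$. For hyperbolic $\gamma$, $\mathbf Q[\gamma]\subset M(2,\mathbf Q)$ is a field isomorphic to the real quadratic field $\mathbf K=\mathbf Q(\sqrt{\mathrm{Tr}(\gamma)^2-4})$; $\Delta_{\mathbf K}$ is the discriminant of its ring of integers $\mathcal{O}_{\mathbf K}$, and $\Delta_\gamma$ is the discriminant of the multiplier ring $\mathcal{O}_\gamma=\mathbf Q[\gamma]\cap M(2,\mathbf Z)$, an order in $\mathbf Q[\gamma]\simeq\mathbf K$. For $\Delta$ the discriminant of a real quadratic order $\mathcal{O}$ (which is determined by $\Delta$ up to isomorphism), $h(\Delta)$ is the narrow class number: the number of classes of invertible fractional ideals of $\mathcal{O}$ modulo multiplication by field elements of positive norm. Events are understood as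 subsets of the hyperbolic elements of $\Gamma_T$ (the proportion of non-hyperbolic elements of $\Gamma_T$ tends to $0$). *)

(* Defs.v *)
(* MathComp / MathComp-Analysis *)
From HB Require Import structures.
From mathcomp Require Import all_boot all_order all_algebra all_field.
From mathcomp Require Import finmap.
From mathcomp Require Import all_classical all_reals all_analysis.

Set Implicit Arguments.
Unset Strict Implicit.
Unset Printing Implicit Defensive.

Import Order.TTheory GRing.Theory Num.Theory.
Import numFieldNormedType.Exports.

Local Open Scope classical_set_scope.
Local Open Scope ring_scope.

Section Orders.
Variable K : falgType rat.

Definition mul_matrix (x : K) : 'M[rat]_(\dim {:K}) :=
  passmx.mxof (vbasis {:K}) (vbasis {:K}) (amull x).

Definition alg_trace (x : K) : rat := \tr (mul_matrix x).

Definition alg_norm (x : K) : rat := \det (mul_matrix x).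

Definition Zspan n (b : n.-tuple K) : set K :=
  [set x | exists c : 'I_n -> int, x = \sum_(i < n) tnth b i *~ c i].

Definition is_Zbasis (L : set K) (b : (\dim {:K}).-tuple K) : Prop :=
  basis_of {:K} b /\ L = Zspan b.

Definition is_order (O : set K) : Prop :=
  [/\ exists b, is_Zbasis O b, O 1 & forall x y, O x -> O y -> O (x * y)].

(* The determinant does not depend on the Z-basis, and it is an integer when O
   is an order; the default value 0 is taken when there is no such basis. *)
Definition disc (O : set K) : int :=
  xget 0 [set d : int | exists2 b, is_Zbasis O b &
    d%:~R = \det (\matrix_(i, j) alg_trace (tnth b i * tnth b j))].

Definition ring_of_integers : set K := [set x | integralOver (intr : int -> K) x].

End Orders.

Section ClassNumber.
Variables (K : fieldExtType rat) (O : set K).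

Definition fractional_ideal (I : set K) : Prop :=
  [/\ I 0,
      forall x y, I x -> I y -> I (x + y),
      forall a x, O a -> I x -> I (a * x),
      exists2 x, I x & x != 0
    & exists d, [/\ O d, d != 0 & forall x, I x -> O (d * x)]].

Definition ideal_mul (I J : set K) : set K :=
  [set z | exists n (x y : 'I_n -> K),
     [/\ forall i, I (x i), forall i, J (y i) & z = \sum_(i < n) x i * y i]].

Definition invertible_ideal (I : set K) : Prop :=
  fractional_ideal I /\ exists2 J, fractional_ideal J & ideal_mul I J = O.

Definition narrow_equiv (I J : set K) : Prop :=
  exists2 x : K, 0 < alg_norm x & J = [set x * y | y in I].

Definition narrow_class (I : set K) : set (set K) :=
  [set J | invertible_ideal J /\ narrow_equiv I J].

Definition narrow_class_group : set (set (set K)) :=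
  [set narrow_class I | I in invertible_ideal].

(* Here fset_set is meaningful because the set of narrow classes is finite. *)
Definition narrow_class_number : nat := #|` fset_set narrow_class_group|.

End ClassNumber.

(* A quadratic order is determined by its discriminant up to isomorphism, so
   the set below has exactly one element when D is the discriminant of one; the
   order is real quadratic precisely when moreover 0 < D. *)
Definition h (D : int) : nat :=
  xget 0%N [set n | exists (K : fieldExtType rat) (O : set K),
    [/\ \dim {:K} = 2, is_order O, disc O = D & n = narrow_class_number O]].

Definition hyperbolic (g : 'M[int]_2) : Prop := 2 < `|\tr g|.

(* K = Q(s) with s ^+ 2 = Tr(g)^2 - 4; such a K is unique up to isomorphism. *)
Definition disc_field (g : 'M[int]_2) : int :=
  xget 0 [set d | exists (K : fieldExtType rat) (s : K),
    [/\ s ^+ 2 = ((\tr g) ^+ 2 - 4)%:~R, <<1; s>>%VS = {:K}%VS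
      & d = disc (@ring_of_integers K)]].

Definition Q_adjoin (g : 'M[int]_2) : {aspace 'M[rat]_2} :=
  <<1; map_mx intr g>>%AS.

Definition multiplier_ring (g : 'M[int]_2) : set (subvs_of (Q_adjoin g)) :=
  [set x | exists m : 'M[int]_2, vsval x = map_mx intr m].

Definition disc_multiplier (g : 'M[int]_2) : int := disc (@multiplier_ring g).

Section Counting.
Variable R : realType.

Definition frobenius_norm (g : 'M[int]_2) : R :=
  Num.sqrt (\tr (g^T *m g))%:~R.

Definition SL2Z_ball (T : R) : set 'M[int]_2 :=
  [set g | \det g = 1 /\ frobenius_norm g <= T].

(* The uniform probability on the finite set SL2Z_ball T. *)
Definition prob (T : R) (A : set 'M[int]_2) : R :=
  #|` fset_set (SL2Z_ball T `&` A)|%:R / #|` fset_set (SL2Z_ball T)|%:R.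

End Counting.

(* Main.v *)
(* The proof counts matrices and uses neither the class number formula nor Siegel's
   theorem. Fix a small power T^d of T.

   Upper bound: every class of invertible ideals of an order of discriminant D contains a
   reduced form (A, B, C), with |B| <= |A| <= |C| and B^2 - 4AC = D, so the divisor bound
   gives h(D) << D^(1/2 + d), and the discriminants at hand are at most (2T)^2.

   Lower bound: a matrix g = (a, b; c, d) of trace t acts on Z^2, which becomes the lattice
   L = Zc + Z(e - a) in the quadratic field, e being a unit of trace t. If f^2 D = t^2 - 4,
   the ideal class of OL, with O the order of discriminant D, determines g up to
   conjugation in SL(2,Z) and up to O(f^4) choices. When |t| and |c| are at least T^(1-d),
   a conjugacy class contains T^(O(d)) matrices of norm at most T: modulo the action of g,
   the first columns of the conjugating matrices fall in O(log T) boxes in each of which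
   they have pairwise small determinants. The matrices with |t| or |c| small, or with f
   large (so that t - 2 or t + 2 has a large square factor), are negligible by the divisor
   bound. Hence at most T^(2 - eta + O(d)) of the >> T^2 matrices have
   h(D) < T^(1 - eta). *)
Require Import Defs.
From HB Require Import structures.
From mathcomp Require Import all_boot all_order all_algebra all_field.
From mathcomp Require Import finmap zify ring lra.
From mathcomp Require Import all_classical all_reals all_analysis.
Import Order.TTheory GRing.Theory Num.Theory.
Import numFieldNormedType.Exports.
Local Open Scope classical_set_scope.
Local Open Scope ring_scope.

Set Implicit Arguments.
Unset Strict Implicit.
Unset Printing Implicit Defensive.

(** A matrix of trace t supplies a unit of size at most |t| in its order, so for norms up to T the
    regulator is O(log T); as class number times regulator is about sqrt(D), class numbers ought to
    be nearly sqrt(D). The count replaces this analytic reason by a pigeonhole: there are O(T)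
    traces, T^(O(d)) values of f for each, and h(D) T^(O(d)) matrices for each pair (t, f). Traces
    with an abnormally small class number are not excluded one by one, which would call for a bound
    of Siegel type; they are only shown to carry few matrices. The unit enters when a conjugating
    matrix W is replaced by g^n W: this brings the ratio of two conjugate linear forms into [1,
    lam^2), lam being the large eigenvalue. The two size conditions come from this step: the
    determinants of first columns are of order T / |t|, and once the first column is known the
    remaining unipotent freedom is of order T / |c|. Both discriminants are treated at once, through
    the three properties collected in [order_of_trace]. *)

(** * Counting *)

(** Bounding the length of duplicate-free lists expresses a cardinality bound without assuming
    finiteness, which then comes out of the bound itself in [atmost_finite]. *)
Definition atmost {T : eqType} (A : set T) (n : nat) : Prop :=
  forall s : seq T, uniq s -> (forall x, x \in s -> A x) -> (size s <= n)%N.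

Lemma atmost_sub {T : eqType} (A B : set T) n :
  A `<=` B -> atmost B n -> atmost A n.
Proof. by move=> AB Bn s us sA; apply: Bn => // x /sA /AB. Qed.

Lemma atmost_leq {T : eqType} (A : set T) m n :
  (m <= n)%N -> atmost A m -> atmost A n.
Proof. by move=> mn Am s us sA; apply: leq_trans mn; apply: Am. Qed.

Lemma size_fiber {T L : eqType} (phi : T -> L) (s : seq T) (r : seq L) m :
  uniq r -> (forall x, x \in s -> phi x \in r) ->
  (forall l, (size [seq x <- s | phi x == l] <= m)%N) ->
  (size s <= size r * m)%N.
Proof.
elim: r s => [|l r IH] s /=.
  move=> _ sr _; case: s sr => // x s /(_ x); rewrite mem_head => /(_ erefl).
  by rewrite in_nil.
move=> /andP[lr ur] sr fib.
rewrite -(count_predC (fun x => phi x == l) s) mulSn -!size_filter.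
apply: leq_add; first exact: fib.
apply: IH => // [x|l'].
  rewrite mem_filter /= => /andP[xl /sr]; by rewrite inE (negPf xl).
rewrite -filter_predI; apply: leq_trans (fib l').
rewrite !size_filter; apply: sub_count => x /= /andP[] //.
Qed.

Lemma atmost_fiber {T L : eqType} (phi : T -> L) (A : set T) (B : set L) n m :
  atmost B n -> (forall x, A x -> B (phi x)) ->
  (forall l, B l -> atmost [set x | A x /\ phi x = l] m) -> atmost A (n * m).
Proof.
move=> Bn AB fib s us sA.
have [->//|s0] := eqVneq s [::].
have rn : (size (undup (map phi s)) <= n)%N.
  apply: Bn; first exact: undup_uniq.
  by move=> l; rewrite mem_undup => /mapP[x /sA Ax ->]; apply: AB.
apply: (@leq_trans (size (undup (map phi s)) * m)); last by rewrite leq_mul2r rn orbT.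
apply: (size_fiber (phi := phi)); first exact: undup_uniq.
  by move=> x xs; rewrite mem_undup map_f.
move=> l; have [ls|ls] := boolP (l \in map phi s).
  have Bl : B l by case/mapP: ls => x /sA Ax ->; apply: AB.
  apply: (fib l Bl); first exact: filter_uniq.
  by move=> x; rewrite mem_filter => /andP[/eqP ? /sA].
rewrite (_ : [seq x <- s | phi x == l] = [::]) //.
rewrite -(filter_pred0 s); apply: eq_in_filter => x xs /=.
by apply/negP => /eqP xl; case/negP: ls; rewrite -xl map_f.
Qed.

Lemma atmost_inj {T L : eqType} (phi : T -> L) (A : set T) (B : set L) n :
  atmost B n -> (forall x, A x -> B (phi x)) ->
  (forall x y, A x -> A y -> phi x = phi y -> x = y) -> atmost A n.
Proof.
move=> Bn AB inj; rewrite -[n]muln1.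
apply: (atmost_fiber (phi := phi) (B := B)) => // l _ [|x [|y s]] //= us sA.
have [Ax xl] := sA x (mem_head _ _).
have [Ay yl] : A y /\ phi y = l by apply: sA; rewrite !inE eqxx orbT.
move: us; rewrite (inj x y) ?xl ?yl// inE eqxx //.
Qed.

Lemma atmostX {T L : eqType} (A : set T) (B : set L) n m :
  atmost A n -> atmost B m -> atmost [set p : T * L | A p.1 /\ B p.2] (n * m).
Proof.
move=> An Bm; apply: (atmost_fiber (phi := fst) (B := A)) => // [[x y] []//|l Al].
apply: (atmost_inj (phi := snd) (B := B)) => // [[x y] [[]]//|].
by move=> [x y] [x' y'] [_ /= ->] [_ /= ->] ->.
Qed.

Lemma atmostU {T : eqType} (A B : set T) n m :
  atmost A n -> atmost B m -> atmost (A `|` B) (n + m).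
Proof.
move=> An Bm s us sAB.
rewrite -(count_predC (fun x => `[< A x >]) s) -!size_filter.
apply: leq_add; [apply: An|apply: Bm]; try exact: filter_uniq.
- by move=> x; rewrite mem_filter => /andP[/asboolP].
- by move=> x; rewrite mem_filter /= => /andP[/asboolPn nA /sAB[]].
Qed.

Lemma atmost_seq {T : eqType} (r : seq T) : atmost [set x | x \in r] (size r).
Proof. by move=> s us sr; apply: uniq_leq_size. Qed.

Lemma atmost_nat n : atmost [set i : nat | (i < n)%N] n.
Proof.
have := @atmost_seq nat (iota 0 n); rewrite size_iota; apply: atmost_sub => i /=.
by rewrite mem_iota.
Qed.

Lemma atmost_absz n : atmost [set i : int | (absz i <= n)%N] (n.*2.+1).
Proof.
apply: (atmost_inj (phi := fun i : int => absz (i + n%:Z)) (B := [set i | (i < n.*2.+1)%N])).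
- exact: atmost_nat.
- by move=> i /=; lia.
- by move=> x y /=; lia.
Qed.

Lemma atmost_bool : atmost [set: bool] 2.
Proof. by apply: (atmost_sub _ (@atmost_seq bool [:: true; false])) => -[]. Qed.

Lemma atmost_finite {T : choiceType} (A : set T) n : atmost A n ->
  finite_set A /\ (#|` fset_set A| <= n)%N.
Proof.
move=> An.
have fA : finite_set A.
  apply: contrapT => /(@infinite_set_fset _ _ n.+1)[B BA].
  by rewrite leqNgt ltnS An// => x xB; apply: BA.
by split=> //; apply: An; [exact: fset_uniq | move=> x; rewrite in_fset_set ?inE].
Qed.

Lemma atmost_fset {T : choiceType} (A : set T) :
  finite_set A -> atmost A #|` fset_set A|.
Proof.
by move=> fA s us sA; apply: uniq_leq_size => // x /sA Ax; rewrite in_fset_set// inE.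
Qed.

Lemma atmost_bigU {T I : eqType} (r : seq I) (F : I -> set T) (n : I -> nat) (A : set T) :
  (forall i, atmost (F i) (n i)) ->
  (forall x, A x -> exists2 i, i \in r & F i x) ->
  atmost A (\sum_(i <- r) n i).
Proof.
move=> Fn AF s us sA.
have {sA AF} : forall x, x \in s -> exists2 i, i \in r & F i x by move=> x /sA /AF.
elim: r s us => [|i r IH] s us sA.
  by case: s us sA => // x s _ /(_ x (mem_head _ _))[].
rewrite big_cons -(count_predC (fun x => `[< F i x >]) s) -!size_filter.
apply: leq_add.
  apply: Fn; first exact: filter_uniq.
  by move=> x; rewrite mem_filter => /andP[/asboolP].
apply: IH; first exact: filter_uniq.
move=> x; rewrite mem_filter /= => /andP[/asboolPn nF /sA[j]].
by rewrite inE => /orP[/eqP-> //|jr Fj]; exists j.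
Qed.

(** * Divisors and squares *)

(** With q the quotient of e by k, e + 1 <= k (q + 1) <= k 2^q, and the k-th power of 2^q is at most
    2^e. This is the cost of a small prime in the divisor bound. *)
Lemma pow_le_exp2 k e : (0 < k)%N -> (e.+1 ^ k <= k ^ k * 2 ^ e)%N.
Proof.
move=> k0; pose q := (e %/ k)%N.
have eq : (e.+1 <= k * 2 ^ q)%N.
  have h1 : (q.+1 <= 2 ^ q)%N by rewrite ltn_expl.
  have h2 : (e < k * q.+1)%N by rewrite mulnC; apply: ltn_ceil.
  by apply: leq_trans h2 _; rewrite leq_mul2l h1 orbT.
apply: (@leq_trans ((k * 2 ^ q) ^ k)); first by rewrite leq_exp2r.
by rewrite expnMn leq_mul2l -expnM leq_exp2l// leq_divM orbT.
Qed.

(** A divisor is determined by its p-adic valuation and its part prime to p. *)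
Lemma size_divisors_pfactor p e m : prime p -> ~~ (p %| m)%N -> (0 < m)%N ->
  (size (divisors (p ^ e * m)) <= e.+1 * size (divisors m))%N.
Proof.
move=> pp pm m0; have p0 := prime_gt0 pp.
have n0 : (0 < p ^ e * m)%N by rewrite muln_gt0 expn_gt0 p0.
have lm : logn p m = 0%N by apply/eqP; rewrite -leqn0 leqNgt logn_gt0 mem_primes pp m0.
suff H : atmost [set d | (d %| p ^ e * m)%N] (e.+1 * size (divisors m)).
  by apply: H; [exact: divisors_uniq | move=> d; rewrite -dvdn_divisors].
apply: (atmost_inj (phi := fun d => (logn p d, (d`_p^')%N))
   (B := [set x | (x.1 < e.+1)%N /\ x.2 \in divisors m])).
- apply: (@atmostX _ _ [set i | (i < e.+1)%N] [set d | d \in divisors m]).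
    exact: atmost_nat.
  exact: atmost_seq.
- move=> d /= dn; split.
    have := dvdn_leq_log p n0 dn; rewrite lognM ?expn_gt0 ?p0// lm addn0 pfactorK//.
  rewrite -dvdn_divisors//.
  have := partn_dvd (p^')%N n0 dn.
  have pe : ((p ^ e)`_p^' = 1)%N by apply: part_p'nat; rewrite pnatNK pnatX pnat_id.
  have -> : ((p ^ e * m)`_p^' = m)%N; last by [].
  by rewrite partnM ?expn_gt0 ?p0// pe mul1n part_pnat_id// p'natE.
- move=> x y /= xn yn [lxy pxy].
  have x0 := dvdn_gt0 n0 xn; have y0 := dvdn_gt0 n0 yn.
  by rewrite -(partnC p x0) -(partnC p y0) pxy !p_part lxy.
Qed.

(** Strip off the least prime factor p, with exponent e. If p >= 2^k then (e + 1)^k <= 2^(e k) <=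
    p^e and nothing is lost; if p < 2^k the loss is a factor k^k, paid by removing p from the list
    [r] of small primes still allowed. *)
Lemma size_divisors_bound_small k (r : seq nat) n : (0 < k)%N -> (0 < n)%N ->
  (forall p, prime p -> (p %| n)%N -> (p < 2 ^ k)%N -> p \in r) ->
  (size (divisors n) ^ k <= (k ^ k) ^ size r * n)%N.
Proof.
move=> k0; have kk0 : (0 < k ^ k)%N by rewrite expn_gt0 k0.
elim/ltn_ind: n r => n IH r n0 nr.
have [->|n1] := eqVneq n 1%N; first by rewrite muln1 /= exp1n expn_gt0 kk0.
have {}n1 : (1 < n)%N by case: n n0 n1 {IH nr} => [|[]].
pose p := pdiv n; have pp : prime p by apply: pdiv_prime.
have pn : (p %| n)%N by apply: pdiv_dvd.
have [m pm nE] := pfactor_coprime pp n0.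
set e := logn p n in nE.
have m0 : (0 < m)%N by move: n0; rewrite nE muln_gt0 => /andP[].
have e0 : (0 < e)%N by rewrite logn_gt0 mem_primes pp n0.
have pm' : ~~ (p %| m)%N by rewrite -prime_coprime.
have mn : (m < n)%N by rewrite nE -{1}[m]muln1 ltn_pmul2l// -(exp1n e) ltn_exp2r// prime_gt1.
have mr (r' : seq nat) : (forall q, q \in r -> q != p -> q \in r') ->
    forall q, prime q -> (q %| m)%N -> (q < 2 ^ k)%N -> q \in r'.
  move=> rr' q qp qm q2; apply: rr'.
    by apply: nr => //; rewrite nE; apply: dvdn_mulr.
  by apply: contraNneq pm' => <-.
have tn : (size (divisors n) ^ k <= e.+1 ^ k * size (divisors m) ^ k)%N.
  by rewrite -expnMn leq_exp2r// nE mulnC size_divisors_pfactor.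
apply: leq_trans tn _.
have [pk|pk] := leqP (2 ^ k) p.
  have h1 : (e.+1 ^ k <= p ^ e)%N.
    apply: (@leq_trans ((2 ^ e) ^ k)); first by rewrite leq_exp2r// ltn_expl.
    by rewrite -expnM mulnC expnM leq_exp2r.
  have h2 := IH m mn r m0 (mr r (fun q qr _ => qr)).
  by apply: leq_trans (leq_mul h1 h2) _; rewrite mulnCA nE [(m * _)%N]mulnC.
have pr : p \in r by apply: nr.
have h1 : (e.+1 ^ k <= k ^ k * p ^ e)%N.
  apply: leq_trans (pow_le_exp2 e k0) _.
  by rewrite leq_mul2l leq_exp2r// prime_gt1// orbT.
have h2 := IH m mn (rem p r) m0 (mr _ _).
apply: leq_trans (leq_mul h1 (h2 _)) _.
  move=> q qr qp; move: qr; rewrite (perm_mem (perm_to_rem pr)) inE (negPf qp) //.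
rewrite size_rem// mulnACA -expnS prednK//; last by case: (r) pr.
by rewrite nE [(m * _)%N]mulnC.
Qed.

Lemma size_divisors_bound k : (0 < k)%N ->
  exists C, forall n, (0 < n)%N -> (size (divisors n) ^ k <= C * n)%N.
Proof.
move=> k0; exists ((k ^ k) ^ size (iota 0 (2 ^ k)))%N => n n0.
by apply: size_divisors_bound_small => // p _ _ pk; rewrite mem_iota.
Qed.

Lemma int_sign_absz_inj (x y : int) : (x < 0) = (y < 0) -> `|x|%N = `|y|%N -> x = y.
Proof. by case: (ltrP x 0) => ?; case: (ltrP y 0) => ? //; lia. Qed.

Lemma atmost_factor_pairs (n : int) : n != 0 ->
  atmost [set p : int * int | p.1 * p.2 = n] (2 * size (divisors `|n|%N)).
Proof.
move=> n0.
apply: (atmost_inj (phi := fun p => (p.1 < 0, `|p.1|%N))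
  (B := [set x | [set: bool] x.1 /\ x.2 \in divisors `|n|%N])).
- apply: (atmostX (B := [set d | d \in divisors `|n|%N])).
    exact: atmost_bool.
  exact: atmost_seq.
- move=> [x y] /= xy; split=> //; rewrite -dvdn_divisors ?absz_gt0//.
  by rewrite -xy abszM dvdn_mulr.
- move=> [x y] [x' y'] /= xy xy' [s a].
  have xx : x = x' by exact: (int_sign_absz_inj s a).
  have x0 : x != 0 by apply: contraNneq n0 => x0; rewrite -xy x0 mul0r.
  by subst x'; congr pair; apply: (mulfI x0); rewrite xy.
Qed.

(** Telescoping, from 1/(q+1)^2 <= 1/q - 1/(q+1). *)
Lemma sum_inv_sq_le (F Q : nat) : (0 < F)%N -> (F <= Q)%N ->
  \sum_(F <= q < Q) (q.+1%:R ^+ 2)^-1 <= F%:R^-1 - Q%:R^-1 :> rat.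
Proof.
move=> F0; elim: Q => [|Q IH]; first by rewrite leqn0 => /eqP F00; rewrite F00 in F0.
rewrite leq_eqVlt => /orP[/eqP <-|FQ]; first by rewrite big_geq// subrr.
rewrite big_nat_recr//=.
have {}IH := IH FQ; have Q0 : (0 : rat) < Q%:R by rewrite ltr0n (leq_trans F0).
have Q1 : (0 : rat) < Q.+1%:R by rewrite ltr0n.
suff H : (Q.+1%:R ^+ 2)^-1 <= Q%:R^-1 - Q.+1%:R^-1 :> rat.
  by apply: le_trans (lerD IH H) _; rewrite addrA subrK.
have -> : Q%:R^-1 - Q.+1%:R^-1 = (Q%:R * Q.+1%:R)^-1 :> rat.
  by rewrite -natr1; field; rewrite natr1 !gt_eqF.
rewrite lef_pV2 ?posrE ?exprn_gt0 ?mulr_gt0// expr2 ler_pM2r//.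
by rewrite ler_nat.
Qed.

Lemma sum_div_sq_le (X F Q : nat) : (0 < F)%N ->
  (F * \sum_(F <= q < Q) X %/ q.+1 ^ 2 <= X)%N.
Proof.
move=> F0; have [QF|FQ] := leqP Q F; first by rewrite big_geq// muln0.
have FF : (0 : rat) < F%:R by rewrite ltr0n.
have := sum_inv_sq_le F0 (ltnW FQ).
rewrite -(ler_nat rat) natrM => S.
rewrite -ler_pdivlMl// natr_sum.
apply: (@le_trans _ _ (\sum_(F <= q < Q) X%:R * (q.+1%:R ^+ 2)^-1)).
  apply: ler_sum => q _; rewrite ler_pdivlMr ?exprn_gt0 ?ltr0n//.
  by rewrite -natrX -natrM ler_nat leq_divM.
rewrite -mulr_sumr mulrC ler_wpM2r ?ler0n//.
by apply: le_trans S _; rewrite lerBlDr lerDl invr_ge0 ler0n.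
Qed.

Lemma atmost_multiples (m X : nat) : (0 < m)%N ->
  atmost [set x : int | [/\ x != 0, (m %| `|x|)%N & (`|x| <= X)%N]] (2 * (X %/ m)).
Proof.
move=> m0.
apply: (atmost_inj (phi := fun x : int => (x < 0, (`|x| %/ m).-1))
  (B := [set x | [set: bool] x.1 /\ (x.2 < X %/ m)%N])).
- apply: (atmostX (B := [set i | (i < X %/ m)%N])); first exact: atmost_bool.
  exact: atmost_nat.
- move=> x /= [x0 mx xX]; split=> //.
  have h1 : (0 < `|x| %/ m)%N by rewrite divn_gt0// dvdn_leq// absz_gt0.
  by rewrite prednK// leq_div2r.
- move=> x y [x0 mx _] [y0 my _] /= [s e].
  have hx : (0 < `|x| %/ m)%N by rewrite divn_gt0// dvdn_leq// absz_gt0.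
  have hy : (0 < `|y| %/ m)%N by rewrite divn_gt0// dvdn_leq// absz_gt0.
  have : `|x|%N = `|y|%N by rewrite -(divnK mx) -(divnK my); congr muln; lia.
  exact: int_sign_absz_inj.
Qed.

(** * Traces with a large square factor *)

(** Take for q the larger of gcd(f, m) and gcd(f, n). Their product is divisible by f, so f <= q^2.
    Since gcd(m, n) divides 4, the square of u = gcd(f, m) has at most a factor 16 in common with n,
    and u^2 dividing m n then divides 16 m; likewise for n. *)
Lemma square_dvd_split (f m n : nat) : (0 < m)%N -> (0 < n)%N ->
  (f ^ 2 %| m * n)%N -> (gcdn m n %| 4)%N ->
  exists q, [/\ (f <= q ^ 2)%N & (q ^ 2 %| 16 * m)%N || (q ^ 2 %| 16 * n)%N].
Proof.
move=> m0 n0 fmn g4.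
have half (a b : nat) : (0 < a)%N -> (f ^ 2 %| a * b)%N -> (gcdn a b %| 4)%N ->
    (gcdn f a ^ 2 %| 16 * a)%N.
  move=> a0 fab gab; set u := gcdn f a.
  have ub : (gcdn u b %| 4)%N.
    by apply: dvdn_trans gab; rewrite dvdn_gcd dvdn_gcdr andbT (dvdn_trans (dvdn_gcdl _ _))// dvdn_gcdr.
  have uab : (u ^ 2 %| a * b)%N by apply: dvdn_trans fab; rewrite dvdn_exp2r// dvdn_gcdl.
  have ub2 : (gcdn (u ^ 2) b %| 16)%N.
    apply: (@dvdn_trans (gcdn u b ^ 2)); last by rewrite (_ : 16 = 4 ^ 2)%N// dvdn_exp2r.
    have [->|u0] := eqVneq u 0%N; first by rewrite !gcd0n dvdn_mulr.
    have g0 : (0 < gcdn u b)%N by rewrite gcdn_gt0 lt0n u0.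
    have [u' uE] : exists u', u = (u' * gcdn u b)%N by apply/dvdnP; rewrite dvdn_gcdl.
    have [b' bE] : exists b', b = (b' * gcdn u b)%N by apply/dvdnP; rewrite dvdn_gcdr.
    move: uE bE g0; set d := gcdn u b => uE bE d0.
    have cop : coprime u' b'.
      rewrite /coprime -(eqn_pmul2r d0) muln_gcdl -uE -bE mul1n //.
    rewrite uE bE expnMn (_ : d ^ 2 = d * d)%N// mulnA -muln_gcdl dvdn_pmul2r//.
    have cop2 : coprime (u' ^ 2) b' by rewrite coprimeXl.
    by rewrite gcdnC Gauss_gcdr 1?coprime_sym// dvdn_gcdr.
  have : (u ^ 2 %| gcdn (a * u ^ 2) (a * b))%N by rewrite dvdn_gcd uab dvdn_mull.
  rewrite -muln_gcdr => h; apply: dvdn_trans h _.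
  by rewrite mulnC dvdn_mul.
have hm := half m n m0 fmn g4.
have hn : (gcdn f n ^ 2 %| 16 * n)%N by apply: (half n m); rewrite // 1?mulnC 1?gcdnC.
have fle : (f <= gcdn f m * gcdn f n)%N.
  apply: dvdn_leq.
    have f0 : (0 < f)%N.
      rewrite lt0n; apply: contraTneq fmn => ->.
      by rewrite -[(0 ^ 2)%N]/0%N dvd0n muln_eq0 negb_or -!lt0n m0.
    by rewrite muln_gt0 !gcdn_gt0 f0.
  rewrite muln_gcdl !muln_gcdr !dvdn_gcd dvdn_mulr// dvdn_mulr// dvdn_mull//=.
  by rewrite (dvdn_trans _ fmn)// dvdn_mulr.
have [mn|nm] := leqP (gcdn f m) (gcdn f n).
  by exists (gcdn f n); rewrite hn orbT; split=> //; apply: leq_trans fle _; rewrite leq_mul2r mn orbT.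
exists (gcdn f m); rewrite hm; split=> //; apply: leq_trans fle _.
by rewrite leq_mul2l (ltnW nm) orbT.
Qed.

(** Factor t^2 - 4 as (t - 2)(t + 2): the common divisors of the two factors divide their difference
    4. *)
Lemma trace_square_dvd (t : int) (f : nat) : (2 < `|t|)%N ->
  (f ^ 2 %| `|(t ^+ 2 - 4)%R|)%N ->
  exists q, [/\ (f <= q ^ 2)%N &
     (q ^ 2 %| `|(16 * (t - 2))%R|)%N || (q ^ 2 %| `|(16 * (t + 2))%R|)%N].
Proof.
move=> t2; rewrite (_ : t ^+ 2 - 4 = (t - 2) * (t + 2)); last by ring.
rewrite abszM => fd.
have [] := square_dvd_split _ _ fd _.
- by clear -t2; lia.
- by clear -t2; lia.
- have : (gcdz (t - 2) (t + 2) %| (t + 2) - (t - 2))%Z.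
    by apply: rpredB; rewrite ?dvdz_gcdl ?dvdz_gcdr.
  by rewrite (_ : t + 2 - (t - 2) = 4)//; ring.
by move=> q; rewrite !abszM => -[? ?]; exists q.
Qed.

Definition large_square_traces (X F : nat) : set int :=
  [set t | [/\ (2 < `|t|)%N, (`|t| <= X)%N &
    exists f, (F ^ 2 < f)%N /\ (f ^ 2 %| `|(t ^+ 2 - 4)%R|)%N]].

(** A square divisor f^2 with f > F^2 forces q^2 to divide 16 (t - 2) or 16 (t + 2) for some q > F.
    These are nonzero and at most Y in absolute value, so each q accounts for at most 4 Y / q^2
    traces, and the sum over q > F is at most 4 Y / F. In the sum and in [S] the index is q - 1. *)
Lemma atmost_large_square_traces (X F : nat) : (0 < F)%N ->
  exists n, (F * n <= 64 * (X + 2))%N /\ atmost (large_square_traces X F) n.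
Proof.
move=> F0; pose Y := (16 * (X + 2))%N.
exists (4 * \sum_(F <= q < Y.+1) Y %/ q.+1 ^ 2)%N; split.
  rewrite mulnCA (_ : 64 * (X + 2) = 4 * Y)%N; last by rewrite /Y mulnA.
  by rewrite leq_mul2l sum_div_sq_le.
rewrite big_distrr/=.
pose S (q : nat) (e : int) := [set t : int | [/\ 16 * (t + e) != 0, (q.+1 ^ 2 %| `|(16 * (t + e))%R|)%N
   & (`|(16 * (t + e))%R| <= Y)%N]].
have SA q e : atmost (S q e) (2 * (Y %/ q.+1 ^ 2)).
  apply: (atmost_inj (phi := fun t => 16 * (t + e))); first exact: (@atmost_multiples (q.+1 ^ 2) Y).
    by move=> t.
  by move=> x y _ _; clear; lia.
apply: (@atmost_bigU _ _ _ (fun q => S q (-2) `|` S q 2)).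
  by move=> q; rewrite (_ : 4 = 2 + 2)%N// mulnDl; apply: atmostU.
move=> t [t2 tX [f [Ff fd]]].
have [q [fq qd]] := trace_square_dvd t2 fd.
have Fq : (F < q)%N.
  by rewrite ltnNge; apply/negP => qF; move: Ff; rewrite ltnNge (leq_trans fq)// leq_exp2r.
have q0 : (0 < q)%N by apply: leq_ltn_trans Fq.
have Yq e : (`|e| <= 2)%N -> (q ^ 2 %| `|(16 * (t + e))%R|)%N -> S q.-1 e t /\ (q <= Y)%N.
  move=> e2 qe; have h1 : 16 * (t + e) != 0 by clear -t2 e2; lia.
  have h2 : (`|(16 * (t + e))%R| <= Y)%N by rewrite /Y; clear -tX e2; lia.
  split; first by split=> //; rewrite prednK.
  apply: leq_trans h2; apply: (@leq_trans (q ^ 2)); first by rewrite leq_pmulr.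
  by apply: dvdn_leq => //; rewrite absz_gt0.
have mem : (q <= Y)%N -> q.-1 \in index_iota F Y.+1.
  clearbody Y; move=> qY; rewrite mem_index_iota; clear -Fq q0 qY; lia.
case/orP: qd => /Yq[] // St qY; exists q.-1; rewrite ?mem//; by [left|right].
Qed.

(** * Counting in SL(2,Z) *)

Definition SL2Z_box (N : nat) : set 'M[int]_2 :=
  [set g | \det g = 1 /\ forall i j, (`|g i j| <= N)%N].

Lemma ord2P (i : 'I_2) : i = 0 \/ i = 1.
Proof. by case: i => [[|[|]]]// p; [left|right]; apply: val_inj. Qed.

Lemma mx2_eq (A : Type) (g g' : 'M[A]_2) :
  g 0 0 = g' 0 0 -> g 0 1 = g' 0 1 -> g 1 0 = g' 1 0 -> g 1 1 = g' 1 1 -> g = g'.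
Proof.
move=> h00 h01 h10 h11; apply/matrixP => i j.
by case: (ord2P i) => ->; case: (ord2P j) => ->.
Qed.

Lemma big_ord2 (V : nmodType) (F : 'I_2 -> V) : \sum_i F i = F 0 + F 1.
Proof. by rewrite !big_ord_recl big_ord0 addr0; congr (_ + F _); apply: val_inj. Qed.

Lemma det2 (R : comPzRingType) (A : 'M[R]_2) : \det A = A 0 0 * A 1 1 - A 0 1 * A 1 0.
Proof.
rewrite (expand_det_row _ 0) big_ord2 /cofactor !det_mx11 !mxE/=.
rewrite addn0 expr0 add0n expr1 mul1r mulN1r mulrN.
by congr (_ * A _ _ - _ * A _ _); apply: val_inj.
Qed.

Lemma trace2 (R : pzSemiRingType) (A : 'M[R]_2) : \tr A = A 0 0 + A 1 1.
Proof. exact: big_ord2. Qed.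

Definition mx2 (A : Type) (a b c d : A) : 'M[A]_2 :=
  \matrix_(i, j) (if i == 0 then if j == 0 then a else b else if j == 0 then c else d).

(** Each coprime pair (a, c) in [1, N]^2 is the first column of a matrix in the box. The other pairs
    share a divisor q >= 2, so they number at most N^2 times the sum of 1/q^2 over q >= 2, which is
    at most 1/4 + 1/2. *)
Lemma SL2Z_box_lower (N : nat) :
  exists s : seq 'M[int]_2, [/\ uniq s, forall g, g \in s -> SL2Z_box N g &
    (N ^ 2 <= 4 * size s)%N].
Proof.
pose P := [seq (a, c) | a <- iota 1 N, c <- iota 1 N].
have uP : uniq P by apply: allpairs_uniq; rewrite ?iota_uniq// => -[? ?] [? ?].
have sP : size P = (N ^ 2)%N by rewrite size_allpairs !size_iota.
have memP x : x \in P -> [/\ (0 < x.1)%N, (x.1 <= N)%N, (0 < x.2)%N & (x.2 <= N)%N].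
  move=> /allpairsP[[a c] /= [+ + ->]] /=; rewrite !mem_iota => /andP[a1 a2] /andP[c1 c2]; by split; lia.
pose C := [seq x <- P | coprime x.1 x.2].
pose D := [seq x <- P | ~~ coprime x.1 x.2].
have CD : (size C + size D = N ^ 2)%N by rewrite !size_filter count_predC.
have Dle : (4 * size D <= 3 * N ^ 2)%N.
  have : (size D <= \sum_(1 <= q < N.+1) (N %/ q.+1) * (N %/ q.+1))%N.
    suff H : atmost [set x | x \in D] (\sum_(1 <= q < N.+1) (N %/ q.+1) * (N %/ q.+1)).
      by apply: H => //; apply: filter_uniq.
    pose S q := [set x : nat * nat | [/\ (q.+1 %| x.1)%N, (q.+1 %| x.2)%N & x \in P]].
    apply: (@atmost_bigU _ _ _ S).
      move=> q; apply: (atmost_inj (phi := fun x : nat * nat => ((x.1 %/ q.+1).-1, (x.2 %/ q.+1).-1))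
        (B := [set x | (x.1 < N %/ q.+1)%N /\ (x.2 < N %/ q.+1)%N])).
      - apply: (@atmostX _ _ [set i | (i < N %/ q.+1)%N] [set i | (i < N %/ q.+1)%N]); exact: atmost_nat.
      - move=> [a c] [/= qa qc /memP[/= a0 aN c0 cN]].
        by rewrite !prednK ?divn_gt0// ?[(q < a)%N]dvdn_leq// ?[(q < c)%N]dvdn_leq// !leq_div2r.
      - move=> [a c] [a' c'] [/= qa qc /memP[/= a0 aN c0 cN]] [/= qa' qc' /memP[/= a0' aN' c0' cN']] [ea ec].
        rewrite -(divnK qa) -(divnK qc) -(divnK qa') -(divnK qc').
        congr (_ * _, _ * _)%N; rewrite -[LHS]prednK ?divn_gt0 ?[(q < _)%N]dvdn_leq//.
          by rewrite ea prednK ?divn_gt0 ?[(q < _)%N]dvdn_leq.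
        by rewrite ec prednK ?divn_gt0 ?[(q < _)%N]dvdn_leq.
    move=> [a c] /=; rewrite mem_filter /= => /andP[nc xP].
    have [/= a0 aN c0 cN] := memP _ xP.
    have g0 : (0 < gcdn a c)%N by rewrite gcdn_gt0 a0.
    have g1 : (1 < gcdn a c)%N by rewrite ltn_neqAle g0 eq_sym nc.
    exists (gcdn a c).-1; last by split; rewrite //= prednK// ?dvdn_gcdl ?dvdn_gcdr.
    have : (gcdn a c <= N)%N by rewrite (leq_trans _ aN)// dvdn_leq// dvdn_gcdl.
    by rewrite mem_index_iota; move: g1; move: (gcdn a c) => q; clear; lia.
  rewrite -(ler_nat rat) => D1; rewrite -(ler_nat rat) !natrM.
  have D2 : (\sum_(1 <= q < N.+1) (N %/ q.+1) * (N %/ q.+1))%:R <=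
      (N ^ 2)%:R * \sum_(1 <= q < N.+1) (q.+1%:R ^+ 2)^-1 :> rat.
    rewrite natr_sum mulr_sumr; apply: ler_sum => q _.
    rewrite ler_pdivlMr ?exprn_gt0 ?ltr0n// -natrX -natrM ler_nat.
    by rewrite -[(N %/ q.+1 * (N %/ q.+1))%N]/((N %/ q.+1) ^ 2)%N -expnMn leq_exp2r// leq_divM.
  have D3 : \sum_(1 <= q < N.+1) (q.+1%:R ^+ 2)^-1 <= 3 / 4 :> rat.
    have [N0|N0] := leqP N 0; first by rewrite big_geq ?ltnS// divr_ge0.
    rewrite big_ltn ?ltnS//.
    have h1 : (2%:R ^+ 2)^-1 <= 4^-1 :> rat by rewrite -natrX.
    have h2 : \sum_(2 <= q < N.+1) (q.+1%:R ^+ 2)^-1 <= 2^-1 :> rat.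
      have [N1|N1] := leqP N 1; first by rewrite big_geq ?ltnS// invr_ge0.
      apply: le_trans (@sum_inv_sq_le 2 N.+1 isT (leqW N1)) _.
      by rewrite lerBlDr lerDl invr_ge0 ler0n.
    apply: le_trans (lerD h1 h2) _; lra.
  have D4 : (N ^ 2)%:R * \sum_(1 <= q < N.+1) (q.+1%:R ^+ 2)^-1 <= (N ^ 2)%:R * (3 / 4) :> rat.
    by rewrite ler_wpM2l ?ler0n.
  move: (le_trans D1 (le_trans D2 D4)); lra.
have ex (x : nat * nat) : x \in C -> exists g : 'M[int]_2, SL2Z_box N g /\ (g 0 0, g 1 0) = (x.1%:Z, x.2%:Z).
  case: x => a c; rewrite mem_filter /= => /andP[cop /memP[/= a0 aN c0 cN]].
  (* Bezout gives km a = kn c + 1 with kn < a; then km <= c, so the second column (kn, km) stays in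
     the box too. *)
  case: (egcdnP c a0) => km kn; rewrite (eqP cop) muln1 => e lt.
  have kmc : (km <= c)%N.
    rewrite leqNgt; apply/negP => h1.
    have h2 : (c.+1 * a <= km * a)%N by rewrite leq_mul2r h1 orbT.
    have h3 : (kn.+1 * c <= a * c)%N by rewrite leq_mul2r lt orbT.
    by clear -a0 c0 e h2 h3; lia.
  exists (mx2 a%:Z kn%:Z c%:Z km%:Z); split; last by rewrite !mxE.
  split; first by rewrite det2 !mxE/=; lia.
  by move=> i j; case: (ord2P i) => ->; case: (ord2P j) => ->; rewrite mxE/=; lia.
have /choice[g gP] : forall x, exists g : 'M[int]_2, x \in C -> SL2Z_box N g /\ (g 0 0, g 1 0) = (x.1%:Z, x.2%:Z).
  move=> x; have [xC|xC] := boolP (x \in C); last by exists 0.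
  by have [g ?] := ex x xC; exists g.
exists (map g C); split.
- rewrite map_inj_in_uniq ?filter_uniq// => x y /gP[_ ex1] /gP[_ ey1] e.
  by move: ex1 ey1; rewrite e => -> [/= e1 e2]; case: x y e1 e2 {e} => [? ?] [? ?] /= [->] [->].
- by move=> _ /mapP[x /gP[? _] ->].
- by rewrite size_map; move: CD Dle; move: (size C) (size D) (N ^ 2)%N => x y z; clear; lia.
Qed.

(** The trace t and the entry a determine d = t - a and the product b c = a d - 1. This product is
    nonzero because a d = 1 would give |t| = 2, so the divisor bound limits the pairs (b, c). *)
Lemma atmost_SL2Z_trace (N M n : nat) (B : set int) : atmost B n ->
  (forall t, B t -> (2 < `|t|)%N) ->
  (forall m, (0 < m <= (N ^ 2).+1)%N -> (size (divisors m) <= M)%N) ->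
  atmost [set g | SL2Z_box N g /\ B (\tr g)] (n * N.*2.+1 * (2 * M)).
Proof.
move=> Bn B2 MP.
apply: (atmost_fiber (phi := fun g : 'M[int]_2 => (\tr g, g 0 0))
  (B := [set x | B x.1 /\ (`|x.2| <= N)%N])).
- exact: (atmostX Bn (@atmost_absz N)).
- by move=> g [[_ gN] Bg]; split=> //=.
- move=> [t a] [/= Bt aN].
  pose m := a * (t - a) - 1.
  have [dN|dN] := leqP `|t - a| N; last first.
    move=> [|g s] //= _ /(_ g (mem_head _ _))[[[_ gN] _] [e1 e2]].
    by move: dN (gN 1 1); rewrite -e1 -e2 trace2 addrAC subrr add0r ltnNge => /negP.
  have m0 : m != 0.
    apply/eqP => m0; have := B2 _ Bt; have : a * (t - a) = 1 by rewrite /m in m0; lia.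
    move=> /(congr1 absz); rewrite abszM => /eqP; rewrite muln_eq1 => /andP[/eqP h1 /eqP h2].
    by clear -h1 h2; lia.
  have mN : (`|m| <= (N ^ 2).+1)%N.
    have h2 : (`|a| * `|(t - a)%R| <= N ^ 2)%N by rewrite leq_mul.
    by move: h2; rewrite -abszM /m; lia.
  apply: (atmost_leq (m := 2 * size (divisors `|m|))).
    by rewrite leq_mul2l/= MP// mN absz_gt0 m0.
  apply: (atmost_inj (phi := fun g : 'M[int]_2 => (g 0 1, g 1 0)) (atmost_factor_pairs m0)).
    by move=> g [[[]]]; rewrite det2 /m => h1 _ _ [<- <-] /=; rewrite -h1 trace2; ring.
  move=> g g' [[[_ _] _] [h1 h2]] [[[_ _] _] [h1' h2']] [e1 e2].
  apply: mx2_eq; rewrite ?h2 ?h2'// -[RHS](addKr (g' 0 0)) -[LHS](addKr (g 0 0)) -!trace2.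
  by rewrite h1 h1' h2 h2'.
Qed.

(** The entries b and c determine a d = 1 + b c. When this is nonzero the divisor bound applies; the
    matrices with a d = 0 are counted apart. *)
Lemma atmost_SL2Z_small_lower_left (N M C : nat) :
  (forall m, (0 < m <= (N ^ 2).+1)%N -> (size (divisors m) <= M)%N) ->
  atmost [set g | SL2Z_box N g /\ (`|g 1%R 0%R| <= C)%N]
    (N.*2.+1 * C.*2.+1 * (2 * M) + 6 * N.*2.+1).
Proof.
move=> MP.
pose A1 := [set g | (SL2Z_box N g /\ (`|g 1%R 0%R| <= C)%N) /\ 1 + g 0 1 * g 1 0 != 0].
pose A2 := [set g : 'M[int]_2 | SL2Z_box N g /\ 1 + g 0 1 * g 1 0 = 0].
apply: (atmost_sub (B := A1 `|` A2)).
  move=> g [g1 g2]; have [e|e] := eqVneq (1 + g 0 1 * g 1 0) 0; first by right.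
  by left.
apply: atmostU.
- apply: (atmost_fiber (phi := fun g : 'M[int]_2 => (g 0 1, g 1 0))
    (B := [set x | (`|x.1| <= N)%N /\ (`|x.2| <= C)%N])).
  + exact: (atmostX (@atmost_absz N) (@atmost_absz C)).
  + by move=> g [[[_ gN] gC] _]; split=> //=.
  + move=> [b c] [/= bN cC].
    have [m0|m0] := eqVneq (1 + b * c) 0.
      by move=> [|g s] //= _ /(_ g (mem_head _ _))[[_ +] [e1 e2]]; rewrite e1 e2 m0 eqxx.
    have [cN|cN] := leqP `|c| N; last first.
      by move=> [|g s] //= _ /(_ g (mem_head _ _))[[[[_ gN] _] _] [_ e]]; move: cN (gN 1 0); rewrite e ltnNge => /negP.
    apply: (atmost_leq (m := 2 * size (divisors `|1 + b * c|))).
      rewrite leq_mul2l/= MP// absz_gt0 m0 /=.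
      have : (`|(b * c)%R| <= N ^ 2)%N by rewrite abszM leq_mul.
      by move: (b * c) (N ^ 2)%N => x y; clear; lia.
    apply: (atmost_inj (phi := fun g : 'M[int]_2 => (g 0 0, g 1 1)) (atmost_factor_pairs m0)).
      by move=> g [[[[]]]]; rewrite det2 => h1 _ _ _ [<- <-] /=; rewrite -h1; ring.
    move=> g g' [_ [h1 h2]] [_ [h1' h2']] [e1 e2].
    by apply: mx2_eq => //; rewrite ?h1 ?h2.
(* Here a d = 0 and b c = -1. Such a matrix is known from whether a vanishes, from c, which lies in
   [-1, 1], and from the trace, which is the other diagonal entry. *)
- rewrite (_ : 6 = 2 * 1.*2.+1)%N//.
  apply: (atmost_inj (phi := fun g : 'M[int]_2 => (g 0 0 == 0, g 1 0, g 0 0 + g 1 1))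
    (B := [set x | ([set: bool] x.1.1 /\ (`|x.1.2| <= 1)%N) /\ (`|x.2| <= N)%N])).
  + exact: (atmostX (atmostX atmost_bool (@atmost_absz 1)) (@atmost_absz N)).
  + move=> g [[+ gN] e]; rewrite det2 => h1 /=; split.
      split=> //; move/eqP: e; rewrite addrC addr_eq0 => /eqP /(congr1 absz).
      by rewrite abszM => /eqP; rewrite muln_eq1 => /andP[_ /eqP ->].
    have := gN 0 0; have := gN 1 1; have : g 0 0 * g 1 1 = 0 by rewrite -[LHS](subrK (g 0 1 * g 1 0)) h1.
    by move=> /eqP; rewrite mulf_eq0 => /orP[] /eqP ->; rewrite ?add0r ?addr0.
  + move=> g g' [[+ _] e] [[+ _] e']; rewrite !det2 => h1 h1' [a0 c a].
    have ad : g 0 0 * g 1 1 = 0 by rewrite -[LHS](subrK (g 0 1 * g 1 0)) h1.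
    have ad' : g' 0 0 * g' 1 1 = 0 by rewrite -[LHS](subrK (g' 0 1 * g' 1 0)) h1'.
    have cc : g 1 0 != 0 by apply/eqP => c0; move: e; rewrite c0 mulr0.
    have bb : g 0 1 = g' 0 1 by apply: (mulIf cc); rewrite {2}c; apply: (addrI 1); rewrite e e'.
    move: a0; have [z|z] := eqVneq (g 0 0) 0; have [z'|z'] := eqVneq (g' 0 0) 0 => // _.
      by apply: mx2_eq; rewrite ?z ?z'//; move: a; rewrite z z' !add0r.
    have d0 : g 1 1 = 0 by apply: (mulfI z); rewrite mulr0.
    have d0' : g' 1 1 = 0 by apply: (mulfI z'); rewrite mulr0.
    by apply: mx2_eq; rewrite ?d0 ?d0'//; move: a; rewrite d0 d0' !addr0.
Qed.

(** * Elements of bounded norm in a conjugacy class *)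

Definition SL2Z_conj (g0 g : 'M[int]_2) : Prop :=
  exists W : 'M[int]_2, \det W = 1 /\ W *m g = g0 *m W.

Lemma dyadic_between (R : realType) (J : nat) (x y : R) : 0 < y -> y <= x -> x < 2 ^+ J * y ->
  exists j, [/\ (j < J)%N, 2 ^+ j * y <= x & x < 2 ^+ j.+1 * y].
Proof.
move=> y0 yx; elim: J => [|J IH] xJ; first by move: xJ; rewrite expr0 mul1r ltNge yx.
have [/IH[j [jJ h1 h2]]|h] := ltrP x (2 ^+ J * y); last by exists J.
by exists j; rewrite ltnW.
Qed.

Section QuadraticUnit.
Variables (R : realType) (t : int).
Hypothesis t2 : (2 < `|t|)%N.

(** The roots of x^2 - t x + 1, with [lam] the root farther from 0: |lam| = (|t| + s) / 2 where s,
    the square root of t^2 - 4, is less than |t|. *)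
Lemma quadratic_unit : exists lam lam' : R,
  [/\ lam + lam' = t%:~R, lam * lam' = 1, 1 < `|lam| & `|lam| < `|t%:~R|].
Proof.
have tR : (2 : R) < `|t%:~R|.
  by rewrite -intr_norm -[2]/(2%:Z%:~R) ltr_int; clear -t2; lia.
pose s : R := Num.sqrt (t%:~R ^+ 2 - 4).
have s2 : s ^+ 2 = t%:~R ^+ 2 - 4.
  rewrite sqr_sqrtr// subr_ge0 -[t%:~R ^+ 2]real_normK ?num_real//.
  rewrite (_ : 4 = 2 ^+ 2); last by rewrite -natrX.
  by rewrite ler_pXn2r// ?nnegrE ?ltW.
have s0 : 0 < s.
  rewrite sqrtr_gt0 subr_gt0 -[t%:~R ^+ 2]real_normK ?num_real//.
  rewrite (_ : 4 = 2 ^+ 2); last by rewrite -natrX.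
  by rewrite ltr_pXn2r// ?nnegrE ?ltW.
move: tR s2; set u : R := t%:~R; move=> tR s2.
have [u0|u0] := ltrP 0 u.
  rewrite (gtr0_norm u0) in tR *.
  have su : s < u by nra.
  exists ((u + s) / 2), ((u - s) / 2); split.
  - by field.
  - have e4 : 4 = u ^+ 2 - s ^+ 2 :> R by rewrite s2 subKr.
    have n4 : 4 != 0 :> R by rewrite pnatr_eq0.
    by apply: (mulfI n4); rewrite mulr1 [RHS]e4; field.
  - by rewrite ger0_norm; lra.
  - by rewrite ger0_norm; lra.
rewrite (ler0_norm u0) in tR *.
have su : s < - u by nra.
exists ((u - s) / 2), ((u + s) / 2); split.
- by field.
- have e4 : 4 = u ^+ 2 - s ^+ 2 :> R by rewrite s2 subKr.
    have n4 : 4 != 0 :> R by rewrite pnatr_eq0.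
    by apply: (mulfI n4); rewrite mulr1 [RHS]e4; field.
- by rewrite ler0_norm; lra.
- by rewrite ler0_norm; lra.
Qed.

End QuadraticUnit.

Section EigenForm.
Variables (R : realType) (g0 : 'M[int]_2).
Hypothesis det_g0 : \det g0 = 1.

(* The first column of W, paired with the left eigenvector of g0 for lam. *)
Definition eigenform (lam : R) (W : 'M[int]_2) : R :=
  (g0 1 0)%:~R * (W 0 0)%:~R + (lam - (g0 0 0)%:~R) * (W 1 0)%:~R.

Lemma eigenform_mul (lam : R) W : lam ^+ 2 = (\tr g0)%:~R * lam - 1 ->
  eigenform lam (g0 *m W) = lam * eigenform lam W.
Proof.
move=> lam2; rewrite /eigenform !mxE !big_ord2 !intrD !intrM.
have : (g0 0 0)%:~R * (g0 1 1)%:~R - (g0 0 1)%:~R * (g0 1 0)%:~R = 1 :> R.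
  by rewrite -!intrM -intrB -det2 det_g0.
move: lam2; rewrite trace2 intrD.
move: (g0 0 0)%:~R (g0 0 1)%:~R (g0 1 0)%:~R (g0 1 1)%:~R => a b c d.
move: (W 0 0)%:~R (W 1 0)%:~R => x y lam2 dt.
have -> : lam * (c * x + (lam - a) * y) = c * lam * x + (lam ^+ 2 - a * lam) * y by ring.
rewrite lam2; have -> : (a + d) * lam - 1 = (a + d) * lam - (a * d - b * c) by rewrite dt.
ring.
Qed.

(** For a column w, the product of the two eigenforms is [g0 1 0] times det(w, g0 w), a binary
    quadratic form preserved by g0. At the first column of W, the factor det(w, g0 w) is the lower
    left entry of the conjugate g. *)
Lemma eigenform_norm (lam lam' : R) W g : \det W = 1 -> W *m g = g0 *m W ->
  lam + lam' = (\tr g0)%:~R -> lam * lam' = 1 ->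
  eigenform lam W * eigenform lam' W = (g0 1 0)%:~R * (g 1 0)%:~R.
Proof.
move=> dW Wg ll' ll.
have -> : g 1 0 = W 0 0 * (g0 *m W) 1 0 - W 1 0 * (g0 *m W) 0 0.
  rewrite -Wg !mxE !big_ord2.
  transitivity (\det W * g 1 0); first by rewrite dW mul1r.
  rewrite det2; ring.
rewrite /eigenform !mxE !big_ord2 !(intrB, intrD, intrM).
have : (g0 0 0)%:~R * (g0 1 1)%:~R - (g0 0 1)%:~R * (g0 1 0)%:~R = 1 :> R.
  by rewrite -!intrM -intrB -det2 det_g0.
move: ll'; rewrite trace2 intrD.
move: (g0 0 0)%:~R (g0 0 1)%:~R (g0 1 0)%:~R (g0 1 1)%:~R => a b c d.
move: (W 0 0)%:~R (W 1 0)%:~R => x y ll' dt.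
have -> : (c * x + (lam - a) * y) * (c * x + (lam' - a) * y) =
  c ^+ 2 * x ^+ 2 + c * (lam + lam' - 2 * a) * x * y +
   (lam * lam' - a * (lam + lam') + a ^+ 2) * y ^+ 2 by ring.
have -> : lam * lam' = a * d - b * c by rewrite ll dt.
rewrite ll'; ring.
Qed.

Lemma eigenform_cross (lam lam' : R) W W' :
  eigenform lam W * eigenform lam' W' - eigenform lam' W * eigenform lam W' =
  (g0 1 0)%:~R * (lam' - lam) * (W 0 0 * W' 1 0 - W 1 0 * W' 0 0)%:~R.
Proof. rewrite /eigenform !(intrB, intrD, intrM); ring. Qed.

End EigenForm.

Section ConjCount.
Variables (R : realType) (g0 : 'M[int]_2) (N C E J : nat).
Hypotheses (det_g0 : \det g0 = 1) (tr_g0 : (2 < `|\tr g0|)%N).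
Hypotheses (C0 : (0 < C)%N) (E2 : (2 <= E)%N) (EN : (4 * N <= E * `|\tr g0|)%N).
Hypothesis J2 : (`|\tr g0| ^ 2 <= 2 ^ J)%N.

Let unitW (W : 'M[int]_2) : \det W = 1 -> W \in unitmx.
Proof. by move=> dW; rewrite unitmxE dW unitr1. Qed.

Let lower_left_neq0 : g0 1 0 != 0.
Proof.
apply/eqP => c0; move: det_g0 tr_g0; rewrite det2 trace2 c0 mulr0 subr0 => h.
have := congr1 absz h; rewrite abszM => /eqP; rewrite muln_eq1 => /andP[/eqP h1 /eqP h2].
by move: h1 h2; move: (g0 0 0) (g0 1 1) => a d; clear; lia.
Qed.

(** Replacing W by g0 W keeps the conjugate g and multiplies the ratio of the two eigenforms by
    lam^2 in absolute value. Going up until the ratio is at least 1, then down while it is at least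
    lam^2, ends in a fundamental domain. The condition on the lower left entry keeps both eigenforms
    nonzero. *)
Lemma conj_normalise (lam lam' : R) (g : 'M[int]_2) :
  lam + lam' = (\tr g0)%:~R -> lam * lam' = 1 -> 1 < `|lam| -> g 1 0 != 0 ->
  SL2Z_conj g0 g ->
  exists W, [/\ \det W = 1, W *m g = g0 *m W,
    `|eigenform g0 lam' W| <= `|eigenform g0 lam W| &
    `|eigenform g0 lam W| < lam ^+ 2 * `|eigenform g0 lam' W|].
Proof.
move=> ll' ll l1 gc [W0 [dW0 Wg0]].
have lam0 : lam != 0 by rewrite -normr_gt0 (lt_trans ltr01).
have lam'0 : lam' != 0 by apply: contra_eq_neq ll => ->; rewrite mulr0 eq_sym oner_neq0.
have nl' : `|lam'| = `|lam|^-1.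
  by apply: (mulfI (x := `|lam|)); rewrite ?normr_eq0// -normrM ll normr1 divff ?normr_eq0.
have lam2 : lam ^+ 2 = (\tr g0)%:~R * lam - 1 by rewrite -ll' -ll; ring.
have lam'2 : lam' ^+ 2 = (\tr g0)%:~R * lam' - 1 by rewrite -ll' -ll; ring.
have lE : lam ^+ 2 = `|lam| ^+ 2 by rewrite real_normK ?num_real.
pose P W := \det W = 1 /\ W *m g = g0 *m W.
pose l W := `|eigenform g0 lam W|; pose l' W := `|eigenform g0 lam' W|.
have lpos W : P W -> 0 < l W /\ 0 < l' W.
  move=> [dW Wg]; have := eigenform_norm det_g0 dW Wg ll' ll => e.
  have : eigenform g0 lam W * eigenform g0 lam' W != 0 by rewrite e -intrM intr_eq0 mulf_neq0.
  by rewrite mulf_eq0 negb_or => /andP[h1 h2]; rewrite !normr_gt0.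
have up W : P W -> P (g0 *m W) /\ (l (g0 *m W) = `|lam| * l W /\ l' (g0 *m W) = `|lam|^-1 * l' W).
  move=> [dW Wg]; split; first by split; rewrite ?det_mulmx ?det_g0 ?dW ?mul1r// -mulmxA Wg.
  by rewrite /l /l' !eigenform_mul// !normrM nl'.
have down W : P W -> exists W', P W' /\ (l W = `|lam| * l W' /\ l' W = `|lam|^-1 * l' W').
  move=> [dW Wg]; have ug := unitW det_g0.
  have PW' : P (invmx g0 *m W).
    split; first by rewrite det_mulmx det_inv det_g0 invr1 dW mul1r.
    by rewrite -mulmxA Wg !mulmxA mulVmx// mulmxV.
  exists (invmx g0 *m W); split=> //.
  by have [_] := up _ PW'; rewrite mulmxA mulmxV// mul1mx.
have pl n : `|lam| ^+ 2 ^+ n.+1 = `|lam| ^+ 2 * `|lam| ^+ 2 ^+ n by rewrite exprS.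
have L0 : 0 < `|lam| by rewrite normr_gt0.
have unb (x : R) : exists n, x <= `|lam| ^+ 2 ^+ n.
  have h : 1 < `|lam| ^+ 2 by rewrite exprn_egt1.
  pose d := `|lam| ^+ 2 - 1; have d0 : 0 < d by rewrite subr_gt0.
  exists (Num.bound `|x / d|).
  have h1 : x / d <= (Num.bound `|x / d|)%:R.
    by apply: le_trans (ler_norm _) _; apply/ltW/archi_boundP; rewrite normr_ge0.
  have h2 (n : nat) : n%:R * d <= `|lam| ^+ 2 ^+ n.
    elim: n => [|n IH]; first by rewrite mul0r expr0 ler01.
    rewrite exprS -[X in X * _ ^+ _](subrK 1) -/d mulrDl mul1r -natr1 mulrDl mul1r addrC.
    by rewrite lerD// ler_pMr// exprn_ege1// ltW.
  by apply: le_trans (h2 _); rewrite -ler_pdivrMr.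
have [W1 [PW1 h1]] : exists W, P W /\ l' W <= l W.
  have [n] := unb (l' W0 / l W0); have [p0 p0'] := lpos W0 (conj dW0 Wg0).
  rewrite ler_pdivrMr//.
  have : P W0 by []; move: {dW0 Wg0 p0 p0'}W0; elim: n => [|n IH] W PW hn.
    by exists W; rewrite expr0 mul1r in hn.
  have [PW' [e1 e2]] := up W PW; apply: (IH (g0 *m W)) => //.
  rewrite e1 e2 ler_pdivrMl//; move: hn; rewrite pl; congr (_ <= _); ring.
have [n hn] := unb (l W1 / l' W1 + 1).
have {hn} : l W1 < `|lam| ^+ 2 ^+ n * l' W1.
  have [_ p'] := lpos W1 PW1.
  by rewrite -ltr_pdivrMr// (lt_le_trans _ hn)// ltrDl.
move: PW1 h1; elim: n W1 => [|n IH] W PW h1 h2.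
  by move: h2; rewrite expr0 mul1r ltNge h1.
have [h|h] := ltrP (l W) (lam ^+ 2 * l' W); first by exists W; case: PW.
have [W' [PW' [e1 e2]]] := down W PW.
have [p p'] := lpos W' PW'.
apply: (IH W') => //.
  move: h; rewrite e1 e2 lE expr2 -mulrA ler_pM2l// mulrA divff ?mul1r// gt_eqF//.
move: h2; rewrite e1 e2 pl expr2 -!mulrA ltr_pM2l//.
by rewrite mulrCA (mulrA `|lam|) divff ?mul1r ?gt_eqF.
Qed.

(** When the ratios of W and W' lie in the same dyadic interval, each mixed product of eigenforms is
    at most sqrt(2) |c| N, because the unmixed ones are at most |c| N. The difference of the mixed
    products is c (lam' - lam) k, and (lam' - lam)^2 = t^2 - 4 is at least t^2 / 2; hence |t| |k| <=
    4 N. *)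
Lemma conj_col_cross (lam lam' : R) (j : nat) (W W' g g' : 'M[int]_2) :
  lam + lam' = (\tr g0)%:~R -> lam * lam' = 1 ->
  \det W = 1 -> W *m g = g0 *m W -> (`|g 1%R 0%R| <= N)%N ->
  \det W' = 1 -> W' *m g' = g0 *m W' -> (`|g' 1%R 0%R| <= N)%N ->
  2 ^+ j * `|eigenform g0 lam' W| <= `|eigenform g0 lam W| ->
  `|eigenform g0 lam W| < 2 ^+ j.+1 * `|eigenform g0 lam' W| ->
  2 ^+ j * `|eigenform g0 lam' W'| <= `|eigenform g0 lam W'| ->
  `|eigenform g0 lam W'| < 2 ^+ j.+1 * `|eigenform g0 lam' W'| ->
  (`|(W 0 0 * W' 1 0 - W 1 0 * W' 0 0)%R| <= E)%N.
Proof.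
move=> ll' ll dW Wg gN dW' Wg' gN' h1 h2 h1' h2'.
set k := (_ - _)%R.
have cR : (g0 1 0)%:~R != 0 :> R by rewrite intr_eq0.
pose c : R := (g0 1 0)%:~R; pose n : R := N%:R.
have n0 : 0 <= n by apply: ler0n.
have e1 := eigenform_norm det_g0 dW Wg ll' ll.
have e2 := eigenform_norm det_g0 dW' Wg' ll' ll.
have intN (x : int) : (`|x| <= N)%N -> `|x%:~R| <= n :> R.
  by move=> xN; rewrite -intr_norm /n -[N%:R]/(N%:Z%:~R) ler_int; clear -xN; lia.
have cr := eigenform_cross g0 lam lam' W W'; rewrite -/k in cr.
have pr (x x' y y' : R) : 2 ^+ j * `|x'| <= `|x| -> `|x| < 2 ^+ j.+1 * `|x'| ->
   2 ^+ j * `|y'| <= `|y| -> `|y| < 2 ^+ j.+1 * `|y'| ->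
   `|x * x'| <= `|c| * n -> `|y * y'| <= `|c| * n -> (x * y') ^+ 2 <= 2 * (`|c| * n) ^+ 2.
  rewrite exprS => a1 a2 b1 b2; rewrite !normrM => xx yy.
  have J0 : 0 < 2 ^+ j :> R by rewrite exprn_gt0.
  rewrite -real_normK ?num_real// normrM.
  have m1 : `|x| * `|y'| * 2 ^+ j <= 2 * 2 ^+ j * `|x'| * `|y|.
    apply: (@le_trans _ _ ((2 * 2 ^+ j * `|x'|) * (2 ^+ j * `|y'|))); last first.
      by rewrite ler_wpM2l// !mulr_ge0// ltW.
    rewrite [leRHS](_ : _ = (2 * 2 ^+ j * `|x'|) * `|y'| * 2 ^+ j); last by ring.
    by rewrite !ler_wpM2r// ltW.
  have m2 : `|x| * `|y'| <= 2 * `|x'| * `|y|.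
    by rewrite -(ler_pM2r J0) (le_trans m1)// le_eqVlt; apply/orP; left; apply/eqP; ring.
  rewrite expr2; apply: (@le_trans _ _ ((`|x| * `|y'|) * (2 * `|x'| * `|y|))).
    by rewrite ler_wpM2l ?mulr_ge0.
  rewrite [leLHS](_ : _ = 2 * ((`|x| * `|x'|) * (`|y| * `|y'|))); last by ring.
  by rewrite ler_wpM2l// expr2 ler_pM ?mulr_ge0.
have E1 : `|eigenform g0 lam W * eigenform g0 lam' W| <= `|c| * n.
  by rewrite e1 normrM ler_wpM2l// intN.
have E2' : `|eigenform g0 lam W' * eigenform g0 lam' W'| <= `|c| * n.
  by rewrite e2 normrM ler_wpM2l// intN.
have p1 := pr _ _ _ _ h1 h2 h1' h2' E1 E2'.
have p2 := pr _ _ _ _ h1' h2' h1 h2 E2' E1.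
have cc : `|c| ^+ 2 = c ^+ 2 by rewrite real_normK ?num_real.
have p3 : (c * (lam' - lam) * k%:~R) ^+ 2 <= 8 * (c ^+ 2 * n ^+ 2).
  rewrite -/c in cr; rewrite -cr -cc -exprMn [eigenform g0 lam' W * _]mulrC.
  move: p1 p2; move: (eigenform g0 lam W * _) (eigenform g0 lam W' * _) (`|c| * n) => x y z p1 p2.
  have := sqr_ge0 (x + y); nra.
have lt : (lam' - lam) ^+ 2 = (\tr g0)%:~R ^+ 2 - 4.
  have -> : (lam' - lam) ^+ 2 = (lam + lam') ^+ 2 - 4 * (lam * lam') by ring.
  by rewrite ll mulr1 ll'.
have p4 : ((\tr g0) ^+ 2 - 4) * k ^+ 2 <= 8 * N%:Z ^+ 2.
  rewrite -(ler_int R) !intrM intrB !rmorphXn/= -lt -(ler_pM2l (x := c ^+ 2)).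
    rewrite [leLHS](_ : _ = (c * (lam' - lam) * k%:~R) ^+ 2); last by ring.
    rewrite [leRHS](_ : _ = 8 * (c ^+ 2 * n ^+ 2))//.
    by rewrite /n -[N%:R]/(N%:Z%:~R); ring.
  by rewrite exprn_even_gt0.
have p5 : ((\tr g0) ^+ 2) * k ^+ 2 <= 16 * N%:Z ^+ 2.
  have t8 : 8 <= (\tr g0) ^+ 2.
    move: tr_g0; move: (\tr g0) => t h; rewrite -[_ ^+ 2]real_normK ?num_real//.
    have h3 : 3 <= `|t| by clear -h; lia.
    by apply: (@le_trans _ _ (3 ^+ 2)) => //; rewrite ler_pXn2r// nnegrE.
  by move: t8 p4 (sqr_ge0 k); move: (_ ^+ 2) (k ^+ 2) (_ ^+ 2) => x y z; clear; nia.
have p6 : (`|\tr g0| * `|k| <= 4 * N)%N.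
  rewrite -abszM -lez_nat abszE -(ler_pXn2r (n := 2))// ?nnegrE// real_normK ?num_real//.
  by rewrite exprMn PoszM exprMn.
have tg : (0 < `|\tr g0|)%N by apply: leq_trans tr_g0.
by rewrite -(leq_pmul2l tg) (leq_trans p6)// (leq_trans EN)// mulnC.
Qed.

(* The first columns of the conjugating matrices are normalised by the action of g0 and
   sorted by the dyadic size of the ratio of the two eigenforms; two of them in the same
   class then have a determinant bounded by E. *)
Lemma atmost_conj_box :
  atmost [set g | [/\ SL2Z_box N g, SL2Z_conj g0 g & (C <= `|g 1%R 0%R|)%N]]
    (J * ((2 * E).+1 * E.+1 * (N %/ C).+1.*2.+1)).
Proof.
have [lam [lam' [ll' ll l1 lt]]] := quadratic_unit R tr_g0.
pose A := [set g | [/\ SL2Z_box N g, SL2Z_conj g0 g & (C <= `|g 1%R 0%R|)%N]].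
have gne g : A g -> g 1 0 != 0.
  by case=> _ _; apply: contraTneq => ->; rewrite -ltnNge.
pose P g W j := [/\ \det W = 1, W *m g = g0 *m W, (j < J)%N,
  2 ^+ j * `|eigenform g0 lam' W| <= `|eigenform g0 lam W| &
  `|eigenform g0 lam W| < 2 ^+ j.+1 * `|eigenform g0 lam' W|].
have ex g : exists Wj : 'M[int]_2 * nat, A g -> P g Wj.1 Wj.2.
  have [Ag|nA] := pselect (A g); last by exists (0, 0%N).
  have [W [dW Wg h1 h2]] := conj_normalise ll' ll l1 (gne _ Ag) (let: And3 _ c _ := Ag in c).
  have p0 : 0 < `|eigenform g0 lam' W|.
    rewrite normr_gt0; apply: contraTneq h2 => ->.
    by rewrite normr0 mulr0 -leNgt.
  have h3 : `|eigenform g0 lam W| < 2 ^+ J * `|eigenform g0 lam' W|.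
    apply: (lt_le_trans h2); rewrite ler_pM2r//.
    rewrite -real_normK ?num_real//.
    apply: (@le_trans _ _ (`|(\tr g0)%:~R| ^+ 2)); first by rewrite ler_pXn2r ?nnegrE// ltW.
    by rewrite -intr_norm -abszE -[_%:~R]/((`|\tr g0|%N)%:R) -!natrX ler_nat.
  by have [j [jJ h4 h5]] := dyadic_between p0 h1 h3; exists (W, j).
have /choice[Wj WjP] := ex.
apply: (atmost_fiber (phi := fun g => (Wj g).2) (B := [set j | (j < J)%N])).
- exact: atmost_nat.
- by move=> g /WjP[].
move=> j jJ; have [[g1 [Ag1 j1]]|none] := pselect (exists g, A g /\ (Wj g).2 = j); last first.
  by move=> [|g s] //= _ /(_ g (mem_head _ _)) ?; case: none; exists g.
have [dW1 Wg1 _ h1 h1'] := WjP _ Ag1; set W1 := (Wj g1).1 in dW1 Wg1 h1 h1'; rewrite j1 in h1 h1'.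
have gN1 : (`|g1 1%R 0%R| <= N)%N by case: Ag1 => -[_ ->].
(* In the basis formed by the columns of the reference matrix W1, the first column of the matrix
   conjugating g has coordinates x and k. The label of g keeps k, the residue of x modulo E + 1, and
   the integer quotient of the lower row, which settles the second column. *)
pose k (g : 'M[int]_2) : int := W1 0 0 * (Wj g).1 1 0 - W1 1 0 * (Wj g).1 0 0.
pose x (g : 'M[int]_2) : int := (Wj g).1 0 0 * W1 1 1 - (Wj g).1 1 0 * W1 0 1.
pose B : set (int * int * int) := [set l | ((`|l.1.1| <= E)%N /\ (0 <= l.1.2 < E.+1%:Z)) /\ (`|l.2| <= (N %/ C).+1)%N].
have Bcount : atmost B ((2 * E).+1 * E.+1 * (N %/ C).+1.*2.+1).
  apply: (@atmostX _ _ [set l : int * int | (`|l.1| <= E)%N /\ (0 <= l.2 < E.+1%:Z)]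
     [set z | (`|z| <= (N %/ C).+1)%N]); last exact: atmost_absz.
  apply: (@atmostX _ _ [set z | (`|z| <= E)%N] [set z : int | 0 <= z < E.+1%:Z]).
    by rewrite mul2n; apply: atmost_absz.
  apply: (atmost_inj (phi := absz) (@atmost_nat E.+1)) => z /=.
    by clear; lia.
  by move=> y; clear; lia.
refine (@atmost_inj _ _ (fun g => (k g, (x g %% E.+1%:Z)%Z, (g 1%R 1%R %/ g 1%R 0%R)%Z)) _ _ _ Bcount _ _).
  move=> g [Ag jg]; have [dW Wg _ h2 h2'] := WjP _ Ag; rewrite jg in h2 h2'.
  have [[_ gN] _ gC] := Ag.
  split; first split.
  - exact: (conj_col_cross ll' ll dW1 Wg1 gN1 dW Wg (gN _ _) h1 h1' h2 h2').
  - by rewrite /= modz_ge0//= ltz_mod.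
  - rewrite /=; have := gN 1 1; move: (gne _ Ag) gC; move: (g 1 0) (g 1 1) => c d c0 cC dN.
    have e := divz_eq d c; have m0 := modz_ge0 d c0; have m1 := ltz_mod d c0.
    move: e m0 m1; move: (d %/ c)%Z (d %% c)%Z => q r e m0 m1.
    rewrite leqNgt; apply/negP => qN.
    have h3 : (N < (N %/ C).+1 * C)%N by apply: ltn_ceil.
    have h4 : ((N %/ C).+1 * C <= (`|q| - 1) * `|c|)%N.
      by apply: leq_mul => //; clear -qN; lia.
    have h5 : (`|q| * `|c| <= N + `|c|)%N.
      have : (`|(q * c)%R| <= `|d| + `|r|)%N by rewrite e; clear; lia.
      by rewrite abszM => h6; apply: leq_trans h6 _; apply: leq_add => //; clear -m0 m1; lia.
    by move: h3 h4 h5; rewrite mulnBl mul1n; clear; lia.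
move=> g g' [Ag jg] [Ag' jg'] [ek ex' ed].
have [dW Wg _ h2 h2'] := WjP _ Ag; rewrite jg in h2 h2'.
have [dW' Wg' _ h3 h3'] := WjP _ Ag'; rewrite jg' in h3 h3'.
have [[dg gN] _ gC] := Ag; have [[dg' gN'] _ gC'] := Ag'.
have kE := conj_col_cross ll' ll dW1 Wg1 gN1 dW Wg (gN _ _) h1 h1' h2 h2'.
have cE := conj_col_cross ll' ll dW Wg (gN _ _) dW' Wg' (gN' _ _) h2 h2' h3 h3'.
set W := (Wj g).1 in dW Wg kE cE; set W' := (Wj g').1 in dW' Wg' cE.
have kx (V : 'M[int]_2) : let k := W1 0 0 * V 1 0 - W1 1 0 * V 0 0 in
    let x := V 0 0 * W1 1 1 - V 1 0 * W1 0 1 in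
    V 0 0 = W1 0 0 * x + W1 0 1 * k /\ V 1 0 = W1 1 0 * x + W1 1 1 * k.
  move=> /=; split.
    by rewrite -[LHS]mulr1 -dW1 det2; ring.
  by rewrite -[LHS]mulr1 -dW1 det2; ring.
have [eW0 eW1] := kx W; have [eW0' eW1'] := kx W'; rewrite -/(k g) -/(x g) in eW0 eW1.
rewrite -/(k g') -/(x g') -ek in eW0' eW1'.
have kk : W 0 0 * W' 1 0 - W 1 0 * W' 0 0 = k g * (x g - x g').
  by rewrite -[RHS]mul1r -dW1 det2 eW0 eW1 eW0' eW1'; ring.
have unit1 (V : 'M[int]_2) y : \det V = 1 -> V 0 0 = W1 0 0 * y -> V 1 0 = W1 1 0 * y -> `|y|%N = 1%N.
  rewrite det2 => dV e1 e2; have : y * (W1 0 0 * V 1 1 - V 0 1 * W1 1 0) = 1.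
    by rewrite -dV e1 e2; ring.
  by move=> /(congr1 absz); rewrite abszM => /eqP; rewrite muln_eq1 => /andP[/eqP].
(* The determinant of the two first columns is k (x - x'), bounded by E. If k = 0, both columns are
   plus or minus the first column of W1, so x and x' differ by at most 2; this is where E >= 2 is
   used. *)
have xE : (`|(x g - x g')%R| <= E)%N.
  have [k0|k0] := eqVneq (k g) 0.
    rewrite k0 !mulr0 !addr0 in eW0 eW1 eW0' eW1'.
    have y1 := unit1 _ _ dW eW0 eW1; have y2 := unit1 _ _ dW' eW0' eW1'.
    by move: y1 y2 E2; move: (x g) (x g') => y y'; clear; lia.
  apply: leq_trans cE; rewrite kk abszM leq_pmull// absz_gt0//.
have xx : x g = x g'.
  have : (E.+1%:Z %| x g - x g')%Z by rewrite -eqz_mod_dvd; apply/eqP.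
  rewrite dvdzE /= => dv; apply/eqP; rewrite -subr_eq0 -absz_eq0.
  by rewrite -[_ == _]negbK -lt0n; apply/negP => /dvdn_leq/(_ dv); rewrite leqNgt ltnS xE.
rewrite -xx -eW0 -eW1 in eW0' eW1'.
pose n : int := W' 0 1 * W 1 1 - W' 1 1 * W 0 1.
pose U : 'M[int]_2 := mx2 1 n 0 1.
(* Two matrices of determinant 1 with the same first column differ by a unipotent U. Conjugation by
   U fixes c and sends d to d + n c, so equal quotients of d by c force n = 0. *)
have WU : W' = W *m U.
  move: (dW) (dW'); rewrite !det2 eW0' eW1' => q1 q2.
  apply: mx2_eq; rewrite !mxE !big_ord2 !mxE/= ?mulr1 ?mulr0 ?addr0//.
    by rewrite -[LHS]mulr1 -{1}q1 -[in RHS](mulr1 (W 0 1)) -q2 /n; ring.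
  by rewrite -[LHS]mulr1 -{1}q1 -[in RHS](mulr1 (W 1 1)) -q2 /n; ring.
have Ug : U *m g' = g *m U.
  have uW : W \in unitmx := unitW dW.
  apply: (can_inj (mulKmx uW)).
  by rewrite mulmxA -WU Wg' WU mulmxA -Wg mulmxA.
have u10 := congr1 (fun M : 'M[int]_2 => M 1 0) Ug; have u11 := congr1 (fun M : 'M[int]_2 => M 1 1) Ug.
rewrite !mxE !big_ord2 !mxE/= !mul0r !mul1r !add0r mulr1 mulr0 addr0 in u10.
rewrite !mxE !big_ord2 !mxE/= !mul0r !mul1r !add0r mulr1 in u11.
have n0 : n = 0.
  move: ed; rewrite u11 u10 [g 1 0 * n]mulrC divzMDl ?gne// => /eqP.
  by rewrite -subr_eq subrr eq_sym => /eqP.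
have U1 : U = 1%:M by apply: mx2_eq; rewrite !mxE/= ?n0.
by move: Ug; rewrite U1 mul1mx mulmx1.
Qed.

End ConjCount.

(** * Traces, norms and discriminants in algebras over the rationals *)

Section AlgebraTrace.
Variable K : falgType rat.
Implicit Types x y : K.

Let bP : basis_of {:K} (vbasis {:K}) := vbasisP _.

Lemma mul_matrix_linear q x y : mul_matrix (q *: x + y) = q *: mul_matrix x + mul_matrix y.
Proof. by rewrite /mul_matrix amull_is_linear passmx.mxof_linear. Qed.

Lemma mul_matrixD x y : mul_matrix (x + y) = mul_matrix x + mul_matrix y.
Proof. by rewrite -[x]scale1r mul_matrix_linear !scale1r. Qed.

Lemma mul_matrixZ (q : rat) x : mul_matrix (q *: x) = q *: mul_matrix x.
Proof.
by apply: (addIr (mul_matrix 0)); rewrite -mul_matrix_linear -mul_matrixD.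
Qed.

Lemma mul_matrix1 : mul_matrix (1 : K) = 1%:M.
Proof.
rewrite /mul_matrix (_ : amull 1 = \1%VF) ?passmx.mxof1 ?(basis_free bP)//.
by apply/lfunP => z; rewrite lfunE/= mul1r lfunE.
Qed.

Lemma mul_matrixM x y : mul_matrix (x * y) = mul_matrix y *m mul_matrix x.
Proof.
rewrite /mul_matrix -passmx.mxof_comp//; congr passmx.mxof.
by apply/lfunP => z; rewrite !lfunE/= !lfunE/= mulrA.
Qed.

Lemma mul_matrix_eq0 x : mul_matrix x = 0 -> x = 0.
Proof.
move=> /eqP; rewrite passmx.mxof_eq0// => /eqP/lfunP/(_ 1).
by rewrite lfunE/= mulr1 zero_lfunE.
Qed.

Lemma mul_matrix_inj : injective (@mul_matrix K).
Proof.
move=> x y xy; apply/eqP; rewrite -subr_eq0 -scaleN1r; apply/eqP/mul_matrix_eq0.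
by rewrite mul_matrixD mul_matrixZ xy scaleN1r subrr.
Qed.

Lemma alg_traceD x y : alg_trace (x + y) = alg_trace x + alg_trace y.
Proof. by rewrite /alg_trace mul_matrixD linearD. Qed.

Lemma alg_traceZ q x : alg_trace (q *: x) = q * alg_trace x.
Proof. by rewrite /alg_trace mul_matrixZ linearZ. Qed.

Lemma alg_trace0 : alg_trace (0 : K) = 0.
Proof. by rewrite -(scale0r (0 : K)) alg_traceZ mul0r. Qed.

Lemma alg_traceMz x (m : int) : alg_trace (x *~ m) = alg_trace x * m%:~R.
Proof. by rewrite -scaler_int alg_traceZ mulrC. Qed.

Lemma alg_trace_sum (I : finType) (F : I -> K) :
  alg_trace (\sum_i F i) = \sum_i alg_trace (F i).
Proof. by apply: (big_morph _ alg_traceD alg_trace0). Qed.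

Lemma alg_normM x y : alg_norm (x * y) = alg_norm x * alg_norm y.
Proof. by rewrite /alg_norm mul_matrixM det_mulmx mulrC. Qed.

Lemma alg_norm1 : alg_norm (1 : K) = 1.
Proof. by rewrite /alg_norm mul_matrix1 det1. Qed.

Definition gram n (b : n.-tuple K) : 'M[rat]_n :=
  \matrix_(i, j) alg_trace (tnth b i * tnth b j).

(** The change of basis P between two Z-bases has an integer inverse, so its determinant is 1 or -1,
    and the Gram determinant is multiplied by the square of it. *)
Lemma disc_basis_unique (L : set K) (b b' : (\dim {:K}).-tuple K) :
  is_Zbasis L b -> is_Zbasis L b' -> \det (gram b) = \det (gram b').
Proof.
move: b b'; rewrite /is_Zbasis; set n := \dim {:K}; move=> b b' [bb Lb] [bb' Lb'].
have ex (c c' : n.-tuple K) : L = Zspan c -> L = Zspan c' ->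
    exists P : 'M[int]_n, forall i, tnth c i = \sum_j tnth c' j *~ P i j.
  move=> Lc Lc'.
  have cL i : exists f : 'I_n -> int, tnth c i = \sum_j tnth c' j *~ f j.
    have : L (tnth c i).
      rewrite Lc; exists (fun j => (j == i)%:R); rewrite (bigD1 i)//= eqxx big1 ?addr0//.
      by move=> j /negPf ->.
    by rewrite Lc'.
  have /choice[f fP] := cL; exists (\matrix_(i, j) f i j) => i.
  by rewrite fP; apply: eq_bigr => j _; rewrite mxE.
have [P PP] := ex _ _ Lb Lb'; have [Q QQ] := ex _ _ Lb' Lb.
have gramE (c c' : n.-tuple K) (A : 'M[int]_n) : (forall i, tnth c i = \sum_j tnth c' j *~ A i j) ->
    gram c = map_mx intr A *m gram c' *m (map_mx intr A)^T.
  move=> cA; apply/matrixP => i j; rewrite mxE mxE cA cA.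
  rewrite mulr_suml alg_trace_sum.
  under eq_bigr => k _ do rewrite mulr_sumr alg_trace_sum.
  under [RHS]eq_bigr => k _ do rewrite mxE mulr_suml.
  rewrite exchange_big/=; apply: eq_bigr => k _; apply: eq_bigr => l _.
  by rewrite !mxE mulrzAl mulrzAr !alg_traceMz mulrAC [RHS]mulrAC [RHS]mulrC mulrA.
have PQ : map_mx intr P *m map_mx intr Q = 1%:M :> 'M[rat]_n.
  have /freeP fr := basis_free bb.
  apply/matrixP => i j; apply/eqP; rewrite -subr_eq0; apply/eqP.
  have /= := fr (fun j => ((map_mx intr P *m map_mx intr Q) i j - (1%:M : 'M[rat]_n) i j)).
  apply.
  under eq_bigr => k _ do rewrite scalerBl.
  rewrite sumrB; apply/eqP; rewrite subr_eq0; apply/eqP.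
  transitivity (tnth b i).
    rewrite [RHS]PP; under [RHS]eq_bigr => k _ do rewrite QQ -scaler_int scaler_sumr.
    rewrite exchange_big/=; apply: eq_bigr => k _.
    rewrite mxE scaler_suml -(tnth_nth 0); apply: eq_bigr => l _.
    by rewrite !mxE -scalerA !scaler_int.
  rewrite (bigD1 i)//= !mxE eqxx scale1r -(tnth_nth 0) big1 ?addr0// => k ki.
  by rewrite mxE eq_sym (negPf ki) scale0r.
have d1 : \det (map_mx intr P : 'M[rat]_n) ^+ 2 = 1.
  have := congr1 determinant PQ; rewrite det_mulmx det1 !det_map_mx.
  rewrite -intrM -[1]/(1%:~R) => /intr_inj h.
  have := congr1 absz h; rewrite abszM => /eqP; rewrite muln_eq1 => /andP[/eqP h1 _].
  by rewrite -rmorphXn/= -[\det P ^+ 2]gez0_abs ?sqr_ge0// abszX h1.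
by rewrite (gramE _ _ _ PP) !det_mulmx det_tr mulrAC -expr2 d1 mul1r.
Qed.

Lemma disc_eq (L : set K) (b : (\dim {:K}).-tuple K) (d : int) :
  is_Zbasis L b -> \det (gram b) = d%:~R -> disc L = d.
Proof.
move=> Lb dE; rewrite /disc; apply: xget_unique; first by exists b.
by move=> d' [b' Lb' d'E]; apply: (@intr_inj rat); rewrite d'E -dE; apply: disc_basis_unique Lb' Lb.
Qed.

Hypothesis dim2 : \dim {:K} = 2%N.

(** Cayley-Hamilton in size 2. The size is a variable because the dimension of K equals 2 only up to
    a proof of equality; the same holds in [tuple2_facts]. *)
Lemma mx2_char n (M : 'M[rat]_n) : n = 2%N -> M *m M = \tr M *: M - (\det M)%:M.
Proof.
move=> n2; subst n; rewrite trace2 det2; apply: mx2_eq; rewrite !mxE !big_ord2/= ?mulr1n ?mulr0n; ring.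
Qed.

Lemma quadratic_char x : x * x = alg_trace x *: x - (alg_norm x) *: 1.
Proof.
rewrite -scaleNr; apply: mul_matrix_inj.
by rewrite mul_matrixD !mul_matrixZ mul_matrixM mul_matrix1 mx2_char// scaleNr scalemx1.
Qed.

(** A non-scalar element satisfies only one monic quadratic equation: the difference of two would
    make it scalar. *)
Lemma quadratic_trace_norm x t n : x \notin <[1]>%VS -> x * x = t *: x - n *: 1 ->
  alg_trace x = t /\ alg_norm x = n.
Proof.
move=> x1 xx; have := quadratic_char x; rewrite xx => e.
have {e} : (t - alg_trace x) *: x = (n - alg_norm x) *: 1.
  rewrite !scalerBl -[t *: x](subrK (n *: 1)) e.
  by rewrite addrAC [alg_trace x *: x - _]addrC addrK addrC.
have [tt|t0 e] := eqVneq (t - alg_trace x) 0.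
  rewrite tt scale0r => /esym/eqP; rewrite scaler_eq0 oner_eq0 orbF !subr_eq0 => /eqP->.
  by split=> //; apply/eqP; rewrite eq_sym -subr_eq0 tt.
case/negP: x1; apply/vlineP; exists ((t - alg_trace x)^-1 * (n - alg_norm x)).
by rewrite -scalerA -e scalerA mulVf// scale1r.
Qed.

End AlgebraTrace.

(** * Quadratic fields *)

Lemma tuple2_facts (K : falgType rat) n (b : n.-tuple K) : n = 2%N ->
  exists u v, [/\ tval b = [:: u; v],
    Zspan b = [set x | exists m k : int, x = u *~ m + v *~ k],
    \det (gram b) = alg_trace (u * u) * alg_trace (v * v) - alg_trace (u * v) * alg_trace (v * u) &
    forall x, x \in <<b>>%VS -> exists p q : rat, x = p *: u + q *: v].
Proof.
move=> n2; subst n; exists (tnth b 0), (tnth b 1).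
have bE : tval b = [:: tnth b 0; tnth b 1].
  by case: b => -[|x [|y [|]]].
split=> //.
- apply/seteqP; split=> x /= [].
    by move=> c ->; exists (c 0), (c 1); rewrite big_ord2.
  move=> m [k ->]; exists (fun i => if i == 0 then m else k); rewrite big_ord2 //.
- by rewrite det2 !mxE.
- move=> x /coord_span ->; exists (coord b 0 x), (coord b 1 x).
  by rewrite big_ord2 -!(tnth_nth 0).
Qed.

Section Quadratic.
Variable K : fieldExtType rat.
Hypothesis dim2 : \dim {:K} = 2%N.
Implicit Types x y u v : K.

(** The nontrivial automorphism of the quadratic field, obtained from the trace without any Galois
    theory. *)
Definition cj x : K := (alg_trace x)%:A - x.

Lemma alg_trace_alg q : alg_trace (q%:A : K) = q * 2.
Proof. by rewrite alg_traceZ /alg_trace mul_matrix1 mxtrace_scalar dim2. Qed.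

Lemma alg_traceE x : (alg_trace x)%:A = x + cj x.
Proof. by rewrite /cj addrC subrK. Qed.

Lemma mul_cj x : x * cj x = (alg_norm x)%:A.
Proof. by rewrite /cj mulrBr mulr_algr quadratic_char// opprB addrC subrK. Qed.

Lemma algM (p q : rat) : (p * q)%:A = p%:A * q%:A :> K.
Proof. by rewrite mulr_algl scalerA. Qed.

Lemma algB (p q : rat) : (p - q)%:A = p%:A - q%:A :> K.
Proof. by rewrite scalerBl. Qed.

Lemma cjD x y : cj (x + y) = cj x + cj y.
Proof. by rewrite /cj alg_traceD scalerDl opprD addrACA. Qed.

Lemma cjZ q x : cj (q *: x) = q *: cj x.
Proof. by rewrite /cj alg_traceZ scalerBr scalerA. Qed.

Lemma cj_alg q : cj (q%:A) = q%:A.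
Proof. by rewrite /cj alg_trace_alg mulr_natr mulr2n scalerDl addrK. Qed.

Lemma cj1 : cj 1 = 1. Proof. by rewrite -[1]scale1r cj_alg. Qed.

Lemma cjN x : cj (- x) = - cj x.
Proof. by rewrite -scaleN1r cjZ scaleN1r. Qed.

Lemma cjB x y : cj (x - y) = cj x - cj y.
Proof. by rewrite cjD cjN. Qed.

Lemma cj0 : cj 0 = 0. Proof. by rewrite -(subrr 1) cjB !subrr. Qed.

Lemma cj_int (m : int) : cj m%:~R = m%:~R.
Proof. by rewrite -[m%:~R]mulr1 mulrzl -scaler_int cj_alg. Qed.

(** Since x times its conjugate is the norm, multiplicativity follows from that of the norm after
    cancelling x y. *)
Lemma cjM x y : cj (x * y) = cj x * cj y.
Proof.
have [->|x0] := eqVneq x 0; first by rewrite mul0r cj0 mul0r.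
have [->|y0] := eqVneq y 0; first by rewrite mulr0 cj0 mulr0.
apply: (mulfI (x := x * y)); first by rewrite mulf_neq0.
rewrite mul_cj alg_normM mulrACA !mul_cj.
by rewrite algM.
Qed.

Lemma cjK : involutive cj.
Proof.
move=> x; rewrite {1}/cj [X in (alg_trace X)%:A]/cj -scaleN1r alg_traceD alg_trace_alg alg_traceZ.
rewrite mulN1r mulr_natr mulr2n addrK /cj opprB addrC subrK //.
Qed.

Lemma alg_norm_eq0 x : (alg_norm x == 0) = (x == 0).
Proof.
apply/eqP/eqP => [n0|->]; last first.
  have := alg_normM (0 : K) 0; have := mul_cj 0; rewrite mul0r => /esym/eqP.
  by rewrite scaler_eq0 oner_eq0 orbF => /eqP.
have /eqP := mul_cj x; rewrite n0 scale0r mulf_eq0 => /orP[/eqP //|/eqP cx].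
by rewrite -[x]cjK cx cj0.
Qed.

Lemma cjV x : cj x^-1 = (cj x)^-1.
Proof.
have [->|x0] := eqVneq x 0; first by rewrite invr0 cj0 invr0.
have cx0 : cj x != 0 by apply: contra_neq x0 => cx; rewrite -[x]cjK cx cj0.
by apply: (mulfI cx0); rewrite -cjM !divff// cj1.
Qed.

Lemma cj_fixed x : cj x = x -> x = (alg_trace x / 2)%:A.
Proof.
move=> cx; rewrite mulrC -scalerA alg_traceE cx -mulr2n -scaler_nat scalerA mulVf// scale1r //.
Qed.

Lemma cj_nontrivial : exists w, cj w != w.
Proof.
apply: contrapT => h.
have : (fullv <= <[1 : K]>)%VS.
  apply/subvP => x _; apply/vlineP; exists (alg_trace x / 2); apply: cj_fixed.
  by apply: contrapT => /eqP ?; apply: h; exists x.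
by move=> /dimvS; rewrite dim_vline oner_neq0 dim2.
Qed.

(* The square of [cross u v] is the discriminant of the pair (u, v). *)
Definition cross u v : K := u * cj v - cj u * v.

Lemma cj_cross u v : cj (cross u v) = - cross u v.
Proof. by rewrite /cross cjB !cjM !cjK opprB. Qed.

Lemma cross_mul x u v : cross (x * u) (x * v) = (alg_norm x)%:A * cross u v.
Proof. by rewrite -mul_cj /cross !cjM; ring. Qed.

Lemma cross_lin (m n p q : rat) u v :
  cross (m%:A * u + n%:A * v) (p%:A * u + q%:A * v) = (m * q - n * p)%:A * cross u v.
Proof.
by rewrite /cross !cjD !cjM !cj_alg algB !algM; ring.
Qed.

Lemma cross_neq0_gens u v : cross u v != 0 -> u != 0 /\ v != 0.
Proof.
by move=> h; split; apply: contra_neq h => ->; rewrite /cross cj0; ring.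
Qed.

(** Cramer's rule: both [cross] values change sign under [cj], so their quotients are fixed by it
    and therefore rational. *)
Lemma cross_coords u v x : cross u v != 0 -> exists p q : rat, x = p%:A * u + q%:A * v.
Proof.
move=> d0.
have fx y z : exists q : rat, cross y z / cross u v = q%:A.
  eexists; apply: cj_fixed; rewrite cjM cjV !cj_cross invrN mulrNN //.
have [p pE] := fx x v; have [q qE] := fx u x; exists p, q.
by apply: (mulIf d0); rewrite -pE -qE; rewrite /cross in d0 *; field.
Qed.

Lemma algI : injective (fun q : rat => q%:A : K).
Proof.
move=> p q /eqP; rewrite -subr_eq0 -algB scaler_eq0 oner_eq0 orbF subr_eq0.
by move/eqP.
Qed.

Lemma cross_coords_inj (m n p q : rat) u v : cross u v != 0 ->
  m%:A * u + n%:A * v = p%:A * u + q%:A * v -> m = p /\ n = q.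
Proof.
move=> d0 e.
have h1 := cross_lin m n 0 1 u v; have h2 := cross_lin p q 0 1 u v.
have g1 := cross_lin 1 0 m n u v; have g2 := cross_lin 1 0 p q u v.
move: h1 g1; rewrite e h2 g2 => /(mulIf d0)/algI + /(mulIf d0)/algI.
by rewrite !mulr1 !mulr0 !mul1r !mul0r !subr0 => -> ->.
Qed.

Definition lat u v : set K := [set x | exists m n : int, x = m%:~R * u + n%:~R * v].

Lemma int_alg (m : int) : (m%:~R : rat)%:A = m%:~R :> K.
Proof. by rewrite scaler_int. Qed.

Lemma intK_eq0 (m : int) : (m%:~R == 0 :> K) = (m == 0).
Proof. by rewrite -int_alg scaler_eq0 oner_eq0 orbF intr_eq0. Qed.

Lemma lat_genl u v : lat u v u.
Proof. by exists 1, 0; rewrite mul1r mul0r addr0. Qed.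

Lemma lat_genr u v : lat u v v.
Proof. by exists 0, 1; rewrite mul1r mul0r add0r. Qed.

Lemma latD u v x y : lat u v x -> lat u v y -> lat u v (x + y).
Proof.
move=> [m [n ->]] [p [q ->]]; exists (m + p), (n + q); rewrite !intrD; ring.
Qed.

Lemma latMz u v x (k : int) : lat u v x -> lat u v (k%:~R * x).
Proof. by move=> [m [n ->]]; exists (k * m), (k * n); rewrite !intrM; ring. Qed.

Lemma latB u v x y : lat u v x -> lat u v y -> lat u v (x - y).
Proof. by move=> hx hy; apply: latD => //; rewrite -mulN1r; apply: (latMz (-1)). Qed.

Lemma lat0 u v : lat u v 0.
Proof. by exists 0, 0; rewrite !mul0r addr0. Qed.

Lemma lat_sub u v u' v' : lat u v u' -> lat u v v' -> lat u' v' `<=` lat u v.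
Proof. by move=> hu hv x [m [n ->]]; apply: latD; apply: latMz. Qed.

Lemma latM u v x : [set x * y | y in lat u v] = lat (x * u) (x * v).
Proof.
apply/seteqP; split=> [_ [_ [m [n ->]] <-]|_ [m [n ->]]].
  by exists m, n; ring.
by exists (m%:~R * u + n%:~R * v); [exists m, n | ring].
Qed.

Lemma lat_change u v u' v' : cross u v != 0 -> lat u v = lat u' v' ->
  exists a b c d : int, [/\ u' = a%:~R * u + b%:~R * v, v' = c%:~R * u + d%:~R * v,
    (a * d - b * c) * (a * d - b * c) = 1 & cross u' v' = (a * d - b * c)%:~R * cross u v].
Proof.
move=> d0 L.
have [a [b e1]] : lat u v u' by rewrite L; apply: lat_genl.
have [c [d e2]] : lat u v v' by rewrite L; apply: lat_genr.
have [a' [b' e1']] : lat u' v' u by rewrite -L; apply: lat_genl.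
have [c' [d' e2']] : lat u' v' v by rewrite -L; apply: lat_genr.
have X : cross u' v' = (a * d - b * c)%:~R * cross u v.
  by rewrite e1 e2 -!int_alg cross_lin intrB !intrM.
have X' : cross u v = (a' * d' - b' * c')%:~R * cross u' v'.
  by rewrite {1}e1' {1}e2' -!int_alg cross_lin intrB !intrM.
exists a, b, c, d; split=> //.
have h : (a * d - b * c) * (a' * d' - b' * c') = 1.
  apply: (@intr_inj rat); apply: algI; rewrite int_alg scale1r.
  by apply: (mulIf d0); rewrite intrM mul1r [X in X * _]mulrC -mulrA -X -X'.
have := congr1 absz h; rewrite abszM => /eqP; rewrite muln_eq1 => /andP[/eqP + _].
move: (a * d - b * c) => z; clear; case: z => [[|[|]]|[|]] //.
Qed.

Lemma disc_crossE u v : (alg_trace (u * u) * alg_trace (v * v) -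
  alg_trace (u * v) * alg_trace (v * u))%:A = cross u v ^+ 2.
Proof.
rewrite algB !algM !alg_traceE !cjM /cross; ring.
Qed.

Lemma Zbasis_lat (L : set K) b : is_Zbasis L b -> exists u v,
  [/\ cross u v != 0, L = lat u v & (\det (gram b))%:A = cross u v ^+ 2].
Proof.
move=> [bb Lb]; have [u [v [bE sp dt co]]] := tuple2_facts b dim2.
exists u, v; split; last by rewrite dt disc_crossE.
- apply/eqP => d0; have [w] := cj_nontrivial.
  have [|p [q wE]] := co w; first by rewrite (span_basis bb) memvf.
  have [|p' [q' oE]] := co 1; first by rewrite (span_basis bb) memvf.
  have : cross 1 w = 0.
    by rewrite {1}oE wE -!(mulr_algl _ u) -!(mulr_algl _ v) cross_lin d0 mulr0.
  by rewrite /cross cj1 !mul1r => /eqP; rewrite subr_eq0 => /eqP ->; rewrite eqxx.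
- rewrite Lb sp; apply/seteqP; split=> x [m [n ->]]; exists m, n.
    by rewrite !mulrzl.
  by rewrite !mulrzl.
Qed.

Lemma lat_Zbasis u v : cross u v != 0 ->
  exists2 b, is_Zbasis (lat u v) b & (\det (gram b))%:A = cross u v ^+ 2.
Proof.
move=> d0; have sb : size [:: u; v] == \dim {:K} by rewrite dim2.
have [u' [v' [/= [<- <-] sp dt _]]] := tuple2_facts (Tuple sb) dim2.
exists (Tuple sb); last by rewrite dt disc_crossE.
split; last first.
  by rewrite sp; apply/seteqP; split=> x [m [n ->]]; exists m, n; rewrite !mulrzl.
rewrite basisEfree subvf size_tuple leqnn !andbT /=.
rewrite free_cons seq1_free (cross_neq0_gens d0).2 andbT span_seq1.
apply/negP => /vlineP[q e]; case/eqP: d0; rewrite e /cross cjZ; apply/eqP.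
by rewrite -!scalerAl [cj v * v]mulrC subrr.
Qed.

Lemma disc_lat u v (d : int) : cross u v != 0 -> cross u v ^+ 2 = d%:~R -> disc (lat u v) = d.
Proof.
move=> d0 e; have [b bL dE] := lat_Zbasis d0; apply: (disc_eq bL).
by apply: algI; rewrite dE e int_alg.
Qed.

End Quadratic.

(** * Orders and invertible ideals *)

Lemma ex_min_nat (P : nat -> Prop) : (exists n, P n) ->
  exists2 n, P n & forall m, P m -> (n <= m)%N.
Proof.
move=> [n0 Pn0]; have ex : exists n, (fun n => `[< P n >]) n by exists n0; apply/asboolP.
by case: (ex_minnP ex) => n /asboolP Pn mn; exists n => // m Pm; apply: mn; apply/asboolP.
Qed.

Lemma rat_common_content (a b c : rat) : a != 0 ->
  exists (n : rat) (A B C x y z : int),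
   [/\ 0 < n, a = n * A%:~R, b = n * B%:~R, c = n * C%:~R & x * A + y * B + z * C = 1].
Proof.
move=> a0.
pose d := denq a * denq b * denq c.
have d0 : d != 0 by rewrite !mulf_neq0 ?denq_eq0.
pose a' := numq a * denq b * denq c; pose b' := denq a * numq b * denq c.
pose c' := denq a * denq b * numq c.
have nz (q : rat) : (denq q)%:~R != 0 :> rat by rewrite intr_eq0 denq_eq0.
have aE : a = a'%:~R / d%:~R.
  by rewrite /a' /d !intrM -[a in LHS]divq_num_den; field; rewrite !nz.
have bE : b = b'%:~R / d%:~R.
  by rewrite /b' /d !intrM -[b in LHS]divq_num_den; field; rewrite !nz.
have cE : c = c'%:~R / d%:~R.
  by rewrite /c' /d !intrM -[c in LHS]divq_num_den; field; rewrite !nz.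
have a'0 : a' != 0 by rewrite !mulf_neq0 ?denq_eq0// numq_eq0.
clearbody a' b' c' d.
have [p [q h1]] := Bezoutz a' b'.
have [r [s h2]] := Bezoutz (gcdz a' b') c'.
set g := gcdz (gcdz a' b') c' in h2.
have g0 : g != 0 by rewrite gcdz_eq0 gcdz_eq0 (negPf a'0).
have ga : (g %| a')%Z by apply: dvdz_trans (dvdz_gcdl _ _) (dvdz_gcdl _ _).
have gb : (g %| b')%Z by apply: dvdz_trans (dvdz_gcdl _ _) (dvdz_gcdr _ _).
have gc : (g %| c')%Z by apply: dvdz_gcdr.
have dR : d%:~R != 0 :> rat by rewrite intr_eq0.
have sgd : (sgz d) * (sgz d) = 1 by move: d0; clear; case: sgzP => //.
have sgR : (sgz d)%:~R * (sgz d)%:~R = 1 :> rat by rewrite -intrM sgd.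
exists (g%:~R / `|d|%:~R), (sgz d * (a' %/ g)%Z), (sgz d * (b' %/ g)%Z), (sgz d * (c' %/ g)%Z),
  (sgz d * (r * p)), (sgz d * (r * q)), (sgz d * s).
have dn : `|d|%:~R = (sgz d)%:~R * d%:~R :> rat by rewrite -intrM -abszEsg.
have sR : (sgz d)%:~R != 0 :> rat by rewrite intr_eq0 sgz_eq0.
have dvE (x : int) : (g %| x)%Z -> x%:~R / d%:~R = g%:~R / `|d|%:~R * (sgz d * (x %/ g)%Z)%:~R :> rat.
  move=> gx; rewrite -[x in LHS](divzK gx) !intrM dn.
  by field; rewrite dR sR.
split.
- by rewrite divr_gt0 ?ltr0z ?normr_gt0// lt_neqAle eq_sym g0.
- by rewrite aE dvE.
- by rewrite bE dvE.
- by rewrite cE dvE.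
- transitivity ((sgz d * sgz d) * (r * p * (a' %/ g)%Z + r * q * (b' %/ g)%Z + s * (c' %/ g)%Z)); first by ring.
  rewrite sgd mul1r; apply: (mulIf g0); rewrite mul1r -[RHS]h2 -h1.
  by rewrite -[in RHS](divzK ga) -[in RHS](divzK gb) -[in RHS](divzK gc); ring.
Qed.

Section Ideals.
Variable K : fieldExtType rat.
Hypothesis dim2 : \dim {:K} = 2%N.
Implicit Types x y u v : K.

(** Hermite normal form. Let m1 be the least positive integer with m1 u in L, and n0 the least
    positive coefficient of v in an element m0 u + n0 v of L. Both exist because L contains two
    independent elements, and Euclidean division shows that m1 u and m0 u + n0 v generate L. *)
Lemma sublattice_basis (L : set K) u v : cross u v != 0 -> L `<=` lat u v ->
  L 0 -> (forall x y, L x -> L y -> L (x - y)) ->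
  (exists x y, [/\ L x, L y & cross x y != 0]) ->
  exists u' v', cross u' v' != 0 /\ L = lat u' v'.
Proof.
move=> d0 Luv L0 LB [x [y [Lx Ly xy]]].
have LN z : L z -> L (- z) by move=> Lz; rewrite -sub0r; apply: LB.
have LD z t : L z -> L t -> L (z + t) by move=> Lz Lt; rewrite -[t]opprK; apply/LB/LN.
have LMn z (n : nat) : L z -> L (n%:R * z).
  move=> Lz; elim: n => [|n IH]; first by rewrite mul0r.
  by rewrite -natr1 mulrDl mul1r; apply: LD.
have LM z (n : int) : L z -> L (n%:~R * z).
  move=> Lz; case: n => n; first exact: LMn.
  by rewrite NegzE mulrNz mulNr; apply/LN/LMn.
have [mx [nx xE]] := Luv _ Lx; have [my [ny yE]] := Luv _ Ly.
have xyE : cross x y = (mx * ny - nx * my)%:~R * cross u v.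
  by rewrite xE yE -!int_alg cross_lin// intrB !intrM.
have dd : mx * ny - nx * my != 0.
  by apply: contra_neq xy => h; rewrite xyE h mul0r.
have [m1 [m1p Lm1] m1min] : exists2 m : nat, (0 < m)%N /\ L (m%:R * u) & forall k, (0 < k)%N /\ L (k%:R * u) -> (m <= k)%N.
  apply: ex_min_nat; exists `|(mx * ny - nx * my)%R|%N; rewrite absz_gt0; split=> //.
  have Lu : L ((mx * ny - nx * my)%:~R * u).
    rewrite (_ : _ * u = ny%:~R * x - nx%:~R * y); first by apply: LB; apply: LM.
    by rewrite xE yE intrB !intrM; ring.
  have -> : (`|(mx * ny - nx * my)%R|%N%:R : K) = (`|mx * ny - nx * my|)%:~R by rewrite -abszE.
  by rewrite normrEsg intrM -mulrA; apply: LM.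
have [n0 [n0p [m0 Ln0]] n0min] : exists2 n : nat, (0 < n)%N /\ (exists m : int, L (m%:~R * u + n%:R * v)) &
    forall k, ((0 < k)%N /\ (exists m : int, L (m%:~R * u + k%:R * v))) -> (n <= k)%N.
  apply: ex_min_nat.
  have nz (z : K) (m n : int) : n != 0 -> L z -> z = m%:~R * u + n%:~R * v ->
      exists k, (0 < k)%N /\ (exists m : int, L (m%:~R * u + k%:R * v)).
    move=> n0 Lz zE; exists `|n|%N; rewrite absz_gt0; split=> //.
    exists (sgz n * m).
    have -> : (`|n|%N%:R : K) = (`|n|)%:~R by rewrite -abszE.
    rewrite normrEsg !intrM (_ : _ + _ = (sgz n)%:~R * z); first exact: LM.
    by rewrite zE; ring.
  have [nx0|nx0] := eqVneq nx 0; last exact: (nz x mx nx).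
  have [ny0|ny0] := eqVneq ny 0; last exact: (nz y my ny).
  by move: dd; rewrite nx0 ny0 mulr0 mul0r subrr eqxx.
exists (m1%:R * u), (m0%:~R * u + n0%:R * v); split.
  have -> : cross (m1%:R * u) (m0%:~R * u + n0%:R * v) = (m1%:~R * n0%:~R) * cross u v.
    rewrite -[m1%:R]/(m1%:~R) -[n0%:R]/(n0%:~R).
    have -> : m1%:~R * u = m1%:~R * u + 0%:~R * v by rewrite mul0r addr0.
    by rewrite -!int_alg cross_lin// mul0r subr0 algM.
  by rewrite !mulf_neq0// intK_eq0 eqz_nat -lt0n.
apply/seteqP; split=> [z Lz|z [p [q ->]]]; last by apply: LD; apply: LM.
have [m [n zE]] := Luv _ Lz.
have n0z : (n0 : int) != 0 by rewrite eqz_nat -lt0n.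
have m1z : (m1 : int) != 0 by rewrite eqz_nat -lt0n.
pose q := (n %/ n0)%Z; pose r := (n %% n0)%Z.
have nE : n = q * n0 + r by apply: divz_eq.
have rlt := ltz_mod n n0z; have r0 := modz_ge0 n n0z; rewrite -/r in rlt r0; clearbody q r.
have Lr : L ((m - q * m0)%:~R * u + r%:~R * v).
  rewrite (_ : _ + _ = z - q%:~R * (m0%:~R * u + n0%:R * v)); first by apply: LB => //; apply: LM.
  rewrite -[n0%:R]/(n0%:~R) zE nE !(intrB, intrD, intrM); ring.
have rz : r = 0.
  apply/eqP; apply: contraT => rn0.
  have : (n0 <= `|r|)%N.
    apply: n0min; rewrite absz_gt0; split=> //; exists (m - q * m0).
    by have -> : (`|r|%N%:R : K) = r%:~R by rewrite -[in RHS](gez0_abs r0).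
  by move: rlt r0; clear; lia.
rewrite rz mul0r addr0 in Lr.
pose k := m - q * m0; rewrite -/k in Lr.
have kR : k%:~R = (k %/ m1)%Z%:~R * m1%:~R + (k %% m1)%Z%:~R :> K.
  by rewrite -intrM -intrD -divz_eq.
have Lk : L ((k %% m1)%Z%:~R * u).
  rewrite (_ : _ * u = k%:~R * u - (k %/ m1)%Z%:~R * (m1%:R * u)); first by apply: LB => //; apply: LM.
  by rewrite -[m1%:R]/(m1%:~R) kR; ring.
have k0 : (k %% m1)%Z = 0.
  have r1 := ltz_mod k m1z; have r2 := modz_ge0 k m1z.
  apply/eqP; apply: contraT => rn0.
  have : (m1 <= `|(k %% m1)%Z|)%N.
    apply: m1min; rewrite absz_gt0; split=> //.
    by have -> : (`|(k %% m1)%Z|%N%:R : K) = (k %% m1)%Z%:~R by rewrite -[in RHS](gez0_abs r2).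
  by move: r1 r2; clear; lia.
exists (k %/ m1)%Z, q.
have kE := divz_eq k m1; rewrite k0 addr0 in kE.
have mE : m = (k %/ m1)%Z * m1 + q * m0 by rewrite -kE /k subrK.
by rewrite -[m1%:R]/(m1%:~R) -[n0%:R]/(n0%:~R) zE {1}mE nE rz addr0 intrD !intrM; ring.
Qed.

Lemma int_multiple_lat u v x : cross u v != 0 -> exists k : int, k != 0 /\ lat u v (k%:~R * x).
Proof.
move=> d0; have [p [q ->]] := cross_coords dim2 x d0.
exists (denq p * denq q); split; first by rewrite mulf_neq0 ?denq_eq0.
exists (numq p * denq q), (denq p * numq q).
have nd (r : rat) : (denq r)%:~R * r%:A = (numq r)%:~R :> K.
  by rewrite -!int_alg -algM -{2}[r]divq_num_den mulrC divfK// intr_eq0 denq_eq0.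
rewrite mulrDr !mulrA !intrM.
have -> : (denq p)%:~R * (denq q)%:~R * p%:A = ((denq p)%:~R * p%:A) * (denq q)%:~R :> K by ring.
have -> : (denq p)%:~R * (denq q)%:~R * q%:A = (denq p)%:~R * ((denq q)%:~R * q%:A) :> K by ring.
by rewrite !nd.
Qed.

(** The unit element is primitive in the lattice O, hence extends to a Z-basis (1, w), with w made
    from Bezout coefficients. *)
Lemma order_generator (O : set K) : is_order O -> exists (w : K) (b c : int),
  [/\ O = lat 1 w, cross 1 w != 0, w + cj w = b%:~R, w * cj w = c%:~R & disc O = b ^+ 2 - 4 * c].
Proof.
move=> [[B /(Zbasis_lat dim2)[u [v [d0 OE _]]]] O1 OM].
have [m [n e1]] : lat u v 1 by rewrite -OE.
have [s [t st]] := Bezoutz m n.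
(* If 1 = g e with e in O, then e = g (e e) with e e in O, so the coordinates of e, which are
   coprime, are divisible by g. *)
have g1 : gcdz m n = 1.
  set g := gcdz m n in st *.
  have g0 : g != 0.
    rewrite gcdz_eq0; apply/negP => /andP[/eqP m0 /eqP n0].
    by move/eqP: e1; rewrite m0 n0 !mul0r addr0 oner_eq0.
  have gm : (g %| m)%Z by apply: dvdz_gcdl.
  have gn : (g %| n)%Z by apply: dvdz_gcdr.
  pose e : K := (m %/ g)%Z%:~R * u + (n %/ g)%Z%:~R * v.
  have ge : g%:~R * e = 1.
    have mR : m%:~R = (m %/ g)%Z%:~R * g%:~R :> K by rewrite -intrM divzK.
    have nR : n%:~R = (n %/ g)%Z%:~R * g%:~R :> K by rewrite -intrM divzK.
    by rewrite [RHS]e1 /e mR nR; ring.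
  have Oe : O e by rewrite OE; exists (m %/ g)%Z, (n %/ g)%Z.
  have [p [q ee]] : lat u v (e * e) by rewrite -OE; apply: OM.
  have : (g * p)%:~R * u + (g * q)%:~R * v = (m %/ g)%Z%:~R * u + (n %/ g)%Z%:~R * v.
    transitivity (g%:~R * (e * e)); first by rewrite ee !intrM; ring.
    by rewrite mulrA ge mul1r.
  rewrite -!int_alg => /(cross_coords_inj dim2 d0)[/intr_inj h1 /intr_inj h2].
  have : g * (s * p + t * q) = 1.
    apply: (mulIf g0); rewrite mul1r -[RHS]st -[in RHS](divzK gm) -[in RHS](divzK gn) -h1 -h2; ring.
  move=> /(congr1 absz); rewrite abszM => /eqP; rewrite muln_eq1 => /andP[/eqP h _].
  by have gp : 0 <= g by []; rewrite -(gez0_abs gp) h.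
rewrite g1 in st.
pose w := (- t)%:~R * u + s%:~R * v.
have cw : cross 1 w = cross u v.
  rewrite {1}e1 /w -!int_alg cross_lin// -!intrM -intrB.
  by rewrite (_ : m * s - n * - t = 1) ?scale1r ?mul1r// -st; ring.
have stR : 1 = s%:~R * m%:~R + t%:~R * n%:~R :> K by rewrite -!intrM -intrD st.
have OE' : O = lat 1 w.
  rewrite OE; apply/seteqP; split; apply: lat_sub.
  - exists s, (- n); rewrite {1}e1 /w -[LHS]mul1r {1}stR !mulrNz; ring.
  - exists t, m; rewrite {1}e1 /w -[LHS]mul1r {1}stR !mulrNz; ring.
  - by exists m, n.
  - by exists (- t), s.
have d1 : cross 1 w != 0 by rewrite cw.
have [c [b wE]] : lat 1 w (w * w) by rewrite -OE'; apply: OM; rewrite OE'; apply: lat_genr.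
have qc := quadratic_char dim2 w.
have [tr nr] : b%:~R = alg_trace w /\ c%:~R = - alg_norm w.
  have : (c%:~R)%:A * 1 + (b%:~R)%:A * w = (- alg_norm w)%:A * 1 + (alg_trace w)%:A * w.
    rewrite !int_alg -wE qc !mulr1 mulr_algl scaleNr addrC //.
  by move=> /(cross_coords_inj dim2 d1)[-> ->].
have trw : w + cj w = b%:~R by rewrite -alg_traceE -tr int_alg.
have nrw : w * cj w = (- c)%:~R.
  by rewrite mul_cj// -int_alg mulrNz nr opprK.
exists w, b, (- c); split=> //.
rewrite OE'; apply: disc_lat => //.
rewrite /cross cj1// !mul1r intrB rmorphXn/= intrM -trw -nrw; ring.
Qed.

Lemma order_disc_sq (O : set K) u v : is_order O -> O = lat u v -> cross u v != 0 ->
  cross u v ^+ 2 = (disc O)%:~R.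
Proof.
move=> /order_generator[w [b [c [OE d0 tr nr ->]]]] OE' d0'.
have [p [q [r [s [_ _ sq ->]]]]] := lat_change dim2 d0 (etrans (esym OE) OE').
rewrite exprMn expr2 -intrM sq mul1r /cross cj1// !mul1r intrB rmorphXn/= intrM -tr -nr; ring.
Qed.

End Ideals.

(** * Invertibility of a lattice over its multiplier ring *)

Section InvertibleIdeals.
Variable K : fieldExtType rat.
Hypothesis dim2 : \dim {:K} = 2%N.
Implicit Types x y u v : K.

Lemma order_int (O : set K) (m : int) : is_order O -> O m%:~R.
Proof.
move=> /(order_generator dim2)[w [b [c [-> _ _ _ _]]]].
by exists m, 0; rewrite mulr1 mul0r addr0.
Qed.

Lemma order_cj (O : set K) x : is_order O -> O x -> O (cj x).
Proof.
move=> /(order_generator dim2)[w [b [c [-> _ tr _ _]]]] [m [n ->]].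
exists (m + n * b), (- n); rewrite cjD !cjM// !cj_int// cj1//.
by rewrite (_ : cj w = b%:~R - w) ?intrD ?intrM ?mulrNz; [ring | rewrite -tr addrC addKr].
Qed.

Lemma order_subr_closed (O : set K) x y : is_order O -> O x -> O y -> O (x - y).
Proof. by move=> /(order_generator dim2)[w [b [c [-> _ _ _ _]]]]; apply: latB. Qed.

Lemma fractional_ideal_lat (O I : set K) : is_order O -> fractional_ideal O I ->
  exists u v, cross u v != 0 /\ I = lat u v.
Proof.
move=> Oo [I0 ID IM [x Ix x0] [d [Od d0 dI]]].
have [w [b [c [OE dw _ _ _]]]] := order_generator dim2 Oo.
apply: (sublattice_basis dim2 (u := d^-1 * 1) (v := d^-1 * w)) => //.
- by rewrite cross_mul// mulf_neq0// scaler_eq0 oner_eq0 orbF alg_norm_eq0// invr_eq0.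
- move=> y /dI; rewrite OE => h; rewrite -latM; exists (d * y) => //.
  by rewrite mulKf.
- move=> y z Iy Iz; apply: ID => //; rewrite -mulN1r; apply: IM => //.
  exact: (@order_int O (-1)).
- exists (x * 1), (x * w); split.
  + by rewrite mulr1.
  + by rewrite mulrC; apply: IM => //; rewrite OE; apply: lat_genr.
  + by rewrite cross_mul// mulf_neq0// scaler_eq0 oner_eq0 orbF alg_norm_eq0.
Qed.

(* The content n of the norm form and theta = u cj(v) / n of a lattice (u, v):
   theta spans, with 1, the multiplier ring. *)
Lemma lat_content u v : cross u v != 0 -> exists (n : rat) (A B C a b c : int) (theta : K),
  [/\ 0 < n, alg_norm u = n * A%:~R, alg_trace (u * cj v) = n * B%:~R &
      alg_norm v = n * C%:~R]
  /\ [/\ a * A + b * B + c * C = 1, theta = u * cj v / n%:A,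
      theta + cj theta = B%:~R & theta * cj theta = (A * C)%:~R].
Proof.
move=> d0; have [u0 v0] := cross_neq0_gens d0.
have a0 : alg_norm u != 0 by rewrite alg_norm_eq0.
have [n [A [B [C [a [b [c [n0 e1 e2 e3 e4]]]]]]]] :=
  rat_common_content (alg_trace (u * cj v)) (alg_norm v) a0.
exists n, A, B, C, a, b, c, (u * cj v / n%:A); split=> //.
have nK : n%:A != 0 :> K by rewrite scaler_eq0 oner_eq0 orbF gt_eqF.
split=> //.
  rewrite cjM// cjV// cj_alg// -mulrDl -alg_traceE e2 algM int_alg mulrAC divff ?mul1r//.
rewrite cjM// cjV// cj_alg// !cjM// cjK// mulrACA.
have -> : u * cj v * (cj u * v) = (u * cj u) * (v * cj v) by ring.
by rewrite !mul_cj// e1 e3 !algM !int_alg intrM; field.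
Qed.

Lemma lat_content_cross u v n A B C theta : cross u v != 0 -> 0 < n ->
  alg_norm u = n * A%:~R -> alg_trace (u * cj v) = n * B%:~R -> alg_norm v = n * C%:~R ->
  theta = u * cj v / n%:A ->
  [/\ cross 1 theta ^+ 2 = (B ^+ 2 - 4 * A * C)%:~R :> K, cross 1 theta != 0,
     theta * u = B%:~R * u - A%:~R * v & theta * v = C%:~R * u].
Proof.
move=> d0 n0 e1 e2 e3 th.
have nK : n%:A != 0 :> K by rewrite scaler_eq0 oner_eq0 orbF gt_eqF.
have nu : u * cj u = n%:A * A%:~R by rewrite mul_cj// e1 algM int_alg.
have nv : v * cj v = n%:A * C%:~R by rewrite mul_cj// e3 algM int_alg.
have tr : u * cj v + cj u * v = n%:A * B%:~R.
  by rewrite (_ : cj u * v = cj (u * cj v)) -?alg_traceE ?e2 ?algM ?int_alg// cjM// cjK.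
have cr : cross 1 theta = - (cross u v / n%:A).
  by rewrite /cross cj1// th !cjM// cjV// cj_alg// cjK//; ring.
split.
- rewrite cr sqrrN expr_div_n /cross.
  apply: (mulIf (x := n%:A ^+ 2)); first by rewrite expf_neq0.
  rewrite divfK ?expf_neq0//.
  have -> : (u * cj v - cj u * v) ^+ 2 = (u * cj v + cj u * v) ^+ 2 - 4 * (u * cj u) * (v * cj v) by ring.
  rewrite tr nu nv !(intrB, intrM); ring.
- by rewrite cr oppr_eq0 mulf_neq0// invr_eq0.
- apply: (mulIf nK); rewrite th mulrAC divfK//.
  have -> : u * cj v * u = (u * cj v + cj u * v) * u - (u * cj u) * v by ring.
  by rewrite tr nu; ring.
- apply: (mulIf nK); rewrite th mulrAC divfK//.
  have -> : u * cj v * v = (v * cj v) * u by ring.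
  by rewrite nv; ring.
Qed.

(** The inverse of the lattice is its conjugate J divided by n. The products of generators are A, C,
    theta and B - theta, so they lie in Z + Z theta; since A, B, C are coprime they generate 1, and
    the product of the two lattices is O. *)
Lemma lat_multiplier_order (O : set K) u v n A B C a b c theta : is_order O ->
  cross u v != 0 -> 0 < n ->
  alg_norm u = n * A%:~R -> alg_trace (u * cj v) = n * B%:~R -> alg_norm v = n * C%:~R ->
  theta = u * cj v / n%:A -> a * A + b * B + c * C = 1 ->
  (forall x y, O x -> lat u v y -> lat u v (x * y)) ->
  (forall x, (forall y, lat u v y -> lat u v (x * y)) -> O x) ->
  [/\ O = lat 1 theta, invertible_ideal O (lat u v) & B ^+ 2 - 4 * A * C = disc O].
Proof.
move=> Oo d0 n0 e1 e2 e3 th abc Om mO.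
have nK : n%:A != 0 :> K by rewrite scaler_eq0 oner_eq0 orbF gt_eqF.
have [u0 v0] := cross_neq0_gens d0.
have cu0 : cj u != 0 by apply: contra_neq u0 => h; rewrite -[u](cjK dim2) h cj0.
have nu : u * cj u = n%:A * A%:~R by rewrite mul_cj// e1 algM int_alg.
have nv : v * cj v = n%:A * C%:~R by rewrite mul_cj// e3 algM int_alg.
have tr : u * cj v + cj u * v = n%:A * B%:~R.
  by rewrite (_ : cj u * v = cj (u * cj v)) -?alg_traceE ?e2 ?algM ?int_alg// cjM// cjK.
have [sq c1 tu tv] := lat_content_cross d0 n0 e1 e2 e3 th.
have ctheta : cj u * v / n%:A = B%:~R - theta.
  have -> : B%:~R = (u * cj v + cj u * v) / n%:A by rewrite tr mulrAC divff ?mul1r.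
  by rewrite th; ring.
have Oth : O theta.
  apply: mO => _ [p [q ->]]; rewrite mulrDr ![theta * (_ * _)]mulrCA tu tv.
  apply: latD; apply: latMz; last by apply: latMz; apply: lat_genl.
  by apply: latB; apply: latMz; [apply: lat_genl | apply: lat_genr].
have O1 : O 1 := order_int 1 Oo.
have OD x y : O x -> O y -> O (x + y).
  by have [w [? [? [-> _ _ _ _]]]] := order_generator dim2 Oo; apply: latD.
have OM x y : O x -> O y -> O (x * y) by have [_ _] := Oo; apply.
have latO : lat 1 theta `<=` O.
  by move=> _ [p [q ->]]; apply: OD; apply: OM => //; apply: order_int.
pose J : set K := lat (cj u / n%:A) (cj v / n%:A).
have prod x y : lat u v x -> J y -> lat 1 theta (x * y).
  move=> [p [q ->]] [r [s ->]].
  rewrite [X in lat _ _ X](_ : _ = ((p * r)%:~R * A%:~R + (q * s)%:~R * C%:~R) + (p * s)%:~R * theta + (q * r)%:~R * (B%:~R - theta)).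
    exists (p * r * A + q * s * C + q * r * B), (p * s - q * r).
    by rewrite !(intrB, intrD, intrM); ring.
  rewrite -ctheta th !intrM.
  have -> : A%:~R = u * cj u / n%:A by rewrite nu mulrAC divff ?mul1r.
  have -> : C%:~R = v * cj v / n%:A by rewrite nv mulrAC divff ?mul1r.
  ring.
have IJ : ideal_mul (lat u v) J = O.
  apply/seteqP; split.
    move=> z [m [x [y [xI yJ ->]]]]; apply: latO.
    by elim/big_ind: _ => [|? ?|i _]; [exact: lat0 | exact: latD | exact: prod].
  move=> o Oo'.
  (* Expand o = o (a A + b B + c C) after multiplying by n: A and C are the norms of u and v, and B
     splits into the two products u cj(v) and v cj(u), hence four terms. *)
  pose X (i : 'I_4) : K := if val i == 0%N then o * (a%:~R * u) else if val i == 1%N then o * (b%:~R * u)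
     else if val i == 2%N then o * (b%:~R * v) else o * (c%:~R * v).
  pose Y (i : 'I_4) : K := (if val i == 0%N then cj u else if val i == 1%N then cj v
     else if val i == 2%N then cj u else cj v) / n%:A.
  exists 4%N, X, Y; split.
  - by case=> -[|[|[|[|]]]]// ? /=; rewrite /X/=; apply: Om => //; apply: latMz;
      (apply: lat_genl || apply: lat_genr).
  - by case=> -[|[|[|[|]]]]// ? /=; rewrite /Y/=; (apply: lat_genl || apply: lat_genr).
  rewrite !big_ord_recl big_ord0 /X /Y /= addr0.
  have EA : A%:~R = u * cj u / n%:A by rewrite nu mulrAC divff ?mul1r.
  have EC : C%:~R = v * cj v / n%:A by rewrite nv mulrAC divff ?mul1r.
  have EB : B%:~R = (u * cj v + cj u * v) / n%:A by rewrite tr mulrAC divff ?mul1r.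
  have e : a%:~R * A%:~R + b%:~R * B%:~R + c%:~R * C%:~R = 1 :> K.
    by rewrite -!intrM -!intrD abc.
  by rewrite -[LHS]mulr1 -[X in _ * X = _]e EA EB EC; ring.
have OE : O = lat 1 theta.
  apply/seteqP; split=> //; rewrite -IJ => z [m [x [y [xI yJ ->]]]].
  by elim/big_ind: _ => [|? ?|i _]; [exact: lat0 | exact: latD | exact: prod].
have mult x : exists2 k : int, k != 0 & O (k%:~R * x).
  by have [k [k0 kx]] := int_multiple_lat dim2 x c1; exists k => //; rewrite OE.
split=> //; last first.
  apply: (@intr_inj rat); apply: (@algI K); rewrite !int_alg -sq.
  by rewrite (order_disc_sq dim2 Oo OE).
split.
  split=> //.
  - exact: lat0.
  - exact: latD.
  - by exists u => //; apply: lat_genl.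
  - have [k k0 kx] := mult (cj u / n%:A); exists (k%:~R * (cj u / n%:A)); split=> //.
      by rewrite !mulf_neq0 ?intK_eq0 ?invr_eq0.
    move=> x xI; rewrite -mulrA; apply: OM; first exact: order_int.
    by apply: latO; rewrite mulrC; apply: prod => //; apply: lat_genl.
exists J => //; split=> //.
- exact: lat0.
- exact: latD.
- move=> x y Ox yJ; rewrite -[x](cjK dim2).
  have cx := order_cj Oo Ox.
  have JE z : J z -> exists2 t, lat u v t & z = cj t / n%:A.
    move=> [p [q ->]]; exists (p%:~R * u + q%:~R * v); first by exists p, q.
    by rewrite cjD !cjM// !cj_int//; ring.
  have EJ t : lat u v t -> J (cj t / n%:A).
    by move=> [p [q ->]]; exists p, q; rewrite cjD !cjM// !cj_int//; ring.
  have [t ti ->] := JE _ yJ; rewrite mulrA -cjM//; apply: EJ; exact: Om.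
- by exists (cj u / n%:A); [exact: lat_genl | rewrite mulf_neq0// invr_eq0].
- have [k k0 kx] := mult u; exists (k%:~R * u); split=> //.
    by rewrite mulf_neq0// intK_eq0.
  move=> x xJ; rewrite -mulrA; apply: OM; first exact: order_int.
  by apply: latO; apply: prod => //; apply: lat_genl.
Qed.

(** Write 1 as an element of I J; multiplying by x, which preserves I, gives x again in I J = O. *)
Lemma invertible_multiplier (O I : set K) x : invertible_ideal O I ->
  (forall y, I y -> I (x * y)) -> O 1 -> O x.
Proof.
move=> [_ [J _ IJ]] xI O1; have : O 1 by [].
rewrite -IJ => -[m [X [Y [XI YJ e]]]]; rewrite -[x]mulr1 e.
exists m, (fun i => x * X i), Y; split=> //; first by move=> i; apply: xI.
by rewrite mulr_sumr; apply: eq_bigr => i _; rewrite mulrA.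
Qed.

Lemma invertible_ideal_form (O : set K) u v : is_order O -> cross u v != 0 ->
  invertible_ideal O (lat u v) ->
  exists (n : rat) (A B C : int) theta,
   [/\ 0 < n, alg_norm u = n * A%:~R, alg_trace (u * cj v) = n * B%:~R &
      alg_norm v = n * C%:~R]
  /\ [/\ O = lat 1 theta, theta = u * cj v / n%:A & B ^+ 2 - 4 * A * C = disc O].
Proof.
move=> Oo d0 inv.
have [n [A [B [C [a [b [c [th [[n0 e1 e2 e3] [abc thE _ _]]]]]]]]]] := lat_content d0.
exists n, A, B, C, th; split=> //.
have O1 : O 1 := order_int 1 Oo.
have [_ _ Om _ _] := inv.1.
have [OE _ D] := lat_multiplier_order Oo d0 n0 e1 e2 e3 thE abc Om
  (fun x h => invertible_multiplier inv h O1).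
by split.
Qed.

Lemma lat_invertible (O : set K) u v : is_order O -> cross u v != 0 ->
  (forall x y, O x -> lat u v y -> lat u v (x * y)) ->
  (forall x, (forall y, lat u v y -> lat u v (x * y)) -> O x) ->
  invertible_ideal O (lat u v).
Proof.
move=> Oo d0 Om mO.
have [n [A [B [C [a [b [c [th [[n0 e1 e2 e3] [abc thE _ _]]]]]]]]]] := lat_content d0.
by have [_ ? _] := lat_multiplier_order Oo d0 n0 e1 e2 e3 thE abc Om mO.
Qed.

End InvertibleIdeals.

(** * Reduced forms and the class number *)

Lemma centred_residue (B A : int) : A != 0 -> exists k : int, (`|(B + 2 * k * A)%R| <= `|A|)%N.
Proof.
move=> A0; have A2 : 2 * A != 0 by rewrite mulf_neq0.
have e := divz_eq B (2 * A); have r0 := modz_ge0 B A2; have r1 := ltz_mod B A2.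
move: e r0 r1; move: (B %/ _)%Z (B %% _)%Z => q r e r0 r1.
have [h|h] := lerP r `|A|.
  exists (- q); rewrite (_ : _ + _ = r); last by rewrite e; ring.
  by move: r0 h; clear; lia.
exists (- q - sgz A); rewrite (_ : _ + _ = r - 2 * (sgz A * A)); last by rewrite e; ring.
by rewrite -normrEsg; move: r0 r1 h; clear; lia.
Qed.

(** Choose (x, y) minimising |Q| over nonzero vectors. It is primitive, as dividing it by g divides
    Q by g^2, so it extends to a basis; adding a multiple of it to the second vector centres the
    middle coefficient, and |A'| <= |C'| is the minimality again. No sign of the discriminant
    enters. *)
Lemma form_reduction (A B C : int) :
  (forall x y : int, (x != 0) || (y != 0) -> A * x ^+ 2 + B * x * y + C * y ^+ 2 != 0) ->
  exists x y s t : int, x * t - y * s = 1 /\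
   let A' := A * x ^+ 2 + B * x * y + C * y ^+ 2 in
   let C' := A * s ^+ 2 + B * s * t + C * t ^+ 2 in
   let B' := 2 * A * x * s + B * (x * t + y * s) + 2 * C * y * t in
   [/\ (`|B'| <= `|A'|)%N, (`|A'| <= `|C'|)%N, A' != 0 & C' != 0].
Proof.
move=> Q0; pose Q (x y : int) := A * x ^+ 2 + B * x * y + C * y ^+ 2.
have [m [x [y [xy mE]]] mmin] : exists2 m : nat,
    (exists x y : int, (x != 0) || (y != 0) /\ m = `|Q x y|%N) &
    forall k, (exists x y : int, (x != 0) || (y != 0) /\ k = `|Q x y|%N) -> (m <= k)%N.
  by apply: ex_min_nat; exists `|Q 1 0|%N, 1, 0.
have m0 : (0 < m)%N by rewrite mE absz_gt0; apply: Q0.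
have [a [b ab]] := Bezoutz x y.
have g1 : gcdz x y = 1.
  set g := gcdz x y in ab *.
  have gx : (g %| x)%Z by apply: dvdz_gcdl.
  have gy : (g %| y)%Z by apply: dvdz_gcdr.
  have g0 : g != 0 by rewrite gcdz_eq0 negb_and.
  have xE := divzK gx; have yE := divzK gy.
  have QE : Q x y = g ^+ 2 * Q (x %/ g)%Z (y %/ g)%Z.
    by rewrite /Q -{1 2}xE -{1 2}yE; ring.
  have nz : ((x %/ g)%Z != 0) || ((y %/ g)%Z != 0).
    rewrite -negb_and; apply/negP => /andP[/eqP h1 /eqP h2].
    by move: xy; rewrite -xE -yE h1 h2 mul0r eqxx.
  have := mmin _ (ex_intro _ _ (ex_intro _ _ (conj nz erefl))).
  rewrite mE QE abszM => h0; have q0 : (0 < `|Q (x %/ g)%Z (y %/ g)%Z|)%N by rewrite absz_gt0; apply: Q0.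
  have h : (`|g| ^ 2 <= 1)%N by rewrite -abszX -(leq_pmul2r q0) mul1n.
  have gp : 0 <= g by [].
  have : (`|g| <= 1)%N by rewrite -(leq_exp2r _ _ (isT : (0 < 2)%N)) exp1n.
  by move: gp g0; clear; lia.
rewrite g1 in ab.
have [k kB] := centred_residue (2 * A * x * (- b) + B * (x * a + y * (- b)) + 2 * C * y * a) (Q0 x y xy).
exists x, y, (- b + k * x), (a + k * y); split.
  by rewrite -[RHS]ab; ring.
have st : (- b + k * x != 0) || (a + k * y != 0).
  rewrite -negb_and; apply/negP => /andP[/eqP h1 /eqP h2].
  have : x * (a + k * y) - y * (- b + k * x) = 1 by rewrite -[RHS]ab; ring.
  by rewrite h1 h2 !mulr0.
split.
- apply: leq_trans kB; rewrite leq_eqVlt; apply/orP; left; apply/eqP; congr absz; ring.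
- by rewrite -[X in (absz X <= _)%N]/(Q x y) -mE; apply: mmin; exists (- b + k * x), (a + k * y).
- exact: Q0.
- exact: Q0.
Qed.

(** * Reduced ideals and narrow classes *)

Section NarrowClasses.
Variable K : fieldExtType rat.
Hypothesis dim2 : \dim {:K} = 2%N.
Implicit Types (x y u v : K) (I J O : set K).

Lemma image_mulA x y I : [set x * z | z in [set y * z | z in I]] = [set (x * y) * z | z in I].
Proof.
apply/seteqP; split=> [_ [_ [z zI <-] <-]|_ [z zI <-]]; first by exists z; rewrite ?mulrA.
by exists (y * z); [exists z | rewrite mulrA].
Qed.

Lemma image_mul1 I : [set 1 * z | z in I] = I.
Proof.
by apply/seteqP; split=> [_ [z zI <-]|z zI]; [rewrite mul1r | exists z; rewrite ?mul1r].
Qed.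

Lemma narrow_equiv_class O I J : narrow_equiv I J -> narrow_class O I = narrow_class O J.
Proof.
move=> [x x0 ->].
have xn0 : x != 0 by rewrite -(alg_norm_eq0 dim2) gt_eqF.
apply/seteqP; split=> L [Linv [y y0 LE]]; split=> //.
  exists (y * x^-1); last by rewrite image_mulA divfK.
  rewrite alg_normM mulr_gt0// -(pmulr_rgt0 _ x0) -alg_normM divff// alg_norm1 //.
by exists (y * x); rewrite ?alg_normM ?mulr_gt0// -image_mulA.
Qed.

(** The label stores the form (A, B, C) as (B, (A, C)): for a given discriminant, B fixes the
    product A C, and the pair (A, C) is then a factorisation. *)
Definition reduced_label O I (l : int * (int * int)) u v n theta :=
  [/\ I = lat u v, cross u v != 0, 0 < n & theta = u * cj v / n%:A] /\
  [/\ alg_norm u = n * l.2.1%:~R, alg_trace (u * cj v) = n * l.1%:~R,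
    alg_norm v = n * l.2.2%:~R & l.1 ^+ 2 - 4 * l.2.1 * l.2.2 = disc O] /\
  [/\ (`|l.1| <= `|l.2.1|)%N, (`|l.2.1| <= `|l.2.2|)%N, l.2.1 != 0 & l.2.2 != 0].

Lemma invertible_reduced O I : is_order O -> invertible_ideal O I ->
  exists l u v n theta, reduced_label O I l u v n theta.
Proof.
move=> Oo Iinv; have [u [v [d0 IE]]] := fractional_ideal_lat dim2 Oo Iinv.1.
rewrite IE in Iinv *.
have [n [A [B [C [th [[n0 e1 e2 e3] [OE thE D]]]]]]] := invertible_ideal_form dim2 Oo d0 Iinv.
have nK : n%:A != 0 :> K by rewrite scaler_eq0 oner_eq0 orbF gt_eqF.
have nu : u * cj u = n%:A * A%:~R by rewrite mul_cj// e1 algM int_alg.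
have nv : v * cj v = n%:A * C%:~R by rewrite mul_cj// e3 algM int_alg.
have tr : u * cj v + cj u * v = n%:A * B%:~R.
  by rewrite (_ : cj u * v = cj (u * cj v)) -?alg_traceE ?e2 ?algM ?int_alg// cjM// cjK.
have Qn (x y : int) : (x%:~R * u + y%:~R * v) * cj (x%:~R * u + y%:~R * v) =
    n%:A * (A * x ^+ 2 + B * x * y + C * y ^+ 2)%:~R.
  transitivity (x%:~R ^+ 2 * (n%:A * A%:~R) + x%:~R * y%:~R * (n%:A * B%:~R) + y%:~R ^+ 2 * (n%:A * C%:~R) : K).
    by rewrite -nu -nv -tr cjD !cjM// !cj_int//; ring.
  by rewrite !(intrD, intrM); ring.
have [x [y [s [t [det1 /= [h1 h2 h3 h4]]]]]] : exists x y s t : int, x * t - y * s = 1 /\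
   let A' := A * x ^+ 2 + B * x * y + C * y ^+ 2 in
   let C' := A * s ^+ 2 + B * s * t + C * t ^+ 2 in
   let B' := 2 * A * x * s + B * (x * t + y * s) + 2 * C * y * t in
   [/\ (`|B'| <= `|A'|)%N, (`|A'| <= `|C'|)%N, A' != 0 & C' != 0].
  apply: form_reduction => x y xy.
  have : (x%:~R * u + y%:~R * v) * cj (x%:~R * u + y%:~R * v) != 0.
    have z0 : x%:~R * u + y%:~R * v != 0.
      apply/negP => /eqP h; move: xy.
      have : x%:~R%:A * u + y%:~R%:A * v = 0%:~R%:A * u + 0%:~R%:A * v :> K.
        by rewrite !int_alg h !mul0r addr0.
      by move=> /(cross_coords_inj dim2 d0)[/intr_inj -> /intr_inj ->].
    by rewrite mul_cj// scaler_eq0 oner_eq0 orbF alg_norm_eq0.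
  by rewrite Qn mulf_eq0 (negPf nK)/= intK_eq0.
pose u1 := x%:~R * u + y%:~R * v; pose v1 := s%:~R * u + t%:~R * v.
exists (2 * A * x * s + B * (x * t + y * s) + 2 * C * y * t,
  (A * x ^+ 2 + B * x * y + C * y ^+ 2, A * s ^+ 2 + B * s * t + C * t ^+ 2)), u1, v1, n, (u1 * cj v1 / n%:A).
have detK : x%:~R * t%:~R - y%:~R * s%:~R = 1 :> K by rewrite -!intrM -intrB det1.
split; [split|split; split] => //=.
- apply/seteqP; split; apply: lat_sub.
  + exists t, (- y); rewrite -[LHS]mul1r -{1}detK /u1 /v1 mulrNz; ring.
  + exists (- s), x; rewrite -[LHS]mul1r -{1}detK /u1 /v1 mulrNz; ring.
  + by exists x, y.
  + by exists s, t.
- by rewrite /u1 /v1 -!int_alg cross_lin// -!intrM -intrB det1 scale1r mul1r.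
- by apply: (@algI K); rewrite -mul_cj// Qn algM int_alg.
- apply: (@algI K); rewrite alg_traceE algM int_alg.
  transitivity (2 * (x%:~R * s%:~R) * (n%:A * A%:~R) + (x%:~R * t%:~R + y%:~R * s%:~R) * (n%:A * B%:~R) + 2 * (y%:~R * t%:~R) * (n%:A * C%:~R) : K).
    by rewrite -nu -nv -tr /u1 /v1 !(cjM, cjD, cjK, cj_int)//; ring.
  by rewrite !(intrD, intrM); ring.
- by apply: (@algI K); rewrite -mul_cj// Qn algM int_alg.
- transitivity ((B ^+ 2 - 4 * A * C) * (x * t - y * s) ^+ 2); first by ring.
  by rewrite det1 expr1n mulr1 D.
Qed.

(** The form and theta fix the quotient v / u = cj(theta) / A, so multiplication by u' / u carries
    one lattice to the other. Its norm is n' / n, which is positive, as narrow equivalence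
    requires. *)
Lemma reduced_label_equiv O I I' l u v n theta u' v' n' theta' :
  reduced_label O I l u v n theta -> reduced_label O I' l u' v' n' theta' ->
  theta = theta' -> narrow_equiv I I'.
Proof.
move=> [[-> d0 n0 thE] [[e1 e2 e3 _] [_ _ A0 _]]] [[-> d0' n0' thE'] [[e1' e2' e3' _] _]] th.
have [u0 v0] := cross_neq0_gens d0; have [u0' v0'] := cross_neq0_gens d0'.
have cj0' (z : K) : z != 0 -> cj z != 0 by apply: contra_neq => h; rewrite -[z](cjK dim2) h cj0.
have nK : n%:A != 0 :> K by rewrite scaler_eq0 oner_eq0 orbF gt_eqF.
have nK' : n'%:A != 0 :> K by rewrite scaler_eq0 oner_eq0 orbF gt_eqF.
have AK : l.2.1%:~R != 0 :> K by rewrite intK_eq0.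
have nu : u * cj u = n%:A * l.2.1%:~R by rewrite mul_cj// e1 algM int_alg.
have nu' : u' * cj u' = n'%:A * l.2.1%:~R by rewrite mul_cj// e1' algM int_alg.
have vE : v * cj u = n%:A * cj theta.
  by rewrite thE !cjM// cjV// cj_alg// cjK//; field.
have vE' : v' * cj u' = n'%:A * cj theta.
  by rewrite th thE' !cjM// cjV// cj_alg// cjK//; field.
exists (u' / u).
  have : alg_norm (u' / u) * (n * l.2.1%:~R) = n' * l.2.1%:~R.
    by rewrite -e1 -e1' -alg_normM divfK.
  rewrite mulrA => /mulIf; rewrite intr_eq0 => /(_ A0) h.
  by rewrite -(pmulr_lgt0 _ n0) h.
rewrite latM; congr lat; first by rewrite divfK.
apply: (mulIf (cj0' _ u0')); rewrite vE'.
apply: (mulIf (cj0' _ u0)); apply: (mulIf u0).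
have -> : u' / u * v * cj u' * cj u * u = (u' * cj u') * (v * cj u) by field.
by rewrite nu' vE -[LHS]mulrA [cj u * u]mulrC nu; ring.
Qed.

(** A class is determined by a reduced form and theta, and theta by B and the sign of its [cross]
    with 1, a square root of the discriminant compared with the fixed root [delta]. The three
    factors count B, the factorisations A C = (B^2 - D) / 4, and this sign. *)
Lemma atmost_narrow_class_group O (S M : nat) : is_order O -> 0 < disc O ->
  disc O <= (S ^ 2)%N%:Z ->
  (forall m, (0 < m <= S ^ 2)%N -> (size (divisors m) <= M)%N) ->
  atmost (narrow_class_group O) (S.*2.+1 * (2 * M) * 2).
Proof.
move=> Oo D0 DS MP.
have [w [b [c [OE dw tr nr DE]]]] := order_generator dim2 Oo.
pose delta := cross 1 w.
have deltaE : delta ^+ 2 = (disc O)%:~R by exact: order_disc_sq OE dw.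
pose P X (r : (int * (int * int)) * (K * K * rat * K)) :=
  X = narrow_class O (lat r.2.1.1.1 r.2.1.1.2) /\
  reduced_label O (lat r.2.1.1.1 r.2.1.1.2) r.1 r.2.1.1.1 r.2.1.1.2 r.2.1.2 r.2.2.
have ex X : exists r, narrow_class_group O X -> P X r.
  have [[I Iinv IX]|nX] := pselect (narrow_class_group O X); last by exists ((0, (0, 0)), (0, 0, 0, 0)).
  have [l [u [v [n [th H]]]]] := invertible_reduced Oo Iinv.
  exists (l, (u, v, n, th)) => _; split=> /=; have := H; case: H => -[IE _ _ _] _; rewrite -IE //.
have /choice[r rP] := ex.
have crossE X : narrow_class_group O X -> cross 1 (r X).2.2 ^+ 2 = delta ^+ 2 /\
   (r X).2.2 + cj (r X).2.2 = (r X).1.1%:~R.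
  move=> /rP[_ [[_ d0 n0 thE] [[e1 e2 e3 D] _]]].
  have [-> _ _ _] := lat_content_cross dim2 d0 n0 e1 e2 e3 thE.
  split; first by rewrite D deltaE.
  have nK : (r X).2.1.2%:A != 0 :> K by rewrite scaler_eq0 oner_eq0 orbF gt_eqF.
  rewrite thE !cjM// cjV// cj_alg// cjK// -mulrDl.
  apply: (mulIf nK); rewrite divfK//.
  transitivity ((alg_trace ((r X).2.1.1.1 * cj (r X).2.1.1.2))%:A : K).
    by rewrite alg_traceE cjM// cjK.
  by rewrite e2 algM int_alg mulrC.
apply: (atmost_inj (phi := fun X => ((r X).1, cross 1 (r X).2.2 == delta))
  (B := [set p | [/\ (`|p.1.1| <= S)%N, p.1.1 ^+ 2 - 4 * (p.1.2.1 * p.1.2.2) = disc O,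
     p.1.2.1 * p.1.2.2 != 0 & (`|(p.1.2.1 * p.1.2.2)%R| <= S ^ 2)%N] /\ [set: bool] p.2])).
- apply: (atmostX (A := [set p : int * (int * int) | [/\ (`|p.1| <= S)%N, p.1 ^+ 2 - 4 * (p.2.1 * p.2.2) = disc O,
     p.2.1 * p.2.2 != 0 & (`|(p.2.1 * p.2.2)%R| <= S ^ 2)%N]] ) _ atmost_bool).
  apply: (atmost_fiber (phi := fst) (B := [set z : int | (`|z| <= S)%N])); first exact: atmost_absz.
    by move=> p [].
  move=> B BS.
  have [[m [m0 mS mE]]|no] := pselect (exists m : int, [/\ m != 0, (`|m| <= S ^ 2)%N & B ^+ 2 - 4 * m = disc O]).
    apply: (@atmost_leq _ _ (2 * size (divisors `|m|))).
      by rewrite leq_mul2l/= MP// mS absz_gt0 m0.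
    apply: (atmost_inj (phi := snd) (atmost_factor_pairs m0)).
      move=> [B' [A C]] [[_ /= e _ _] /= BE]; move: e; rewrite BE -mE.
      by move=> /addrI/oppr_inj/mulfI; apply.
    by move=> [? ?] [? ?] [_ /= ->] [_ /= ->] ->.
  move=> [|p s] //= _ /(_ p (mem_head _ _))[[_ e e0 eS] BE].
  by case: no; exists (p.2.1 * p.2.2); rewrite -BE.
- move=> X GX; have [_ [_ [[e1 e2 e3 D] [h1 h2 A0 C0]]]] := rP _ GX; split=> //=.
  move: D D0 DS h1 h2 A0 C0; move: (r X).1.1 (r X).1.2.1 (r X).1.2.2 (disc O) => B A C d <- {X GX e1 e2 e3}.
  move=> D0 DS h1 h2 A0 C0.
  have BA : B ^+ 2 <= A ^+ 2 by rewrite -[B ^+ 2]real_normK ?num_real// -[A ^+ 2]real_normK ?num_real// ler_pXn2r// ?nnegrE// -!abszE lez_nat.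
  have AC : A ^+ 2 <= `|A * C|.
    by rewrite normrM -[A ^+ 2]real_normK ?num_real// expr2 ler_wpM2l// -!abszE lez_nat.
  have A2 : 0 < A ^+ 2 by rewrite exprn_even_gt0.
  have B2 := sqr_ge0 B.
  (* If A C were nonnegative, B^2 <= A^2 <= A C would make B^2 - 4 A C negative. Hence D = B^2 + 4
     |A C|, which bounds both terms. *)
  have neg : A * C < 0.
    rewrite ltNge; apply/negP => AC0; rewrite (ger0_norm AC0) in AC.
    by move: BA AC A2 D0; rewrite -mulrA; move: (A * C) (A ^+ 2) (B ^+ 2) => x y z; clear; lia.
  have BS : B ^+ 2 <= (S ^ 2)%N%:Z.
    by move: DS neg; rewrite -mulrA; move: (A * C) (B ^+ 2) => x z; clear; lia.
  split=> //.
  + by rewrite -(leq_exp2r _ _ (isT : (0 < 2)%N)) -abszX; move: BS B2; move: (B ^+ 2) => x; clear; lia.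
  + by rewrite mulrA.
  + by rewrite lt_eqF.
  + by move: DS neg B2; rewrite -mulrA; move: (A * C) (B ^+ 2) (S ^ 2)%N => x z y; clear; lia.
- move=> X Y GX GY [lXY dXY].
  have [sX tX] := crossE _ GX; have [sY tY] := crossE _ GY.
  have [XE RX] := rP _ GX; have [YE RY] := rP _ GY.
  rewrite XE YE; apply: narrow_equiv_class; rewrite -lXY in RY.
  apply: reduced_label_equiv RX RY _.
  have thE (z : K) : z = (z + cj z - cross 1 z) / 2%:R.
    have two : 2%:R != 0 :> K by rewrite (_ : 2%:R = 2%:~R)// intK_eq0.
    by apply: (mulIf two); rewrite divfK// /cross cj1//; ring.
  rewrite (thE (r X).2.2) (thE (r Y).2.2) tX tY -lXY; congr ((_ - _) / _).
  move/eqP: sX; rewrite eqf_sqr => /orP[/eqP cX|/eqP cX].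
    by apply/eqP; rewrite cX eq_sym -dXY cX eqxx.
  move/eqP: sY; rewrite eqf_sqr => /orP[/eqP cY|/eqP -> //].
  by move: dXY; rewrite cY eqxx => /eqP ->.
Qed.

End NarrowClasses.

(** * Matrices of given trace and ideal classes *)

Section MatrixIdeals.
Variable K : fieldExtType rat.
Hypothesis dim2 : \dim {:K} = 2%N.
Implicit Types (x y u v : K).

(** In the basis (1, w) the unit is e = k + f w with k = (t - f b) / 2. The numerator is even: (t -
    f b)(t + f b) = 4 (1 - f^2 c), and the two factors have the same parity. Then f w = e - k, so f
    O lies in Z + Z e. *)
Lemma unit_of_trace (O : set K) (t : int) (f : nat) : is_order O -> (0 < f)%N ->
  f%:Z ^+ 2 * disc O = t ^+ 2 - 4 ->
  exists e : K, [/\ O e, e + cj e = t%:~R, e * cj e = 1, cross 1 e != 0 &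
    forall x, O x -> lat 1 e (f%:R * x)].
Proof.
move=> Oo f0 fD; have [w [b [c [OE dw tr nr DE]]]] := order_generator dim2 Oo.
rewrite DE in fD.
have [k kE] : exists k : int, t - f%:Z * b = 2 * k.
  have h : (t - f%:Z * b) * (t + f%:Z * b) = 4 * (1 - f%:Z ^+ 2 * c).
    transitivity (t ^+ 2 - 4 - f%:Z ^+ 2 * (b ^+ 2 - 4 * c) + 4 - 4 * (f%:Z ^+ 2 * c)); first by ring.
    by rewrite fD; ring.
  have [q e] : exists q : int, t - f%:Z * b = q * 2 + ((t - f%:Z * b) %% 2)%Z.
    by eexists; exact: divz_eq.
  exists q.
  rewrite [RHS]mulrC [LHS]e; suff -> : ((t - f%:Z * b) %% 2)%Z = 0 by rewrite addr0.
  apply/eqP; apply: contraT => m0.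
  have m1 : ((t - f%:Z * b) %% 2)%Z = 1.
    have r0 := @modz_ge0 (t - f%:Z * b) 2 isT; have r1 := @ltz_mod (t - f%:Z * b) 2 isT.
    by move: m0 r0 r1; move: ((t - f%:Z * b) %% 2)%Z => r; clear; lia.
  move: h e; rewrite m1; move: (f%:Z ^+ 2 * c) (f%:Z * b) => z y h e.
  have e2 : t + y = 2 * (q + y) + 1 by rewrite -[t](subrK y) e; ring.
  rewrite e e2 in h.
  have : 2 * ((q * 2 * (q + y)) + q + (q + y) - 2 * (1 - z)) + 1 = 0.
    by apply: (@addrI _ (4 * (1 - z))); rewrite addr0 -[RHS]h; ring.
  by move: (_ - _) => z'; clear; lia.
have tE : t = 2 * k + f%:Z * b by rewrite -kE subrK.
exists (k%:~R + f%:R * w); have fK : f%:R = f%:Z%:~R :> K by [].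
have tR : t%:~R = 2 * k%:~R + f%:Z%:~R * b%:~R :> K by rewrite tE intrD !intrM.
split.
- by rewrite OE; exists k, f%:Z; rewrite mulr1.
- rewrite fK cjD !cjM// !cj_int// tR -tr; ring.
- rewrite fK cjD !cjM// !cj_int//.
  have -> : (k%:~R + f%:Z%:~R * w) * (k%:~R + f%:Z%:~R * cj w) =
    (k ^+ 2 + k * f%:Z * b + f%:Z ^+ 2 * c)%:~R :> K.
    by rewrite !(intrD, intrM) -tr -nr; ring.
  suff -> : k ^+ 2 + k * f%:Z * b + f%:Z ^+ 2 * c = 1 by [].
  apply: (@mulfI _ 4) => //.
  transitivity (t ^+ 2 - f%:Z ^+ 2 * (b ^+ 2 - 4 * c)); first by rewrite tE; ring.
  by rewrite fD; ring.
- have -> : cross 1 (k%:~R + f%:R * w) = f%:Z%:~R * cross 1 w.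
    by rewrite /cross fK cjD !cjM// !cj_int// cj1//; ring.
  by rewrite mulf_neq0// intK_eq0 eqz_nat -lt0n.
- move=> x; rewrite OE => -[m [n ->]]; exists (f%:Z * m - n * k), n.
  by rewrite fK intrB !intrM; ring.
Qed.

Variables (O : set K) (t : int) (f : nat) (e : K).
Hypotheses (Oo : is_order O) (f0 : (0 < f)%N) (Oe : O e) (etr : e + cj e = t%:~R)
  (enr : e * cj e = 1) (ce : cross 1 e != 0) (fO : forall x, O x -> lat 1 e (f%:R * x)).

(* Multiplication by [e] acts on the basis (c, e - a) of this lattice through the
   transpose of g. *)
Definition matrix_lat (g : 'M[int]_2) : set K := lat (g 1 0)%:~R (e - (g 0 0)%:~R).

Definition matrix_ideal (g : 'M[int]_2) : set K :=
  [set z | exists x y, [/\ O x, O y & z = x * (g 1 0)%:~R + y * (e - (g 0 0)%:~R)]].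

(** Only the inclusion of the multiplier ring in O is recorded; the reverse one is the O-module
    structure of I. *)
Definition exact_multipliers (I : set K) : Prop :=
  forall x, (forall y, I y -> I (x * y)) -> O x.

Section OneMatrix.
Variable g : 'M[int]_2.
Hypotheses (det_g : \det g = 1) (tr_g : \tr g = t) (c0 : g 1 0 != 0).

Lemma matrix_lat_cross : cross (g 1 0)%:~R (e - (g 0 0)%:~R) = (g 1 0)%:~R * cross 1 e.
Proof. by rewrite /cross cjB !cj_int// cj1//; ring. Qed.

Lemma matrix_lat_cross_neq0 : cross (g 1 0)%:~R (e - (g 0 0)%:~R) != 0.
Proof. by rewrite matrix_lat_cross mulf_neq0// intK_eq0. Qed.

Lemma matrix_lat_actl :
  e * (g 1 0)%:~R = (g 0 0)%:~R * (g 1 0)%:~R + (g 1 0)%:~R * (e - (g 0 0)%:~R).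
Proof. ring. Qed.

Lemma matrix_lat_actr :
  e * (e - (g 0 0)%:~R) = (g 0 1)%:~R * (g 1 0)%:~R + (g 1 1)%:~R * (e - (g 0 0)%:~R).
Proof.
have ee : e * e = t%:~R * e - 1 by rewrite -etr -enr; ring.
rewrite mulrBr ee -tr_g trace2 intrD.
have -> : (g 0 1)%:~R * (g 1 0)%:~R = (g 0 0)%:~R * (g 1 1)%:~R - 1 :> K.
  have dR : (g 0 0)%:~R * (g 1 1)%:~R - (g 0 1)%:~R * (g 1 0)%:~R = 1 :> K.
    by rewrite -!intrM -intrB -det2 det_g.
  by rewrite -[X in _ = _ - X]dR; ring.
ring.
Qed.

Lemma matrix_lat_stable x y : lat 1 e x -> matrix_lat g y -> matrix_lat g (x * y).
Proof.
move=> [m [n ->]] yL.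
have ey : matrix_lat g (e * y).
  case: yL => p [q ->]; rewrite mulrDr ![e * (_ * _)]mulrCA matrix_lat_actl matrix_lat_actr.
  by apply: latD; apply: latMz; apply: latD; apply: latMz; (apply: lat_genl || apply: lat_genr).
by rewrite mulrDl mulr1 -mulrA; apply: latD; apply: latMz.
Qed.

Lemma matrix_lat_sub : matrix_lat g `<=` matrix_ideal g.
Proof.
by move=> _ [p [q ->]]; exists p%:~R, q%:~R; split=> //; apply: order_int.
Qed.

Lemma matrix_ideal_mul_sub z : matrix_ideal g z -> matrix_lat g (f%:R * z).
Proof.
move=> [x [y [Ox Oy ->]]]; rewrite mulrDr !mulrA.
by apply: latD; apply: matrix_lat_stable (fO _) _ => //; (apply: lat_genl || apply: lat_genr).
Qed.

Lemma matrix_ideal_fractional : fractional_ideal O (matrix_ideal g).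
Proof.
have [_ O1 OM] := Oo.
have OD x y : O x -> O y -> O (x + y).
  by have [w [? [? [-> _ _ _ _]]]] := order_generator dim2 Oo; apply: latD.
have O0 : O 0 by exact: (order_int dim2 0 Oo).
split.
- by exists 0, 0; split=> //; rewrite !mul0r addr0.
- move=> _ _ [x [y [Ox Oy ->]]] [x' [y' [Ox' Oy' ->]]]; exists (x + x'), (y + y').
  by split; [exact: OD | exact: OD | ring].
- move=> z _ Oz [x [y [Ox Oy ->]]]; exists (z * x), (z * y).
  by split; [exact: OM | exact: OM | ring].
- by exists (g 1 0)%:~R; [apply: matrix_lat_sub; apply: lat_genl | rewrite intK_eq0].
- exists 1; split; rewrite ?oner_eq0// => z [x [y [Ox Oy ->]]]; rewrite mul1r.
  apply: OD; apply: OM => //; first exact: order_int.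
  by apply: order_subr_closed => //; apply: order_int.
Qed.

Lemma matrix_ideal_invertible : exact_multipliers (matrix_ideal g) ->
  invertible_ideal O (matrix_ideal g).
Proof.
move=> ex; have [u [v [d0 IE]]] := fractional_ideal_lat dim2 Oo matrix_ideal_fractional.
have [_ _ Om _ _] := matrix_ideal_fractional.
move: ex Om; rewrite IE => ex Om; exact: (lat_invertible dim2 Oo d0 Om).
Qed.

End OneMatrix.

(** Two bases of one lattice differ by an integer matrix of determinant 1 or -1. Comparing [cross]
    values, this sign is that of N(x') c' / (N(x) c), which is positive here. Writing multiplication
    by e in both bases then gives the conjugation, after a transposition. *)
Lemma same_lat_conj (g g' : 'M[int]_2) (x x' : K) :
  \det g = 1 -> \tr g = t -> g 1 0 != 0 -> \det g' = 1 -> \tr g' = t -> g' 1 0 != 0 ->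
  0 < alg_norm x -> 0 < alg_norm x' -> (0 < g 1 0) = (0 < g' 1 0) ->
  [set x * y | y in matrix_lat g] = [set x' * y | y in matrix_lat g'] -> SL2Z_conj g g'.
Proof.
move=> dg tg c0 dg' tg' c0' x0 x0' sc; rewrite /matrix_lat !latM => L.
set u := x * _ in L; set v := x * _ in L; set u' := x' * _ in L; set v' := x' * _ in L.
have xK : x != 0 by rewrite -(alg_norm_eq0 dim2) gt_eqF.
have cuv : cross u v = (alg_norm x * (g 1 0)%:~R)%:A * cross 1 e.
  by rewrite /u /v cross_mul// matrix_lat_cross// algM int_alg mulrA.
have cuv' : cross u' v' = (alg_norm x' * (g' 1 0)%:~R)%:A * cross 1 e.
  by rewrite /u' /v' cross_mul// matrix_lat_cross// algM int_alg mulrA.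
have d0 : cross u v != 0.
  by rewrite cross_mul// mulf_neq0// ?scaler_eq0 ?oner_eq0 ?orbF ?gt_eqF// matrix_lat_cross_neq0.
have [p [q [r [s [uE vE sq cE]]]]] := lat_change dim2 d0 L.
have det1 : p * s - q * r = 1.
  have : alg_norm x' * (g' 1 0)%:~R = (p * s - q * r)%:~R * (alg_norm x * (g 1 0)%:~R).
    apply: (@algI K); apply: (mulIf ce).
    by rewrite [in RHS]algM int_alg -mulrA -cuv -cuv' cE.
  move: sq; move: (p * s - q * r) => z z2.
  have [-> //|-> h] : z = 1 \/ z = -1.
    have : (z - 1) * (z + 1) = 0 by rewrite -[0](subrr 1) -[X in _ = X - _]z2; ring.
    move=> /eqP; rewrite mulf_eq0 subr_eq0 addr_eq0 => /orP[/eqP->|/eqP->]; by [left|right].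
  exfalso; move: h sc; rewrite mulrNz mulN1r => h.
  have [cp|cn] := ltrP 0 (g 1 0).
    move=> /esym cp'; have h1 : 0 < alg_norm x' * (g' 1 0)%:~R by rewrite mulr_gt0// ltr0z.
    have h2 : 0 < alg_norm x * (g 1 0)%:~R by rewrite mulr_gt0// ltr0z.
    by move: h1; rewrite h oppr_gt0 => /(lt_trans h2); rewrite ltxx.
  move=> /esym/negbT; rewrite -leNgt => cn'.
  have h1 : alg_norm x' * (g' 1 0)%:~R <= 0 by rewrite pmulr_rle0// lerz0.
  have h2 : alg_norm x * (g 1 0)%:~R < 0 by rewrite pmulr_rlt0// ltrz0 lt_neqAle c0.
  by move: h1; rewrite h oppr_le0 => /(lt_le_trans h2); rewrite ltxx.
have eu : e * u = (g 0 0)%:~R * u + (g 1 0)%:~R * v.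
  by rewrite /u /v mulrCA matrix_lat_actl; ring.
have ev : e * v = (g 0 1)%:~R * u + (g 1 1)%:~R * v.
  by rewrite /u /v mulrCA matrix_lat_actr//; ring.
have eu' : e * u' = (g' 0 0)%:~R * u' + (g' 1 0)%:~R * v'.
  by rewrite /u' /v' mulrCA matrix_lat_actl; ring.
have ev' : e * v' = (g' 0 1)%:~R * u' + (g' 1 1)%:~R * v'.
  by rewrite /u' /v' mulrCA matrix_lat_actr//; ring.
clearbody u v u' v'.
have co (m n m' n' : int) : m%:~R * u + n%:~R * v = m'%:~R * u + n'%:~R * v -> m = m' /\ n = n'.
  by rewrite -!int_alg => /(cross_coords_inj dim2 d0)[/intr_inj -> /intr_inj ->].
have [h1 h2] : g' 0 0 * p + g' 1 0 * r = p * g 0 0 + q * g 0 1 /\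
    g' 0 0 * q + g' 1 0 * s = p * g 1 0 + q * g 1 1.
  apply: co; transitivity (e * u').
    by rewrite eu' uE vE !(intrD, intrM); ring.
  by rewrite uE mulrDr ![e * (_ * _)]mulrCA eu ev !(intrD, intrM); ring.
have [h3 h4] : g' 0 1 * p + g' 1 1 * r = r * g 0 0 + s * g 0 1 /\
    g' 0 1 * q + g' 1 1 * s = r * g 1 0 + s * g 1 1.
  apply: co; transitivity (e * v').
    by rewrite ev' uE vE !(intrD, intrM); ring.
  by rewrite vE mulrDr ![e * (_ * _)]mulrCA eu ev !(intrD, intrM); ring.
exists (mx2 p r q s); split; first by rewrite det2 !mxE/= -det1; ring.
apply: mx2_eq; rewrite !mxE !big_ord2 !mxE/=.
- by rewrite [p * _]mulrC [r * _]mulrC h1; ring.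
- by rewrite [p * _]mulrC [r * _]mulrC h3; ring.
- by rewrite [q * _]mulrC [s * _]mulrC h2; ring.
- by rewrite [q * _]mulrC [s * _]mulrC h4; ring.
Qed.

(* A fibre of the map g |-> class of [matrix_ideal g] meets at most 2 f^4 conjugacy
   classes: scale all the ideals of the fibre to a single J. The lattice then lies
   between f J and J, so it is known from its basis modulo f, and the sign of c turns
   a base change in GL(2,Z) into one in SL(2,Z). *)
Lemma atmost_matrices_of_trace (A : set 'M[int]_2) (n m : nat) :
  (forall g, A g -> [/\ \det g = 1, \tr g = t, g 1 0 != 0 & exact_multipliers (matrix_ideal g)]) ->
  atmost (narrow_class_group O) n ->
  (forall g, A g -> atmost [set g' | A g' /\ SL2Z_conj g g'] m) ->
  atmost A (n * (f ^ 4 * 2 * m)).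
Proof.
move=> AP Gn conjm.
apply: (atmost_fiber (phi := fun g => narrow_class O (matrix_ideal g)) Gn).
  by move=> g Ag; have [dg tg c0 ex] := AP g Ag; exists (matrix_ideal g) => //; apply: matrix_ideal_invertible.
move=> kappa _.
have [[g0 [Ag0 k0]]|no] := pselect (exists g, A g /\ narrow_class O (matrix_ideal g) = kappa); last first.
  by move=> [|g s] //= _ /(_ g (mem_head _ _)) ?; case: no; exists g.
have [dg0 tg0 c00 ex0] := AP _ Ag0.
have [al [be [d0 JE]]] := fractional_ideal_lat dim2 Oo (matrix_ideal_fractional c00).
have exx g : exists x : K, (A g /\ narrow_class O (matrix_ideal g) = kappa) ->
   0 < alg_norm x /\ [set x * y | y in matrix_ideal g] = lat al be.
  have [[Ag kg]|nA] := pselect (A g /\ narrow_class O (matrix_ideal g) = kappa); last by exists 0.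
  have [dg tg c0 ex] := AP _ Ag.
  have : narrow_class O (matrix_ideal g0) (matrix_ideal g).
    rewrite k0 -kg; split; first exact: matrix_ideal_invertible.
    by exists 1; [rewrite alg_norm1 | rewrite image_mul1].
  move=> [_ [x x0 xE]]; exists x^-1 => _; split.
    have xK : x != 0 by rewrite -(alg_norm_eq0 dim2) gt_eqF.
    by rewrite -(pmulr_rgt0 _ x0) -alg_normM divff// alg_norm1.
  have xK : x != 0 by rewrite -(alg_norm_eq0 dim2) gt_eqF.
  by rewrite xE image_mulA mulVf// image_mul1.
have /choice[xg xgP] := exx.
(* M holds the coordinates, in the basis (al, be) of the common ideal, of the two generators of the
   rescaled lattice of g. *)
have exM g : exists M : int * int * (int * int), (A g /\ narrow_class O (matrix_ideal g) = kappa) ->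
    xg g * (g 1 0)%:~R = M.1.1%:~R * al + M.1.2%:~R * be /\
    xg g * (e - (g 0 0)%:~R) = M.2.1%:~R * al + M.2.2%:~R * be.
  have [Ag|nA] := pselect (A g /\ narrow_class O (matrix_ideal g) = kappa); last by exists ((0, 0), (0, 0)).
  have [x0 xE] := xgP _ Ag.
  have [m1 [m2 e1]] : lat al be (xg g * (g 1 0)%:~R).
    by rewrite -xE; exists (g 1 0)%:~R => //; apply: matrix_lat_sub; apply: lat_genl.
  have [m3 [m4 e2]] : lat al be (xg g * (e - (g 0 0)%:~R)).
    by rewrite -xE; exists (e - (g 0 0)%:~R) => //; apply: matrix_lat_sub; apply: lat_genr.
  by exists ((m1, m2), (m3, m4)).
have /choice[M MP] := exM.
have fz : f%:Z != 0 by rewrite eqz_nat -lt0n.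
pose red (z : int) : nat := `|(z %% f%:Z)%Z|%N.
have redlt z : (red z < f)%N.
  have r0 := modz_ge0 z fz; have r1 := ltz_mod z fz.
  by rewrite /red; move: r0 r1; move: (z %% f%:Z)%Z => r; clear; lia.
have red_eq z z' : red z = red z' -> exists k, z = z' + f%:Z * k.
  move=> rz; have rr : (z %% f%:Z)%Z = (z' %% f%:Z)%Z.
    by rewrite -[LHS](gez0_abs (modz_ge0 _ fz)) -[RHS](gez0_abs (modz_ge0 _ fz)) -/(red z) rz.
  exists ((z %/ f%:Z)%Z - (z' %/ f%:Z)%Z).
  by rewrite {1}(divz_eq z f%:Z) {1}(divz_eq z' f%:Z) rr; ring.
pose L g := ((red (M g).1.1, red (M g).1.2), (red (M g).2.1, red (M g).2.2), (0 < g 1 0)).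
apply: (atmost_fiber (phi := L) (B := [set l | (((l.1.1.1 < f)%N /\ (l.1.1.2 < f)%N) /\
    ((l.1.2.1 < f)%N /\ (l.1.2.2 < f)%N)) /\ [set: bool] l.2])).
- rewrite (_ : f ^ 4 = (f * f) * (f * f))%N; last by ring.
  have ff : atmost [set p : nat * nat | (p.1 < f)%N /\ (p.2 < f)%N] (f * f).
    exact: (@atmostX _ _ [set i | (i < f)%N] [set i | (i < f)%N] f f (@atmost_nat f) (@atmost_nat f)).
  exact: (atmostX (atmostX ff ff) atmost_bool).
- by move=> g _; rewrite /L /=; do ?split; exact: redlt.
move=> l _; have [[g1 [Ag1 l1]]|no] := pselect (exists g, (A g /\ narrow_class O (matrix_ideal g) = kappa) /\ L g = l); last first.
  by move=> [|g s] //= _ /(_ g (mem_head _ _)) ?; case: no; exists g.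
apply: atmost_sub (conjm _ Ag1.1) => g [Ag lg]; split; first by case: Ag.
have [dg tg c0 _] := AP _ Ag.1; have [dg1 tg1 c01 _] := AP _ Ag1.1.
have [x0 xE] := xgP _ Ag; have [x01 xE1] := xgP _ Ag1.
(* Equal residues mean that the generators differ by elements of f times the common ideal, and these
   belong to both rescaled lattices. *)
have sub h h' : A h /\ narrow_class O (matrix_ideal h) = kappa ->
    A h' /\ narrow_class O (matrix_ideal h') = kappa -> L h = L h' ->
    [set xg h * y | y in matrix_lat h] `<=` [set xg h' * y | y in matrix_lat h'].
  move=> Ah Ah' [e1 e2 e3 e4 _].
  have [k1 E1] := red_eq _ _ e1; have [k2 E2] := red_eq _ _ e2.
  have [k3 E3] := red_eq _ _ e3; have [k4 E4] := red_eq _ _ e4.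
  have [F1 F2] := MP _ Ah; have [F1' F2'] := MP _ Ah'.
  have [dh th ch _] := AP _ Ah'.1.
  have fJ z : lat al be z -> [set xg h' * y | y in matrix_lat h'] (f%:R * z).
    have [_ <-] := xgP _ Ah'; move=> [y yI <-]; exists (f%:R * y); last by rewrite mulrCA.
    exact: matrix_ideal_mul_sub.
  move: fJ; rewrite /matrix_lat !latM => fJ; apply: lat_sub.
    rewrite F1 E1 E2 [X in lat _ _ X](_ : _ = xg h' * (h' 1 0)%:~R + f%:R * (k1%:~R * al + k2%:~R * be)).
      by apply: latD; [exact: lat_genl | apply: fJ; exists k1, k2].
    by rewrite F1' -[f%:R]/(f%:Z%:~R) !(intrD, intrM); ring.
  rewrite F2 E3 E4 [X in lat _ _ X](_ : _ = xg h' * (e - (h' 0 0)%:~R) + f%:R * (k3%:~R * al + k4%:~R * be)).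
    by apply: latD; [exact: lat_genr | apply: fJ; exists k3, k4].
  by rewrite F2' -[f%:R]/(f%:Z%:~R) !(intrD, intrM); ring.
apply: (same_lat_conj (x := xg g1) (x' := xg g)) => //.
  by move: l1; rewrite -lg => -[].
by apply/seteqP; split; apply: sub; rewrite // l1 lg.
Qed.

End MatrixIdeals.

(** * Rings of integers *)

Section RingOfIntegers.
Variable K : fieldExtType rat.
Hypothesis dim2 : \dim {:K} = 2%N.
Implicit Types (x y u v e : K).

(** The equation is transported to [algC], where a rational algebraic integer is an integer. *)
Lemma integral_rat (q : rat) : integralOver (intr : int -> K) q%:A -> exists m : int, q = m%:~R.
Proof.
case=> p pm pr.
have pE : map_poly (intr : int -> K) p = map_poly (GRing.in_alg K) (map_poly (intr : int -> rat) p).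
  by apply/polyP => i; rewrite !coef_map_id0//= ?int_alg ?scale0r// coef_map_id0//= int_alg.
rewrite pE fmorph_root in pr.
have qA : (ratr q : algC) \in Aint.
  apply: (@root_monic_Aint (map_poly ratr (map_poly (intr : int -> rat) p))).
  - by rewrite fmorph_root.
  - by rewrite map_monic; apply: monic_map.
  - by apply/polyOverP => i; rewrite !coef_map /= ratr_int.
have /intrP[m mE] := Cint_rat_Aint (Crat_rat q) qA.
by exists m; apply: (fmorph_inj (ratr : rat -> algC)); rewrite /= ratr_int mE.
Qed.

Lemma integral_cj x : integralOver (intr : int -> K) x -> integralOver (intr : int -> K) (cj x).
Proof.
case=> p pm; rewrite /root => /eqP pr; exists p => //; rewrite /root.
suff -> : (map_poly (intr : int -> K) p).[cj x] = cj (map_poly (intr : int -> K) p).[x] by rewrite pr cj0.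
rewrite !horner_coef (big_morph (@cj K) (@cjD K) (@cj0 K)).
apply: eq_bigr => i _; rewrite cjM//; congr (_ * _).
  by rewrite coef_map_id0// cj_int.
by elim: (i : nat) => [|n IH]; rewrite ?expr0 ?cj1// !exprS cjM// IH.
Qed.

Lemma ring_of_integersP x : ring_of_integers x <->
  exists a b : int, alg_trace x = a%:~R /\ alg_norm x = b%:~R.
Proof.
split=> [xi|[a [b [tr nr]]]].
  have ci := integral_cj xi.
  have [a aE] : exists m : int, alg_trace x = m%:~R.
    by apply: integral_rat; rewrite alg_traceE; exact: (@integral_add int K intr x (cj x)).
  have [b bE] : exists m : int, alg_norm x = m%:~R.
    by apply: integral_rat; rewrite -mul_cj//; exact: (@integral_mul int K intr x (cj x)).
  by exists a, b.
exists (('X - a%:P) * 'X + b%:P).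
  have m1 : ('X - a%:P) * 'X \is monic by rewrite rpredM ?monicXsubC ?monicX.
  rewrite monicE lead_coefDl -?monicE// size_polyC size_mulX ?polyXsubC_eq0// size_XsubC.
  by case: (b != 0).
rewrite rmorphD rmorphM rmorphB /= map_polyX !map_polyC /= /root !hornerE.
rewrite -[a%:~R]int_alg -[b%:~R]int_alg -tr -nr alg_traceE -mul_cj//.
by apply/eqP; ring.
Qed.


Lemma cross1_coords x e : cross 1 e != 0 ->
  x = (cross x e / cross 1 e) * 1 + (cross 1 x / cross 1 e) * e.
Proof.
rewrite /cross cj1// !mul1r => d0; field; exact: d0.
Qed.

Lemma cross1_sq e (T n : rat) : alg_trace e = T -> alg_norm e = n ->
  cross 1 e ^+ 2 = (T ^+ 2 - 4 * n)%:A :> K.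
Proof.
move=> tr nr; rewrite algB expr2 !algM -tr -nr alg_traceE -mul_cj// (_ : 4%:A = 4%:R).
  by rewrite /cross cj1//; ring.
by rewrite scaler_nat.
Qed.

Lemma integral_ratN x : integralOver (intr : int -> K) x -> cj x = x -> exists m : int, x = m%:~R.
Proof.
move=> xi /cj_fixed xE; rewrite xE in xi.
by have [m mE] := integral_rat xi; exists m; rewrite xE mE int_alg.
Qed.

(** The coordinates of an integral x in the basis (1, e) are [cross] values divided by [cross 1 e].
    Multiplied by m, the square of [cross 1 e], they become integral and fixed by [cj], hence
    integers. So the ring of integers lies in the lattice generated by 1 / m and e / m. *)
Lemma ring_of_integers_order e : ring_of_integers e -> cross 1 e != 0 ->
  is_order (@ring_of_integers K).
Proof.
move=> ei d0.
have [a [b [tr nr]]] := (ring_of_integersP e).1 ei.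
pose m := a ^+ 2 - 4 * b.
have mE : cross 1 e ^+ 2 = m%:~R.
  by rewrite (cross1_sq tr nr) -int_alg /m intrB rmorphXn /= intrM.
have mK : m%:~R != 0 :> K by rewrite -mE expf_neq0.
have ci := integral_cj ei.
have i1 : integralOver (intr : int -> K) 1 by exact: integral1.
have crossi x y : ring_of_integers x -> ring_of_integers y -> integralOver (intr : int -> K) (cross x y).
  by move=> xi yi; apply: integral_sub; apply: integral_mul => //; apply: integral_cj.
have intm x y : ring_of_integers x -> ring_of_integers y ->
    exists k : int, cross x y / cross 1 e = k%:~R * m%:~R^-1.
  move=> xi yi; have [k kE] : exists k : int, cross x y * cross 1 e = k%:~R.
    apply: integral_ratN; first by apply: integral_mul; apply: crossi.
    by rewrite cjM// !cj_cross// mulrNN.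
  by exists k; rewrite -kE -mE; field.
have [u [v [uv OE]]] : exists u v, cross u v != 0 /\ @ring_of_integers K = lat u v.
  apply: (sublattice_basis dim2 (u := m%:~R^-1 * 1) (v := m%:~R^-1 * e)).
  - by rewrite cross_mul// mulf_neq0// scaler_eq0 oner_eq0 orbF alg_norm_eq0// invr_eq0.
  - move=> x xi; have [k kE] := intm x e xi ei; have [l lE] := intm 1 x i1 xi.
    by exists k, l; rewrite [LHS](cross1_coords x d0) kE lE; ring.
  - exact: (@mxpoly.integral0 int K intr).
  - move=> x y; exact: (@integral_sub int K intr).
  - by exists 1, e.
have [B BL _] := lat_Zbasis dim2 uv.
split; [by exists B; rewrite OE|exact: i1|by move=> x y; exact: (@integral_mul int K intr)].
Qed.

(** The hypothesis makes [cross 1 x] equal to [cross 1 w] up to sign, w being the generator of O.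
    The traces are congruent modulo 2, so x is an integer plus or minus w. *)
Lemma order_mem_of_disc (O : set K) x (T n : int) : is_order O ->
  alg_trace x = T%:~R -> alg_norm x = n%:~R -> T ^+ 2 - 4 * n = disc O ->
  O x /\ O `<=` lat 1 x.
Proof.
move=> Oo tr nr; have [w [b [c [OE dw trw nrw DE]]]] := order_generator dim2 Oo.
rewrite DE => D.
have trx : x + cj x = T%:~R by rewrite -alg_traceE tr int_alg.
have nrx : x * cj x = n%:~R by rewrite mul_cj// nr int_alg.
have sq : cross 1 x ^+ 2 = cross 1 w ^+ 2.
  have -> : cross 1 x ^+ 2 = (T ^+ 2 - 4 * n)%:~R.
    by rewrite intrB rmorphXn /= intrM -trx -nrx /cross cj1//; ring.
  by rewrite D intrB rmorphXn /= intrM -trw -nrw /cross cj1//; ring.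
have two : 2%:~R != 0 :> K by rewrite intK_eq0.
have par (q : int) : q ^+ 2 = 1 -> exists p : int, T = 2 * p + q * b.
  move=> q1.
  have [k kE] : exists k, T - q * b = 2 * k.
    have h : (T - q * b) * (T + q * b) = 4 * (n - c).
      transitivity (T ^+ 2 - q ^+ 2 * b ^+ 2); first by ring.
      by rewrite q1 mul1r -[T ^+ 2](subrK (4 * n)) D; ring.
    have [k e] : exists k : int, T - q * b = k * 2 + ((T - q * b) %% 2)%Z.
      by eexists; exact: divz_eq.
    exists k; rewrite [RHS]mulrC [LHS]e; suff -> : ((T - q * b) %% 2)%Z = 0 by rewrite addr0.
    apply/eqP; apply: contraT => m0.
    have m1 : ((T - q * b) %% 2)%Z = 1.
      have r0 := @modz_ge0 (T - q * b) 2 isT; have r1 := @ltz_mod (T - q * b) 2 isT.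
      by move: m0 r0 r1; move: ((T - q * b) %% 2)%Z => r; clear; lia.
    move: h e; rewrite m1; move: (q * b) (n - c) => y z h e.
    have e2 : T + y = 2 * (k + y) + 1 by rewrite -[T](subrK y) e; ring.
    rewrite e e2 in h.
    have : 2 * ((k * 2 * (k + y)) + k + (k + y) - 2 * z) + 1 = 0.
      by apply: (@addrI _ (4 * z)); rewrite addr0 -[RHS]h; ring.
    by move: (_ - _) => z'; clear; lia.
  by exists k; rewrite -kE subrK.
have [q [q1 qE]] : exists q : int, q ^+ 2 = 1 /\ cross 1 x = q%:~R * cross 1 w.
  move/eqP: sq; rewrite eqf_sqr => /orP[/eqP->|/eqP->].
    by exists 1; rewrite mul1r.
  by exists (-1); rewrite mulrNz !mulN1r.
have [p pE] := par q q1.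
have xE : x = p%:~R + q%:~R * w.
  apply: (mulfI two).
  have -> : 2%:~R * x = (x + cj x) - cross 1 x by rewrite /cross cj1//; ring.
  by rewrite trx qE pE intrD !intrM -trw /cross cj1//; ring.
rewrite OE; split; first by exists p, q; rewrite mulr1.
apply: lat_sub; first exact: lat_genl.
exists (- (q * p)), q; rewrite xE mulrNz intrM mulrDr mulrA -[q%:~R * q%:~R]intrM -expr2 q1; ring.
Qed.

(** In the basis (u, v), x acts by an integer matrix, so Cayley-Hamilton gives its quadratic
    equation. A rational x satisfies several such equations and is treated apart. *)
Lemma lat_multiplier_integral u v x : cross u v != 0 -> (forall y, lat u v y -> lat u v (x * y)) ->
  exists a b : int, alg_trace x = a%:~R /\ alg_norm x = b%:~R.
Proof.
move=> d0 xL; have [p [q xu]] := xL _ (lat_genl u v); have [r [s xv]] := xL _ (lat_genr u v).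
have key : x * x = (p + s)%:~R *: x - (p * s - q * r)%:~R *: 1.
  have [u0 _] := cross_neq0_gens d0; apply: (mulIf u0).
  have e : x * x * u = x * (p%:~R * u + q%:~R * v) by rewrite -mulrA xu.
  rewrite e mulrDr ![x * (_ * _)]mulrCA xu xv mulrBl -!scalerAl mul1r xu.
  have sc (z : int) y : (z%:~R : rat) *: y = z%:~R * y by rewrite scaler_int mulrzl.
  by rewrite !sc !(intrB, intrD, intrM); ring.
have [x1|x1] := boolP (x \in <[1]>%VS).
  move/vlineP: x1 => [k kE].
  have : (k)%:A * u + 0%:A * v = (p%:~R)%:A * u + (q%:~R)%:A * v.
    by rewrite scale0r mul0r addr0 !int_alg -xu kE.
  move=> /(cross_coords_inj dim2 d0)[kp _].
  exists (2 * p), (p * p); rewrite kE kp alg_trace_alg// intrM mulrC; split=> //.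
  by apply: (@algI K); rewrite -mul_cj// cj_alg// -algM intrM.
have [-> ->] := quadratic_trace_norm dim2 x1 key.
by exists (p + s), (p * s - q * r).
Qed.

End RingOfIntegers.

(** K' may be another model of the field than K. Instead of an isomorphism, the element p + q w' of
    K' is compared with p + q w1 in K, which has the same trace and norm and is therefore integral;
    this forces q, and then p, to be an integer. *)
Lemma order_mem_of_fundamental (K K' : fieldExtType rat) (O : set K') (x : K') (T n : int) :
  \dim {:K} = 2%N -> \dim {:K'} = 2%N -> is_order (@ring_of_integers K) -> is_order O ->
  disc O = disc (@ring_of_integers K) ->
  alg_trace x = T%:~R -> alg_norm x = n%:~R -> O x.
Proof.
move=> d2 d2' Ko Oo DD tr nr.
have [w [b [c [OE dw trw nrw DE]]]] := order_generator d2 Ko.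
have [w' [b' [c' [OE' dw' trw' nrw' DE']]]] := order_generator d2' Oo.
rewrite DE DE' in DD.
have [p [q xE]] := cross_coords d2' x dw'.
pose y : K := p%:A * 1 + q%:A * w.
(* w1 is the generator of the ring of integers with the trace and norm of w' *)
have [k kE] : exists k : int, b' = b + 2 * k.
  have h : (b' - b) * (b' + b) = 4 * (c' - c).
    transitivity (b' ^+ 2 - b ^+ 2); first by ring.
    by rewrite -[b' ^+ 2](subrK (4 * c')) DD; ring.
  have [k e] : exists k : int, b' - b = k * 2 + ((b' - b) %% 2)%Z.
    by eexists; exact: divz_eq.
  exists k; rewrite -[LHS](subrK b) [in LHS]e.
  suff -> : ((b' - b) %% 2)%Z = 0 by ring.
  apply/eqP; apply: contraT => m0.
  have m1 : ((b' - b) %% 2)%Z = 1.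
    have r0 := @modz_ge0 (b' - b) 2 isT; have r1 := @ltz_mod (b' - b) 2 isT.
    by move: m0 r0 r1; move: ((b' - b) %% 2)%Z => r; clear; lia.
  move: h e; rewrite m1; move: (c' - c) => z h e.
  have e2 : b' + b = 2 * (k + b) + 1 by rewrite -[b'](subrK b) e; ring.
  rewrite e e2 in h.
  have : 2 * ((k * 2 * (k + b)) + k + (k + b) - 2 * z) + 1 = 0.
    by apply: (@addrI _ (4 * z)); rewrite addr0 -[RHS]h; ring.
  by move: (_ - _) => z'; clear; lia.
pose w1 : K := w + k%:~R.
have tr1 : w1 + cj w1 = b'%:~R.
  by rewrite /w1 cjD cj_int// kE intrD intrM -trw; ring.
have nr1 : w1 * cj w1 = c'%:~R.
  have -> : c' = c + k * b + k ^+ 2.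
    by apply: (@mulfI _ 4) => //; apply: oppr_inj; apply: (@addrI _ (b' ^+ 2)); rewrite DD kE; ring.
  by rewrite /w1 cjD cj_int// !intrD intrM rmorphXn /= -nrw -trw; ring.
pose z : K := p%:A * 1 + q%:A * w1.
have trz : z + cj z = (T%:~R : K).
  have e : T%:~R = 2 * p + q * b'%:~R :> rat.
    apply: (@algI K'); rewrite -tr alg_traceE xE !cjD !cjM// !cj_alg// cj1//.
    rewrite scalerDl algM -[2]/(2%:~R) int_alg algM int_alg -trw'; ring.
  rewrite /z cjD !cjM// !cj_alg// cj1// -int_alg e scalerDl algM -[2]/(2%:~R) int_alg algM int_alg -tr1; ring.
have nrz : z * cj z = (n%:~R : K).
  have e : n%:~R = p ^+ 2 + p * q * b'%:~R + q ^+ 2 * c'%:~R :> rat.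
    apply: (@algI K'); rewrite -nr -mul_cj// xE !cjD !cjM// !cj_alg// cj1//.
    rewrite !scalerDl !algM !int_alg -trw' -nrw'; ring.
  rewrite /z cjD !cjM// !cj_alg// cj1// -int_alg e !scalerDl !algM !int_alg -tr1 -nr1; ring.
have zi : ring_of_integers z.
  apply/(ring_of_integersP d2); exists T, n; split; apply: (@algI K).
    by rewrite alg_traceE trz int_alg.
  by rewrite -mul_cj// nrz int_alg.
rewrite OE in zi; case: zi => i [j ij].
have : (p + q * k%:~R)%:A * 1 + q%:A * w = i%:~R%:A * 1 + j%:~R%:A * w :> K.
  by rewrite !int_alg -ij /z /w1 scalerDl algM int_alg; ring.
move=> /(cross_coords_inj d2 dw)[e1 e2]; rewrite OE' xE; exists (i - j * k), j.
by rewrite -!int_alg intrB intrM -e1 -e2 addrK.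
Qed.


(** * The discriminants attached to a hyperbolic matrix *)

(** A rational root would be an integer k with (|t| - |k|)(|t| + |k|) = 4, impossible for |t| >
    2. *)
Lemma trace_disc_nonsquare (t : int) (q : rat) : 2 < `|t| -> q ^+ 2 != (t ^+ 2 - 4)%:~R.
Proof.
move=> t2; apply/eqP => qE.
have d0 : denq q != 0 by rewrite denq_eq0.
have nd : numq q ^+ 2 = (t ^+ 2 - 4) * denq q ^+ 2.
  apply: (@intr_inj rat); rewrite [in RHS]intrM !rmorphXn /= -qE -{2}[q]divq_num_den expr_div_n.
  by rewrite divfK// expf_neq0// intr_eq0.
have dn : (`|denq q| %| `|numq q|)%N.
  by rewrite -(dvdn_pexp2r _ _ (isT : (0 < 2)%N)) -!abszX nd abszM dvdn_mull.
have [k kE] : exists k : int, numq q = k * denq q.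
  by move: dn; rewrite -dvdzE => /dvdzP[k kE]; exists k.
have kk : k ^+ 2 = t ^+ 2 - 4.
  by apply: (mulIf (expf_neq0 2 d0)); rewrite -exprMn -kE nd.
have h : (`|t| - `|k|) * (`|t| + `|k|) = 4.
  by rewrite -subr_sqr !real_normK ?num_real// kk; ring.
have k0 : 0 <= `|k| by [].
move: h k0 t2; move: `|t| `|k| => x y h y0 x2.
have xy : y < x.
  rewrite ltNge; apply/negP => yx.
  have : (x - y) * (x + y) <= 0 by rewrite mulr_le0_ge0 ?subr_le0// addr_ge0// ltW// (lt_trans _ x2).
  by rewrite h.
have [e|e] : x - y = 1 \/ 2 <= x - y by move: xy; clear; lia.
  by move: h; rewrite e mul1r; move: e; clear; lia.
have : 2 * (x + y) <= (x - y) * (x + y) by rewrite ler_wpM2r// addr_ge0// ltW// (lt_trans _ x2).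
by rewrite h; move: x2 y0 e xy; clear; lia.
Qed.

(** * The field generated by a square root of a non-square *)

Section QuadraticGenerator.
Variables (m : int).
Hypothesis nsq : forall q : rat, q ^+ 2 != m%:~R.

Lemma quadratic_field_exists : exists (K : fieldExtType rat) (s : K),
  s ^+ 2 = m%:~R /\ <<1; s>>%VS = {:K}%VS.
Proof.
pose p : {poly rat} := 'X^2 - (m%:~R)%:P.
have sp : size p = 3%N by rewrite size_XnsubC.
have ir : irreducible_poly p.
  apply: cubic_irreducible; first by rewrite sp.
  by move=> x; rewrite /root !hornerE subr_eq0; apply: nsq.
have [K _ [s rs sf]] := irredp_FAdjoin ir.
exists K, s; split=> //; move: rs.
rewrite rmorphB /= map_polyXn map_polyC /= /root !hornerE subr_eq0 int_alg.
by move/eqP.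
Qed.

Variables (K : fieldExtType rat) (s : K).
Hypotheses (s2 : s ^+ 2 = m%:~R) (sf : <<1; s>>%VS = {:K}%VS).

Lemma quadratic_generator_notin : s \notin <[1]>%VS.
Proof.
apply/negP => /vlineP[q qE]; have := nsq q; apply/negP; rewrite negbK; apply/eqP.
by apply: (@algI K); rewrite int_alg -s2 qE expr2 algM expr2.
Qed.

Lemma quadratic_generator_dim : \dim {:K} = 2%N.
Proof.
have pr : minPoly 1 s %| 'X^2 - (m%:~R)%:P.
  apply: minPoly_dvdp.
    by rewrite rpredB ?rpredX ?polyOverX// polyOverC -int_alg memvZ// mem1v.
  by rewrite /root !hornerE s2 subrr.
have : (size (minPoly 1 s) <= 3)%N.
  have h : ('X^2 - (m%:~R)%:P : {poly K}) != 0 by rewrite -size_poly_eq0 size_XnsubC.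
  by rewrite -(size_XnsubC (m%:~R : K) (isT : (0 < 2)%N)); apply: dvdp_leq.
rewrite -sf dim_Fadjoin dimv1 muln1 size_minPoly ltnS.
have : adjoin_degree 1 s != 1%N.
  by rewrite adjoin_deg_eq1 quadratic_generator_notin.
have : (0 < adjoin_degree 1 s)%N by rewrite adjoin_degreeE divn_gt0 ?dimv1 ?adim_gt0.
by case: (adjoin_degree _ _) => [|[|[|]]].
Qed.

Lemma quadratic_generator_trace_norm : alg_trace s = 0 /\ alg_norm s = - m%:~R.
Proof.
apply: (quadratic_trace_norm quadratic_generator_dim quadratic_generator_notin).
by rewrite -expr2 s2 scale0r add0r scaleNr opprK int_alg.
Qed.

Lemma quadratic_generator_cross : cross 1 s != 0.
Proof.
have [tr nr] := quadratic_generator_trace_norm; have d2 := quadratic_generator_dim.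
have := cross1_sq d2 tr nr; move=> sq.
have : cross 1 s ^+ 2 != 0.
  rewrite sq scaler_eq0 oner_eq0 orbF expr0n /= add0r oppr_eq0 mulf_neq0// oppr_eq0.
  by have := nsq 0; rewrite expr0n /= eq_sym.
by rewrite expf_eq0.
Qed.

End QuadraticGenerator.

Section MonogenicOrder.
Variable K : fieldExtType rat.
Hypothesis dim2 : \dim {:K} = 2%N.

Lemma monogenic_order (x : K) (T n : int) :
  alg_trace x = T%:~R -> alg_norm x = n%:~R -> cross 1 x != 0 ->
  is_order (lat 1 x) /\ disc (lat 1 x) = T ^+ 2 - 4 * n.
Proof.
move=> tr nr d0.
have xx : x * x = T%:~R * x - n%:~R.
  by rewrite quadratic_char// tr nr -(mulr_algl _ x) !int_alg.
have [b bL bd] := lat_Zbasis dim2 d0.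
split; last first.
  by apply: disc_lat => //; rewrite (cross1_sq dim2 tr nr) -int_alg intrB rmorphXn /= intrM.
split; [by exists b | exact: lat_genl |].
move=> _ _ [p [q ->]] [p' [q' ->]].
exists (p * p' - q * q' * n), (p * q' + q * p' + q * q' * T).
transitivity (p%:~R * p'%:~R + (p%:~R * q'%:~R + q%:~R * p'%:~R) * x + q%:~R * q'%:~R * (x * x)); first by ring.
by rewrite xx !(intrB, intrD, intrM); ring.
Qed.

End MonogenicOrder.

(** All that the counting asks of a discriminant: it divides t^2 - 4 with a square quotient, it
    belongs to a quadratic order, and OL has no multipliers outside O. The last clause ranges over
    every K and O because [h] selects its own model of the order. *)
Definition order_of_trace (g : 'M[int]_2) (D : int) : Prop :=
  [/\ exists2 f : nat, (0 < f)%N & f%:Z ^+ 2 * D = (\tr g) ^+ 2 - 4,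
     exists (K : fieldExtType rat) (O : set K), [/\ \dim {:K} = 2%N, is_order O & disc O = D] &
     forall (K : fieldExtType rat) (O : set K) (e : K),
       \dim {:K} = 2%N -> is_order O -> disc O = D ->
       O e -> e + cj e = (\tr g)%:~R -> e * cj e = 1 -> exact_multipliers O (matrix_ideal O e g)].

Lemma hyperbolic_lower_left (g : 'M[int]_2) : \det g = 1 -> hyperbolic g -> g 1 0 != 0.
Proof.
rewrite /hyperbolic det2 trace2 => dg; apply: contraTneq => c0; move: dg; rewrite c0 mulr0 subr0.
move: (g 0 0) (g 1 1) => a d ad.
have := congr1 absz ad; rewrite abszM => /eqP; rewrite muln_eq1 => /andP[/eqP h1 /eqP h2].
by move: h1 h2; clear; lia.
Qed.

Section Hyperbolic.
Variable g : 'M[int]_2.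
Hypotheses (det_g : \det g = 1) (hyp_g : hyperbolic g).

Let nsq (q : rat) : q ^+ 2 != (\tr g ^+ 2 - 4)%:~R.
Proof. exact: trace_disc_nonsquare. Qed.

(** With e = (t + s) / 2 an integral unit, f is the index of Z + Z e in the ring of integers. The
    condition on multipliers costs nothing for a maximal order: any multiplier of a lattice is
    integral. *)
Lemma disc_field_order : order_of_trace g (disc_field g).
Proof.
have [K [s [s2 sf]]] := quadratic_field_exists nsq.
have : [set d | exists (K : fieldExtType rat) (s : K),
    [/\ s ^+ 2 = ((\tr g) ^+ 2 - 4)%:~R, <<1; s>>%VS = {:K}%VS
      & d = disc (@ring_of_integers K)]] (disc_field g).
  by apply: xgetPex; exists (disc (@ring_of_integers K)), K, s.
move=> {K s s2 sf} [K [s [s2 sf ->]]].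
have d2 := quadratic_generator_dim nsq s2 sf.
have [trs nrs] := quadratic_generator_trace_norm nsq s2 sf.
have cs := quadratic_generator_cross nsq s2 sf.
pose t := \tr g; pose e : K := 2^-1 * (t%:~R + s).
have two : (2 : K) != 0 := negbT (intK_eq0 K 2).
have cjs : cj s = - s by rewrite /cj trs scale0r add0r.
have cj2 : cj (2 : K) = 2 := cj_int d2 2.
have cje : cj e = 2^-1 * (t%:~R - s) by rewrite /e cjM// cjV// cj2 cjD cj_int// cjs.
have tre : e + cj e = t%:~R. rewrite cje /e; field; exact: two.
have four : (4 : K) != 0 := negbT (intK_eq0 K 4).
have nre : e * cj e = 1.
  have -> : e * cj e = (t%:~R ^+ 2 - s ^+ 2) / 4.
    rewrite cje /e; field; by rewrite four two.
  rewrite s2 intrB rmorphXn /= opprB addrC subrK.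
  by rewrite divff.
have ce : cross 1 e != 0.
  have -> : cross 1 e = 2^-1 * cross 1 s by rewrite /cross cje cjs cj1// /e; field; exact: two.
  by rewrite mulf_neq0// invr_eq0.
have tre' : alg_trace e = t%:~R by apply: (@algI K); rewrite alg_traceE tre int_alg.
have nre' : alg_norm e = 1%:~R by apply: (@algI K); rewrite -mul_cj// nre int_alg.
have ei : ring_of_integers e by apply/(ring_of_integersP d2); exists t, 1.
have Ko := ring_of_integers_order d2 ei ce.
have [w [b [c [OE dw trw nrw DE]]]] := order_generator d2 Ko.
split.
- have [i [j eE]] : lat 1 w e by rewrite -OE.
  have cej : cross 1 e = j%:~R * cross 1 w.
    by rewrite eE /cross cjD !cjM// !cj_int// cj1//; ring.
  exists `|j|%N.
    by rewrite absz_gt0; apply: contra_neq ce => j0; rewrite cej j0 mul0r.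
  apply: (@intr_inj rat); apply: (@algI K); rewrite !int_alg intrM.
  rewrite -(order_disc_sq d2 Ko OE dw) abszE real_normK ?num_real// rmorphXn /= -exprMn -cej.
  by rewrite (cross1_sq d2 tre' nre') -int_alg mulr1 intrB rmorphXn.
- by exists K, (@ring_of_integers K).
move=> K' O e' d2' Oo DD Oe' tr' nr' x xJ.
have fr := matrix_ideal_fractional d2' Oo Oe' (hyperbolic_lower_left det_g hyp_g).
have [u [v [uv JE]]] := fractional_ideal_lat d2' Oo fr.
rewrite JE in xJ.
have [a' [b' [trx nrx]]] := lat_multiplier_integral d2' uv xJ.
exact: (order_mem_of_fundamental d2 d2' Ko Oo DD trx nrx).
Qed.

End Hyperbolic.

(** * The multiplier ring of a hyperbolic matrix *)

Section Multiplier.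
Variable g : 'M[int]_2.
Hypotheses (det_g : \det g = 1) (hyp_g : hyperbolic g).

Let a := g 0 0. Let b := g 0 1. Let c := g 1 0. Let d := g 1 1.
Let G : 'M[rat]_2 := map_mx intr g.

Lemma matrix_content : exists (F : nat) (b' c' d' r s t : int),
  [/\ (0 < F)%N, b = F%:Z * b', c = F%:Z * c', d - a = F%:Z * d' & r * b' + s * c' + t * d' = 1].
Proof.
have c0 : c != 0 by apply: hyperbolic_lower_left.
have [p [q h1]] := Bezoutz b c.
have [r [s h2]] := Bezoutz (gcdz b c) (d - a).
set F := gcdz (gcdz b c) (d - a) in h2.
have F0 : F != 0 by rewrite !gcdz_eq0 (negPf c0) andbF.
have FE : (`|F|%N : int) = F by [].
have gb : (F %| b)%Z by apply: dvdz_trans (dvdz_gcdl _ _) (dvdz_gcdl _ _).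
have gc : (F %| c)%Z by apply: dvdz_trans (dvdz_gcdl _ _) (dvdz_gcdr _ _).
have gd : (F %| d - a)%Z by apply: dvdz_gcdr.
exists `|F|%N, (b %/ F)%Z, (c %/ F)%Z, ((d - a) %/ F)%Z, (r * p), (r * q), s.
rewrite FE absz_gt0 F0; split=> //; try by rewrite mulrC divzK.
apply: (mulIf F0); rewrite mul1r -[RHS]h2 -h1.
transitivity (r * p * ((b %/ F)%Z * F) + r * q * ((c %/ F)%Z * F) + s * (((d - a) %/ F)%Z * F)); first by ring.
by rewrite !divzK//; ring.
Qed.

Variables (F : nat) (b' c' d' r s t : int).
Hypotheses (F0 : (0 < F)%N) (bE : b = F%:Z * b') (cE : c = F%:Z * c')
  (dE : d - a = F%:Z * d') (rst : r * b' + s * c' + t * d' = 1).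

(** Dividing g - a by the content F of (b, c, d - a) gives [w0]; with 1 it spans the multiplier ring
    over Z. *)
Let w0 : 'M[rat]_2 := mx2 0 b'%:~R c'%:~R d'%:~R.

Let FR : (F%:Z%:~R : rat) != 0.
Proof. by rewrite intr_eq0 eqz_nat -lt0n. Qed.

Let c'0 : c' != 0.
Proof. by apply: contra_neq (hyperbolic_lower_left det_g hyp_g) => h; rewrite -/c cE h mulr0. Qed.

Let GE : G = a%:~R *: 1 + F%:Z%:~R *: w0.
Proof.
apply: mx2_eq; rewrite !mxE/= ?mulr0 ?mulr1 ?add0r ?addr0//.
- by rewrite -intrM -bE.
- by rewrite -intrM -cE.
- by rewrite -intrM -intrD -dE addrC subrK.
Qed.

Let w0w0 : w0 * w0 = d'%:~R *: w0 + (b' * c')%:~R *: 1.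
Proof.
rewrite -[w0 * w0]/(w0 *m w0).
by apply: mx2_eq; rewrite !mxE !big_ord2 !mxE/= ?intrM; ring.
Qed.

Let V : {aspace 'M[rat]_2} := Q_adjoin g.

Let V1 : 1 \in V.
Proof. exact: (subvP (sub1_agenv _) _ (memv_line _)). Qed.

Let Vw : w0 \in V.
Proof.
have VG : G \in V by apply: memv_adjoin.
have -> : w0 = (F%:Z%:~R)^-1 *: (G - a%:~R *: 1) by rewrite GE addrC addKr scalerA mulVf// scale1r.
by rewrite memvZ// memvB// memvZ.
Qed.

Let VP x : x \in V -> exists p q : rat, x = p *: 1 + q *: w0.
Proof.
have : (V <= <[1]> + <[w0]>)%VS.
  apply: agenv_sub_modl; first exact: addvSl.
  apply/prodvP => u v /memv_addP[_ /vlineP[k ->] [_ /vlineP[l ->] ->]].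
  move=> /memv_addP[_ /vlineP[p ->] [_ /vlineP[q ->] ->]].
  have -> : (k *: 1 + l *: map_mx intr g) * (p *: 1 + q *: w0) =
     (k * p + l * (a%:~R * p) + l * F%:Z%:~R * q * (b' * c')%:~R) *: 1 +
     (k * q + l * a%:~R * q + l * F%:Z%:~R * p + l * F%:Z%:~R * q * d'%:~R) *: w0.
    rewrite -/G GE; transitivity ((k * p + l * (a%:~R * p)) *: 1 + (k * q + l * a%:~R * q + l * F%:Z%:~R * p) *: w0
       + (l * F%:Z%:~R * q) *: (w0 * w0)).
      have mulE (A B : 'M[rat]_2) : A * B = A *m B by [].
      by rewrite !mulE; apply: mx2_eq; rewrite !mxE !big_ord2 !mxE/=; ring.
    by rewrite w0w0; apply: mx2_eq; rewrite !mxE/=; ring.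
  by apply: memv_add; apply: memvZ; apply: memv_line.
move=> /subvP sub /sub /memv_addP[_ /vlineP[p ->] [_ /vlineP[q ->] ->]].
by exists p, q.
Qed.

Let W : subvs_of V := Subvs Vw.

Let val1 : vsval (1 : subvs_of V) = 1.
Proof. by apply/eqP; rewrite /= algid_eq1. Qed.

Let W1 : W \notin <[1]>%VS.
Proof.
apply/negP => /vlineP[k kE].
have : w0 = k *: 1 by rewrite -val1 -[RHS]/(vsval (k *: (1 : subvs_of V))) -kE.
move=> /(congr1 (fun M : 'M[rat]_2 => M 1 0)).
by rewrite !mxE/= mulr0 => /eqP; rewrite intr_eq0 (negPf c'0).
Qed.

Let freeW : free [:: 1; W].
Proof.
rewrite free_cons span_seq1 seq1_free; apply/andP; split; last first.
  by apply: contraNneq W1 => ->; apply: mem0v.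
apply/negP => /vlineP[k kE].
have k0 : k != 0 by apply/eqP => k0; move/eqP: kE; rewrite k0 scale0r oner_eq0.
by case/negP: W1; apply/vlineP; exists k^-1; rewrite kE scalerA mulVf// scale1r.
Qed.

Let VE (x : subvs_of V) : exists p q : rat, x = p *: 1 + q *: W.
Proof.
have [p [q e]] := VP (valP x); exists p, q; apply: val_inj; rewrite [LHS]e.
by rewrite -val1.
Qed.

Let dimV : \dim {:subvs_of V} = 2%N.
Proof.
have fE : ({:subvs_of V} = <<[:: 1%R; W]>>)%VS.
  apply/vspaceP => x; rewrite memvf; have [p [q ->]] := VE x.
  by rewrite memvD// memvZ// memv_span// !inE eqxx ?orbT.
by rewrite fE (eqP freeW).
Qed.

(** The matrix p + q [w0] is integral exactly when p, q b', q c', q d' are integers, and since b',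
    c', d' are coprime this means that p and q are. The discriminant is read off from w0^2 = d' w0 +
    b' c'. *)
Lemma disc_multiplier_content : disc_multiplier g = d' ^+ 2 + 4 * b' * c'.
Proof.
have sb : size [:: 1; W] == \dim {:subvs_of V} by rewrite dimV.
have WW : W * W = d'%:~R *: W - (- (b' * c')%:~R) *: 1.
  apply: val_inj; rewrite /= scaleNr opprK -[LHS]/(w0 * w0) w0w0.
  by rewrite -[RHS]/(d'%:~R *: w0 + (b' * c')%:~R *: vsval (1 : subvs_of V)) val1.
have [trW _] := quadratic_trace_norm dimV W1 WW.
have tr1 : alg_trace (1 : subvs_of V) = 2 by rewrite /alg_trace mul_matrix1 mxtrace_scalar dimV.
have [u' [v' [/= [<- <-] sp dt _]]] := tuple2_facts (Tuple sb) dimV.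
apply: (@disc_eq _ _ (Tuple sb)).
  split.
    rewrite basisEfree freeW subvf size_tuple leqnn //.
  rewrite sp; apply/seteqP; split=> [x [m mE]|x [p [q ->]]].
    have [p [q xE]] := VE x; exists (m 0 0), (r * m 0 1 + s * m 1 0 + t * (m 1 1 - m 0 0)).
    have xv : p *: 1 + q *: w0 = map_mx intr m.
      by rewrite -mE xE -val1.
    have e00 := congr1 (fun M : 'M[rat]_2 => M 0 0) xv; have e01 := congr1 (fun M : 'M[rat]_2 => M 0 1) xv.
    have e10 := congr1 (fun M : 'M[rat]_2 => M 1 0) xv; have e11 := congr1 (fun M : 'M[rat]_2 => M 1 1) xv.
    rewrite !mxE/= in e00 e01 e10 e11.
    have pE : p = (m 0 0)%:~R by rewrite -e00; ring.
    have qE : q = (r * m 0 1 + s * m 1 0 + t * (m 1 1 - m 0 0))%:~R.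
      transitivity (q * (r * b' + s * c' + t * d')%:~R); first by rewrite rst mulr1.
      by rewrite !(intrB, intrD, intrM) -e00 -e01 -e10 -e11; ring.
    by rewrite xE pE qE !scaler_int.
  exists (mx2 p (q * b') (q * c') (p + q * d')).
  rewrite -!scaler_int -[LHS]/(p%:~R *: vsval (1 : subvs_of V) + q%:~R *: w0) val1.
  by apply: mx2_eq; rewrite !mxE/= ?intrD ?intrM; ring.
rewrite dt !mul1r mulr1 WW tr1 trW alg_traceD -scaleNr opprK !alg_traceZ trW tr1.
by rewrite intrD !intrM; ring.
Qed.


Section Theta.
Variables (K : fieldExtType rat) (e : K).
Hypotheses (dim2 : \dim {:K} = 2%N) (etr : e + cj e = (\tr g)%:~R) (enr : e * cj e = 1).

(** The counterpart of [w0] in K, with e in the role of g. *)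
Let theta : K := (e - a%:~R) / F%:Z%:~R.

Let FK : (F%:Z%:~R : K) != 0.
Proof. by rewrite intK_eq0 eqz_nat -lt0n. Qed.

Let thetaE : e - a%:~R = F%:Z%:~R * theta.
Proof. by rewrite mulrC divfK. Qed.

Lemma theta_trace_norm : alg_trace theta = d'%:~R /\ alg_norm theta = (- (b' * c'))%:~R.
Proof.
have cth : cj theta = (cj e - a%:~R) / F%:Z%:~R.
  by rewrite /theta cjM// cjV// cj_int// cjB cj_int.
have dR : a%:~R * d%:~R - b%:~R * c%:~R = 1 :> K by rewrite -!intrM -intrB -det2 det_g.
have trE : e + cj e = a%:~R + d%:~R by rewrite etr trace2 intrD.
split; apply: (@algI K); rewrite int_alg.
  rewrite alg_traceE cth /theta -mulrDl; apply: (mulIf FK); rewrite divfK//.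
  have -> : e - a%:~R + (cj e - a%:~R) = (e + cj e) - 2 * a%:~R by ring.
  have -> : d'%:~R * F%:Z%:~R = d%:~R - a%:~R :> K by rewrite mulrC -intrM -dE intrB.
  by rewrite trE; ring.
rewrite -mul_cj// cth /theta; apply: (mulIf FK); apply: (mulIf FK).
have -> : (e - a%:~R) / F%:Z%:~R * ((cj e - a%:~R) / F%:Z%:~R) * F%:Z%:~R * F%:Z%:~R
    = e * cj e - a%:~R * (e + cj e) + a%:~R * a%:~R by field.
have -> : (- (b' * c'))%:~R * F%:Z%:~R * F%:Z%:~R = - (b%:~R * c%:~R) :> K.
  by rewrite bE cE mulrNz !intrM; ring.
by rewrite enr trE -[X in X - _ + _]dR; ring.
Qed.

(** Here O = Z + Z theta already preserves L, so OL = L. If x = p + q theta preserves L, its matrix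
    in the basis of L shows that p, q c', q b' and p + q d' are integers, and coprimality makes q an
    integer. *)
Lemma multiplier_exact (O : set K) : is_order O -> disc O = d' ^+ 2 + 4 * b' * c' ->
  O e -> exact_multipliers O (matrix_ideal O e g).
Proof.
move=> Oo DD Oe.
have [trT nrT] := theta_trace_norm.
have c0 := hyperbolic_lower_left det_g hyp_g.
have [Oth Osub] : O theta /\ O `<=` lat 1 theta.
  by apply: (order_mem_of_disc dim2 Oo trT nrT); rewrite DD; ring.
have thL : theta * (e - a%:~R) = b'%:~R * c%:~R + d'%:~R * (e - a%:~R).
  apply: (mulfI FK); rewrite mulrA -thetaE.
  have -> : (e - a%:~R) * (e - a%:~R) = e * (e - a%:~R) - a%:~R * (e - a%:~R) by ring.
  by rewrite (matrix_lat_actr etr enr det_g)// -/a -/b -/c -/d bE -[d](subrK a) dE !(intrD, intrM); ring.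
have thc : theta * c%:~R = c'%:~R * (e - a%:~R).
  by rewrite cE intrM thetaE; ring.
have matL : matrix_ideal O e g `<=` matrix_lat e g.
  have st x y : O x -> matrix_lat e g y -> matrix_lat e g (x * y).
    move=> /Osub[m [n ->]] yL; rewrite mulrDl mulr1 -mulrA; apply: latD; apply: latMz => //.
    case: yL => p [q ->]; rewrite mulrDr ![theta * (_ * _)]mulrCA -/a -/c thL thc.
    apply: latD; apply: latMz; first by apply: latMz; apply: lat_genr.
    by apply: latD; apply: latMz; [apply: lat_genl | apply: lat_genr].
  by move=> _ [x [y [Ox Oy ->]]]; apply: latD; apply: st => //; [apply: lat_genl | apply: lat_genr].
move=> x xJ.
have ce : cross 1 e != 0.
  have h : cross 1 e ^+ 2 = (\tr g ^+ 2 - 4)%:~R.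
    have -> : cross 1 e ^+ 2 = (e + cj e) ^+ 2 - 4 * (e * cj e) by rewrite /cross cj1//; ring.
    by rewrite etr enr mulr1 intrB rmorphXn.
  have : cross 1 e ^+ 2 != 0.
    by rewrite h intK_eq0 -(intr_eq0 rat) eq_sym; have := trace_disc_nonsquare 0 hyp_g; rewrite expr0n.
  by rewrite expf_eq0.
have cth : cross 1 theta != 0.
  have : cross 1 e = F%:Z%:~R * cross 1 theta.
    have eE : e = a%:~R + F%:Z%:~R * theta by rewrite -thetaE addrC subrK.
    by rewrite {1}eE /cross cjD cjM// !cj_int// cj1//; ring.
  by move=> h; apply: contra_neq ce => h'; rewrite h h' mulr0.
have d0 := matrix_lat_cross_neq0 dim2 ce c0.
have [p [q xE]] := cross_coords dim2 x cth.
have x1 : matrix_lat e g (x * c%:~R).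
  by apply/matL/xJ/matrix_lat_sub => //; apply: lat_genl.
have x2 : matrix_lat e g (x * (e - a%:~R)).
  by apply/matL/xJ/matrix_lat_sub => //; apply: lat_genr.
have iA (k : int) : k%:~R = (k%:~R : rat)%:A :> K by rewrite int_alg.
have [m1 [m2 e1]] := x1; have [m3 [m4 e2]] := x2.
have [p1 q1] : p = m1%:~R /\ q * c'%:~R = m2%:~R.
  apply: (cross_coords_inj dim2 d0); rewrite -!iA -e1 xE mulrDl mulr1 -/a -/c -mulrA thc.
  by rewrite (iA c') algM; ring.
have [q2 p2] : q * b'%:~R = m3%:~R /\ p + q * d'%:~R = m4%:~R.
  apply: (cross_coords_inj dim2 d0); rewrite -!iA -e2 xE mulrDl mulr1 -/a -/c -mulrA thL.
  by rewrite (iA b') (iA d') !algM scalerDl algM; ring.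
have qE : q = (r * m3 + s * m2 + t * (m4 - m1))%:~R.
  transitivity (q * (r * b' + s * c' + t * d')%:~R); first by rewrite rst mulr1.
  by rewrite !(intrB, intrD, intrM) -q1 -q2 -p2 -p1; ring.
have O1 : O 1 by have [_ ? _] := Oo.
have OD y z : O y -> O z -> O (y + z).
  by have [w [? [? [-> _ _ _ _]]]] := order_generator dim2 Oo; apply: latD.
have OM y z : O y -> O z -> O (y * z) by have [_ _] := Oo; apply.
by rewrite xE p1 qE -!iA; apply: OD; apply: OM => //; apply: order_int.
Qed.

End Theta.
End Multiplier.

Lemma disc_multiplier_order (g : 'M[int]_2) : \det g = 1 -> hyperbolic g ->
  order_of_trace g (disc_multiplier g).
Proof.
move=> dg hg.
have [F [b' [c' [d' [r [s [t [F0 bE cE dE rst]]]]]]]] := matrix_content dg hg.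
have DE := disc_multiplier_content dg hg F0 bE cE dE rst.
have sq : F%:Z ^+ 2 * disc_multiplier g = \tr g ^+ 2 - 4.
  rewrite DE trace2.
  have -> : (g 0 0 + g 1 1) ^+ 2 - 4 = (g 1 1 - g 0 0) ^+ 2 + 4 * (g 0 1 * g 1 0) + 4 * (\det g - 1).
    by rewrite det2; ring.
  by rewrite dg subrr mulr0 addr0 bE cE dE; ring.
split.
- by exists F.
(* The multiplier ring lives in an algebra of matrices, while an order in a [fieldExtType] is
   wanted. The field is taken from the maximal order, and Z + Z theta is the required order in
   it. *)
- have [[f1 f10 fD] [K [ O [d2 Oo DD]]] _] := disc_field_order dg hg.
  rewrite -DD in fD; have [e [Oe tr nr ce _]] := unit_of_trace d2 Oo f10 fD.
  have [trT nrT] := theta_trace_norm dg F0 bE cE dE d2 tr nr.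
  set th := (_ / _) in trT nrT.
  have FK : F%:Z%:~R != 0 :> K by rewrite intK_eq0 eqz_nat -lt0n.
  have cth : cross 1 th != 0.
    have : cross 1 e = F%:Z%:~R * cross 1 th.
      have eE : e = (g 0 0)%:~R + F%:Z%:~R * th by rewrite mulrC divfK// addrC subrK.
      by rewrite {1}eE /cross cjD cjM// !cj_int// cj1//; ring.
    by move=> h; apply: contra_neq ce => h'; rewrite h h' mulr0.
  have [Oth Dth] := monogenic_order d2 trT nrT cth.
  by exists K, (lat 1 th); split=> //; rewrite Dth DE; ring.
- move=> K O e d2 Oo DD Oe tr nr; rewrite DE in DD.
  exact: (multiplier_exact dg hg F0 bE cE dE rst d2 tr nr Oo DD Oe).
Qed.


(** * Bounds for the class number *)

Lemma h_spec (D : int) :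
  (exists (K : fieldExtType rat) (O : set K), [/\ \dim {:K} = 2%N, is_order O & disc O = D]) ->
  exists (K : fieldExtType rat) (O : set K),
    [/\ \dim {:K} = 2%N, is_order O, disc O = D & h D = narrow_class_number O].
Proof.
move=> [K [ O [d2 Oo DD]]].
have : [set n | exists (K : fieldExtType rat) (O : set K),
    [/\ \dim {:K} = 2, is_order O, disc O = D & n = narrow_class_number O]] (h D).
  by apply: xgetPex; exists (narrow_class_number O), K, O.
by move=> [K' [ O' [d2' Oo' DD' e]]]; exists K', O'.
Qed.

Lemma h_le (D : int) (S M : nat) :
  (exists (K : fieldExtType rat) (O : set K), [/\ \dim {:K} = 2%N, is_order O & disc O = D]) ->
  0 < D -> D <= (S ^ 2)%N%:Z ->
  (forall m, (0 < m <= S ^ 2)%N -> (size (divisors m) <= M)%N) ->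
  (h D <= S.*2.+1 * (2 * M) * 2)%N.
Proof.
move=> /h_spec[K [ O [d2 Oo DD ->]]] D0 DS MP.
rewrite -DD in D0 DS.
by have [_] := atmost_finite (atmost_narrow_class_group d2 Oo D0 DS MP).
Qed.

(** The crude S and M only give finiteness, which makes [fset_set] count the classes. *)
Lemma narrow_class_group_atmost (K : fieldExtType rat) (O : set K) : \dim {:K} = 2%N ->
  is_order O -> 0 < disc O -> atmost (narrow_class_group O) (narrow_class_number O).
Proof.
move=> d2 Oo D0; apply: atmost_fset.
pose S := `|disc O|%N; pose M := \max_(m < (S ^ 2).+1) size (divisors m).
have DS : disc O <= (S ^ 2)%N%:Z.
  rewrite -[disc O]gtz0_abs// -/S lez_nat; case: (S) => // n; rewrite -[X in (X <= _)%N]expn1.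
  by rewrite leq_pexp2l.
have MP m : (0 < m <= S ^ 2)%N -> (size (divisors m) <= M)%N.
  move=> /andP[_ mS]; have mS' : (m < (S ^ 2).+1)%N by [].
  exact: (leq_bigmax (Ordinal mS')).
by have [] := atmost_finite (atmost_narrow_class_group d2 Oo D0 DS MP).
Qed.

(** * Matrices with a small class number *)

Section Discriminants.
Variable R : realType.
Variable dd : 'M[int]_2 -> int.
Hypothesis ddP : forall g, \det g = 1 -> hyperbolic g -> order_of_trace g (dd g).

Lemma hyperbolic_dd (g : 'M[int]_2) : \det g = 1 -> hyperbolic g ->
  0 < dd g /\ dd g <= \tr g ^+ 2.
Proof.
move=> dg hg; have [[f f0 fD] _ _] := ddP dg hg.
have t4 : 4 < \tr g ^+ 2.
  rewrite -[\tr g ^+ 2]real_normK ?num_real//; apply: (@lt_le_trans _ _ (3 ^+ 2)) => //.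
  by rewrite ler_pXn2r// nnegrE.
have f1 : 1 <= f%:Z ^+ 2 by rewrite exprn_ege1// lez_nat.
have D0 : 0 < dd g.
  have : 0 < f%:Z ^+ 2 * dd g by rewrite fD subr_gt0.
  by rewrite pmulr_rgt0// (lt_le_trans _ f1).
split=> //; apply: (@le_trans _ _ (f%:Z ^+ 2 * dd g)); first by rewrite ler_peMl// ltW.
by rewrite fD lerBlDr lerDl.
Qed.

(** The pair (t, f) fixes the discriminant, so a single order and a single unit e serve all these
    matrices. *)
Lemma atmost_trace_conductor (N C E J H : nat) (t : int) (f : nat) :
  (0 < C)%N -> (2 <= E)%N -> (0 < f)%N -> 2 < `|t| ->
  (4 * N <= E * `|t|)%N -> (`|t| ^ 2 <= 2 ^ J)%N ->
  atmost [set g | [/\ SL2Z_box N g, \tr g = t, (C <= `|g 1%R 0%R|)%N,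
      f%:Z ^+ 2 * dd g = t ^+ 2 - 4 & (h (dd g) <= H)%N]]
   (H * (f ^ 4 * 2 * (J * ((2 * E).+1 * E.+1 * (N %/ C).+1.*2.+1)))).
Proof.
move=> C0 E2 f0 t2 EN tJ; set A := [set g | _].
have [[g0 Ag0]|no] := pselect (exists g, A g); last first.
  by move=> [|g s] //= _ /(_ g (mem_head _ _)) ?; case: no; exists g.
have [[dg0 _] tr0 _ fD0 hH] := Ag0.
have hg0 : hyperbolic g0 by rewrite /hyperbolic tr0.
have [_ ex _] := ddP dg0 hg0; have [D0 _] := hyperbolic_dd dg0 hg0.
have [K [ O [d2 Oo DD hE]]] := h_spec ex.
have fz : f%:Z ^+ 2 != 0 by rewrite expf_neq0// eqz_nat -lt0n.
rewrite -DD in fD0; have [e [Oe tr nr ce fO]] := unit_of_trace d2 Oo f0 fD0.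
apply: (@atmost_leq _ _ (h (dd g0) * (f ^ 4 * 2 * (J * ((2 * E).+1 * E.+1 * (N %/ C).+1.*2.+1))))).
  by rewrite leq_mul2r hH orbT.
apply: (atmost_matrices_of_trace d2 Oo f0 Oe tr nr ce fO).
- move=> g [[dg _] trg _ fD _].
  have hg : hyperbolic g by rewrite /hyperbolic trg.
  have De : disc O = dd g by apply: (mulfI fz); rewrite fD0 fD.
  split=> //; first exact: hyperbolic_lower_left.
  by have [_ _ ex2] := ddP dg hg; apply: ex2; rewrite ?trg.
- rewrite hE; apply: narrow_class_group_atmost => //; by rewrite DD.
- move=> g [[dg _] trg _ _ _].
  apply: (atmost_sub (B := [set g' | [/\ SL2Z_box N g', SL2Z_conj g g' & (C <= `|g' 1%R 0%R|)%N]])).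
    by move=> g' [[]].
  by apply: (atmost_conj_box R); rewrite ?trg //; move: t2; clear; lia.
Qed.

(** The four summands count, in order, the matrices with |t| <= Tm, those with |c| <= C, those with
    f > F^2, whose traces have a large square factor, and the rest, grouped by (t, f). *)
Lemma atmost_small_class_number (N M C Tm F E J H : nat) :
  (0 < C)%N -> (2 <= E)%N -> (0 < F)%N -> (4 * N <= E * Tm)%N -> ((2 * N) ^ 2 <= 2 ^ J)%N ->
  (forall m, (0 < m <= (N ^ 2).+1)%N -> (size (divisors m) <= M)%N) ->
  exists n, [/\ (F * n <= 64 * (2 * N + 2))%N &
   atmost [set g | [/\ SL2Z_box N g, hyperbolic g & (h (dd g) <= H)%N]]
    (Tm.*2.+1 * N.*2.+1 * (2 * M) + (N.*2.+1 * C.*2.+1 * (2 * M) + 6 * N.*2.+1)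
     + n * N.*2.+1 * (2 * M)
     + (2 * N).*2.+1 * (F ^ 2).+1 * (H * ((F ^ 2) ^ 4 * 2 * (J * ((2 * E).+1 * E.+1 * (N %/ C).+1.*2.+1)))))].
Proof.
move=> C0 E2 F0 EN NJ MP.
have [n [nF nA]] := atmost_large_square_traces (2 * N) F0; exists n; split=> //.
set m := (_ * (_ * (_ * _)))%N in |- *.
pose A1 := [set g | SL2Z_box N g /\ [set t : int | (2 < `|t|)%N /\ (`|t| <= Tm)%N] (\tr g)].
pose A2 := [set g | SL2Z_box N g /\ (`|g 1%R 0%R| <= C)%N].
pose A3 := [set g | SL2Z_box N g /\ large_square_traces (2 * N) F (\tr g)].
pose A4 := [set g | [/\ SL2Z_box N g, hyperbolic g, (h (dd g) <= H)%N & [/\ (Tm < `|\tr g|)%N, (C < `|g 1%R 0%R|)%N &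
   exists f, [/\ (0 < f)%N, (f <= F ^ 2)%N & f%:Z ^+ 2 * dd g = \tr g ^+ 2 - 4]]]].
have trN g : SL2Z_box N g -> (`|\tr g| <= 2 * N)%N.
  move=> [_ gN]; rewrite trace2; have := gN 0 0; have := gN 1 1.
  by move: (g 0 0) (g 1 1) => x y; clear; lia.
apply: (atmost_sub (B := ((A1 `|` A2) `|` A3) `|` A4)).
  move=> g [gN hg hH]; have [dg _] := gN.
  have t2 : (2 < `|\tr g|)%N by move: hg; rewrite /hyperbolic; clear; lia.
  have [tT|tT] := leqP `|\tr g| Tm; first by left; left; left.
  have [cC|cC] := leqP `|g 1 0| C; first by left; left; right.
  have [[f f0 fD] _ _] := ddP dg hg.
  have [fF|fF] := leqP f (F ^ 2); first by right; split=> //; split=> //; exists f.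
  left; right; split=> //; split=> //; first exact: trN.
  by exists f; split=> //; rewrite -fD abszM abszX dvdn_mulr.
apply: atmostU; first apply: atmostU; first apply: atmostU.
- apply: atmost_SL2Z_trace MP => //; last by move=> t [].
  by apply: (atmost_sub _ (@atmost_absz Tm)) => t [].
- exact: atmost_SL2Z_small_lower_left.
- by apply: atmost_SL2Z_trace MP => //; move=> t [].
have exf g : exists f, A4 g -> [/\ (0 < f)%N, (f <= F ^ 2)%N & f%:Z ^+ 2 * dd g = \tr g ^+ 2 - 4].
  have [Ag|nA'] := pselect (A4 g); last by exists 0%N.
  by have [_ _ _ [_ _ [f fP]]] := Ag; exists f.
have /choice[f fP] := exf.
apply: (atmost_fiber (phi := fun g => (\tr g, f g)) (B := [set p | (`|p.1| <= 2 * N)%N /\ (p.2 < (F ^ 2).+1)%N])).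
- exact: (@atmostX _ _ [set z | (`|z| <= 2 * N)%N] [set i | (i < (F ^ 2).+1)%N] _ _ (@atmost_absz _) (@atmost_nat _)).
- by move=> g Ag; have [_ f1 _] := fP g Ag; split=> //=; apply: trN; case: Ag.
move=> [t f0] [/= tN fF].
have [[g0 [Ag0 e0]]|no] := pselect (exists g, A4 g /\ (\tr g, f g) = (t, f0)); last first.
  by move=> [|g s] //= _ /(_ g (mem_head _ _)) ?; case: no; exists g.
case: e0 => e1 e2; have [f1 f2 _] := fP _ Ag0; rewrite e2 in f1 f2.
have [gN0 hg0 _ [tT cC _]] := Ag0.
apply: (@atmost_leq _ _ (H * (f0 ^ 4 * 2 * (J * ((2 * E).+1 * E.+1 * (N %/ C).+1.*2.+1))))).
  by rewrite /m leq_mul2l leq_mul2r leq_mul2r leq_exp2r// f2 !orbT.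
apply: (atmost_sub (B := [set g | [/\ SL2Z_box N g, \tr g = t, (C <= `|g 1%R 0%R|)%N,
      f0%:Z ^+ 2 * dd g = t ^+ 2 - 4 & (h (dd g) <= H)%N]])).
  by move=> g [Ag [<- <-]]; have [? ? ? [? ? _]] := Ag; have [_ _ ?] := fP g Ag; split=> //; apply: ltnW.
rewrite -e1 in tN *.
apply: atmost_trace_conductor => //.
  by apply: leq_trans EN _; rewrite leq_mul2l ltnW ?orbT.
by apply: leq_trans NJ; rewrite leq_exp2r.
Qed.

End Discriminants.

(** * Asymptotics *)

(* X is the integer part of the k-th root of T: all bounds become polynomial in X,
   and a factor X stands for an arbitrarily small power of T. *)
Lemma size_divisors_power_bound k : (0 < k)%N ->
  exists2 c, (0 < c)%N & forall X m, (0 < X)%N -> (0 < m <= (2 * (2 * X) ^ k) ^ 2)%N ->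
    (size (divisors m) <= c * X)%N.
Proof.
move=> k0; have k20 : (0 < 2 * k)%N by rewrite muln_gt0.
(* With exponent 2 k, an integer m of order X^(2 k) has O(X) divisors. *)
have [C CP] := size_divisors_bound k20.
exists (C.+1 * 4)%N => // X m X0 /andP[m0 mN].
rewrite -(leq_exp2r _ _ k20); apply: leq_trans (CP m m0) _.
apply: (@leq_trans (C.+1 * (2 * (2 * X) ^ k) ^ 2)); first by rewrite leq_mul.
rewrite !expnMn -!expnM [(k * 2)%N]mulnC mulnA.
rewrite [((C.+1 * 2 ^ 2) * _)%N]mulnA leq_mul2r; apply/orP; right.
apply: (@leq_trans (C.+1 ^ (2 * k) * (2 ^ 2 * 2 ^ (2 * k)))).
  rewrite -mulnA leq_mul2r; apply/orP; right.
  by rewrite -[X in (X <= _)%N]expn1 leq_pexp2l.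
rewrite leq_mul2l; apply/orP; right.
rewrite -expnD (_ : 4 = 2 ^ 2)%N// -expnM leq_pexp2l//.
by move: k0; clear; lia.
Qed.

Section Asymptotics.
Variable R : realType.
Variable dd : 'M[int]_2 -> int.
Hypothesis ddP : forall g, \det g = 1 -> hyperbolic g -> order_of_trace g (dd g).

Lemma class_number_upper k : (0 < k)%N -> exists c, forall X g, (0 < X)%N ->
  SL2Z_box ((2 * X) ^ k) g -> hyperbolic g -> (h (dd g) <= c * X ^ k.+1)%N.
Proof.
move=> k0; have [c c0 cP] := size_divisors_power_bound k0.
exists (20 * 2 ^ k * c)%N => X g X0 gN hg; have [dg gB] := gN.
set N := ((2 * X) ^ k)%N in gN gB.
have [D0 DT] := hyperbolic_dd ddP dg hg; have [_ ex _] := ddP dg hg.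
have tN : (`|\tr g| <= 2 * N)%N.
  rewrite trace2; have := gB 0 0; have := gB 1 1.
  by move: (g 0 0) (g 1 1) => x y; clear; lia.
have DN : dd g <= ((2 * N) ^ 2)%N%:Z.
  apply: le_trans DT _; rewrite -[_ ^+ 2]gez0_abs ?sqr_ge0// lez_nat abszX.
  by rewrite leq_exp2r.
apply: leq_trans (h_le ex D0 DN (fun m => cP X m X0)) _.
have N0 : (0 < N)%N by rewrite expn_gt0 muln_gt0 X0.
apply: (@leq_trans (5 * N * (2 * (c * X)) * 2)).
  by rewrite !leq_mul2r; apply/orP; right; apply/orP; right; move: N0; clear; lia.
rewrite /N expnMn expnS; apply: eq_leq; ring.
Qed.

(** Write k = j + 30, so that N is of order X^k. The thresholds for |t| and |c| are N / (a X^2) and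
    F = X^2: each of the first three families loses X^2 against the divisor bound O(X), leaving
    X^(2k - 1). In the last family the exponents are k for t, 4 for f, j + 1 for h, 16 for f^4, 1
    for J, 4 for the two factors in E and 2 for N / C, in all 2j + 58, below 2k - 1 = 2j + 59. This
    bookkeeping fixes the constant 30. *)
Lemma atmost_small_class_number_power j : exists c, forall X, (0 < X)%N ->
  atmost [set g | [/\ SL2Z_box ((2 * X) ^ (j + 30)) g, hyperbolic g &
     (h (dd g) <= 2 ^ (j + 30) * X ^ j.+1)%N]] (c * X ^ (j.*2 + 59)).
Proof.
set k := (j + 30)%N; have k0 : (0 < k)%N by rewrite /k addnC.
have [c c0 cP] := size_divisors_power_bound k0.
pose a := (2 ^ k)%N.
pose c1 := (18 * a * c)%N; pose c2 := (18 * a)%N; pose c3 := (256 * a * 6 * a * c)%N.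
pose c4 := (5 * a * 2 * a * 2 * (4 * k + 2) * 9 * a * 5 * a * 5 * a)%N.
exists (c1 + (c1 + c2) + c3 + c4)%N => X X0.
pose P := (X ^ j)%N.
have P0 : (0 < P)%N by rewrite expn_gt0 X0.
have a0 : (0 < a)%N by rewrite expn_gt0.
set N := ((2 * X) ^ k)%N.
have NE : N = (a * (P * X ^ 30))%N by rewrite /N expnMn -/a /k expnD.
have N0 : (0 < N)%N by rewrite expn_gt0 muln_gt0 X0.
pose Q := (P * X ^ 28)%N; have Q0 : (0 < Q)%N by rewrite muln_gt0 P0 expn_gt0 X0.
pose E := (4 * a * X ^ 2)%N; pose J := ((4 * k + 2) * X)%N.
have X20 : (0 < X ^ 2)%N by rewrite expn_gt0 X0.
have aX : (0 < a * X ^ 2)%N by rewrite muln_gt0 a0.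
have E2 : (2 <= E)%N by rewrite /E -mulnA; move: aX; clear; lia.
have EN : (4 * N <= E * Q)%N by rewrite NE /E /Q; apply: eq_leq; ring.
have NJ : ((2 * N) ^ 2 <= 2 ^ J)%N.
  apply: (@leq_trans ((2 ^ (k * X.+1).+1) ^ 2)).
    rewrite leq_exp2r// expnS leq_mul2l /= /N [(k * _)%N]mulnC expnM leq_exp2r//.
    by rewrite expnS leq_mul2l /= ltnW// ltn_expl.
  rewrite -expnM leq_pexp2l// /J mulnDl; have : (k <= k * X)%N by rewrite leq_pmulr.
  rewrite [(k * X.+1)%N]mulnS (_ : 4 * k * X = 4 * (k * X))%N; last by rewrite mulnA.
  by clearbody k; move: (k * X)%N X0 => y; clear; lia.
have MP m : (0 < m <= (N ^ 2).+1)%N -> (size (divisors m) <= c * X)%N.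
  move=> /andP[m0 mN]; apply: cP => //; rewrite m0 /=; apply: leq_trans mN _.
  rewrite -/N expnMn; have : (0 < N ^ 2)%N by rewrite expn_gt0 N0.
  by move: (N ^ 2)%N; clear; lia.
have [n [nF nA]] := @atmost_small_class_number R dd ddP N (c * X) Q Q (X ^ 2) E J (a * X ^ j.+1) Q0 E2 X20 EN NJ MP.
apply: (atmost_leq _ nA).
have nQ : (n <= 256 * a * Q)%N.
  rewrite -(leq_pmul2l X20); apply: leq_trans nF _.
  apply: (@leq_trans (256 * N)); first by move: N0; clear; lia.
  by rewrite NE /Q; apply: eq_leq; ring.
have NQ : (N %/ Q = a * X ^ 2)%N.
  by rewrite NE (_ : a * (P * X ^ 30) = a * X ^ 2 * Q)%N ?mulnK// /Q; ring.
have XE : (X ^ (j.*2 + 59) = P * P * X ^ 59)%N by rewrite expnD -addnn expnD.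
have N3 : (N.*2.+1 <= 3 * N)%N by move: N0; clear; lia.
have Q3 : (Q.*2.+1 <= 3 * Q)%N by move: Q0; clear; lia.
rewrite NQ; set Z := (X ^ (j.*2 + 59))%N in XE *.
have H1 : (Q.*2.+1 * N.*2.+1 * (2 * (c * X)) <= c1 * Z)%N.
  apply: (@leq_trans (3 * Q * (3 * N) * (2 * (c * X)))); first by rewrite !leq_mul.
  by rewrite NE XE /Q /c1; apply: eq_leq; ring.
have H2 : (6 * N.*2.+1 <= c2 * Z)%N.
  apply: (@leq_trans (6 * (3 * N))); first by rewrite leq_mul.
  rewrite NE XE /c2; apply: (@leq_trans (18 * a * (P * X ^ 30) * (P * X ^ 29))).
    rewrite (_ : 6 * (3 * (a * (P * X ^ 30))) = 18 * a * (P * X ^ 30))%N; last by ring.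
    by rewrite leq_pmulr// muln_gt0 P0 expn_gt0 X0.
  by apply: eq_leq; ring.
have H3 : (n * N.*2.+1 * (2 * (c * X)) <= c3 * Z)%N.
  apply: (@leq_trans (256 * a * Q * (3 * N) * (2 * (c * X)))); first by rewrite !leq_mul.
  by rewrite NE XE /Q /c3; apply: eq_leq; ring.
have H4 : ((2 * N).*2.+1 * ((X ^ 2) ^ 2).+1 * (a * X ^ j.+1 * (((X ^ 2) ^ 2) ^ 4 * 2 *
    (J * ((2 * E).+1 * E.+1 * (a * X ^ 2).+1.*2.+1)))) <= c4 * Z)%N.
  have h1 : ((2 * N).*2.+1 <= 5 * N)%N by move: N0; clear; lia.
  have h2 : (((X ^ 2) ^ 2).+1 <= 2 * X ^ 4)%N.
    have : (0 < X ^ 4)%N by rewrite expn_gt0 X0.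
    by rewrite -expnM; move: (X ^ 4)%N; clear; lia.
  have h3 : ((2 * E).+1 <= 9 * (a * X ^ 2))%N.
    by rewrite /E -!mulnA; move: aX; move: (a * X ^ 2)%N; clear; lia.
  have h4 : (E.+1 <= 5 * (a * X ^ 2))%N.
    by rewrite /E -!mulnA; move: aX; move: (a * X ^ 2)%N; clear; lia.
  have h5 : ((a * X ^ 2).+1.*2.+1 <= 5 * (a * X ^ 2))%N.
    by move: aX; move: (a * X ^ 2)%N; clear; lia.
  apply: leq_trans (leq_mul (leq_mul h1 h2) (leq_mul (leqnn _) (leq_mul (leqnn _) (leq_mul (leqnn _) (leq_mul (leq_mul h3 h4) h5))))) _.
  apply: (@leq_trans (c4 * (P * P * X ^ 58))).
    by rewrite NE /J [(X ^ j.+1)%N]expnS -/P /c4; apply: eq_leq; ring.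
  by rewrite XE leq_mul2l leq_mul2l leq_pexp2l ?orbT.
have H1' : (N.*2.+1 * Q.*2.+1 * (2 * (c * X)) <= c1 * Z)%N by rewrite [(N.*2.+1 * _)%N]mulnC.
apply: leq_trans (leq_add (leq_add (leq_add H1 (leq_add H1' H2)) H3) H4) _.
by rewrite -!mulnDl.
Qed.


End Asymptotics.

Lemma root_floor (R : realType) (T : R) k : (0 < k)%N -> 1 <= T ->
  exists X : nat, [/\ (0 < X)%N, (X ^ k)%N%:R <= T & T < (X.+1 ^ k)%N%:R].
Proof.
move=> k0 T1; have [n Tn nmin] : exists2 n : nat, T < (n ^ k)%N%:R & forall m : nat, T < (m ^ k)%N%:R -> (n <= m)%N.
  apply: ex_min_nat; exists (Num.bound T).
  apply: (lt_le_trans (archi_boundP (le_trans ler01 T1))); rewrite ler_nat.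
  by case: (Num.bound T) => // m; rewrite -[X in (X <= _)%N]expn1 leq_pexp2l.
case: n Tn nmin => [|n] Tn nmin.
  by move: Tn; rewrite exp0n// ltNge (le_trans ler01 T1).
exists n; split=> //.
- rewrite lt0n; apply: contraTneq Tn => ->; by rewrite exp1n -leNgt.
- by rewrite leNgt; apply/negP => /nmin; rewrite ltnn.
Qed.

(** * From boxes and powers to balls and logarithms *)

Section Probability.
Variable R : realType.

Lemma frobenius_sq (g : 'M[int]_2) :
  \tr (g^T *m g) = (g 0 0 ^+ 2 + g 1 0 ^+ 2) + (g 0 1 ^+ 2 + g 1 1 ^+ 2).
Proof. by rewrite trace2 !mxE !big_ord2 !mxE. Qed.

Lemma box_sub_ball N (T : R) : (2 * N)%N%:R <= T -> SL2Z_box N `<=` SL2Z_ball T.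
Proof.
move=> NT g [dg gN]; split=> //; rewrite /frobenius_norm frobenius_sq.
apply: le_trans NT.
have -> : (2 * N)%N%:R = Num.sqrt ((2 * N)%N%:R ^+ 2) :> R by rewrite sqrtr_sqr ger0_norm.
rewrite ler_wsqrtr// -[(2 * N)%N%:R]/((2 * N)%N%:Z%:~R) -rmorphXn /= ler_int.
have sq i j : g i j ^+ 2 <= N%:Z ^+ 2.
  by rewrite -[g i j ^+ 2]real_normK ?num_real// ler_pXn2r ?nnegrE// -abszE lez_nat.
have -> : (2 * N)%N%:Z ^+ 2 = (N%:Z ^+ 2 + N%:Z ^+ 2) + (N%:Z ^+ 2 + N%:Z ^+ 2) by rewrite PoszM; ring.
by rewrite !lerD.
Qed.

Lemma ball_sub_box N (T : R) : T < N%:R -> SL2Z_ball T `<=` SL2Z_box N.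
Proof.
move=> TN g [dg gT]; split=> // i j; move: gT; rewrite /frobenius_norm frobenius_sq => gT.
have gij : (g i j) ^+ 2 <= (g 0 0 ^+ 2 + g 1 0 ^+ 2) + (g 0 1 ^+ 2 + g 1 1 ^+ 2).
  have := sqr_ge0 (g 0 0); have := sqr_ge0 (g 0 1); have := sqr_ge0 (g 1 0); have := sqr_ge0 (g 1 1).
  by case: (ord2P i) => ->; case: (ord2P j) => ->;
    move: (g 0 0 ^+ 2) (g 0 1 ^+ 2) (g 1 0 ^+ 2) (g 1 1 ^+ 2) => w x y z; clear; lia.
have h : `|(g i j)%:~R| <= T :> R.
  apply: le_trans gT; rewrite -sqrtr_sqr ler_wsqrtr// -rmorphXn /= ler_int //.
have : `|(g i j)%:~R| < N%:R :> R by apply: le_lt_trans TN.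
rewrite -intr_norm -[N%:R]/(N%:Z%:~R) ltr_int; move: (g i j) => x; clear; lia.
Qed.

Lemma atmost_box N : atmost (SL2Z_box N) ((N.*2.+1 * N.*2.+1) * (N.*2.+1 * N.*2.+1)).
Proof.
apply: (atmost_inj (phi := fun g : 'M[int]_2 => ((g 0 0, g 0 1), (g 1 0, g 1 1)))
  (B := [set p | ((`|p.1.1| <= N)%N /\ (`|p.1.2| <= N)%N) /\ ((`|p.2.1| <= N)%N /\ (`|p.2.2| <= N)%N)])).
- have NN : atmost [set p : int * int | (`|p.1| <= N)%N /\ (`|p.2| <= N)%N] (N.*2.+1 * N.*2.+1).
    exact: (@atmostX _ _ [set z | (`|z| <= N)%N] [set z | (`|z| <= N)%N] _ _ (@atmost_absz N) (@atmost_absz N)).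
  exact: (atmostX NN NN).
- by move=> g [_ gN]; split; split; apply: gN.
- by move=> g g' _ _ [? ? ? ?]; apply: mx2_eq.
Qed.

Variable dd : 'M[int]_2 -> int.
Hypothesis ddP : forall g, \det g = 1 -> hyperbolic g -> order_of_trace g (dd g).

(** If h exceeds 2^k X^(j+1), the factor 2^k offsets T < (X+1)^k <= (2X)^k, so log h >= log T - 29
    log X. From above, log h <= (k + 2) log X <= log T + 2 log X. As log T >= k log X and k eta >=
    29, both deviations are at most eta log T. *)
Lemma log_class_number_bounds (eta T : R) (j X c : nat) (g : 'M[int]_2) :
  29 <= (j + 30)%:R * eta -> (1 < X)%N -> (c <= X)%N ->
  (X ^ (j + 30))%N%:R <= T -> T < (X.+1 ^ (j + 30))%N%:R ->
  (h (dd g) <= c * X ^ (j + 30).+1)%N ->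
  eta < `|ln ((h (dd g))%:R : R) / ln T - 1| ->
  (h (dd g) <= 2 ^ (j + 30) * X ^ j.+1)%N.
Proof.
set k := (j + 30)%N => keta X1 cX XT TX hu; rewrite ltNge => /negP nb.
rewrite leqNgt; apply/negP => hl; apply: nb.
have X0 : (0 < X)%N by apply: ltnW.
have XR : 0 < X%:R :> R by rewrite ltr0n.
have k0 : (0 < k)%N by rewrite /k addnC.
have T1 : 1 < T.
  apply: lt_le_trans XT; rewrite ltr1n; apply: (leq_trans X1).
  by rewrite -[X in (X <= _)%N]expn1 leq_pexp2l.
have T0 : 0 < T by apply: lt_trans T1.
have L0 : 0 < ln T by apply: ln_gt0.
have lX0 : 0 <= ln (X%:R : R) by apply: ln_ge0; rewrite ler1n.
have l20 : 0 <= ln (2 : R) by apply: ln_ge0; rewrite ler1n.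
have lT1 : k%:R * ln (X%:R : R) <= ln T.
  by rewrite mulr_natl -lnXn// -natrX ler_ln ?posrE ?ltr0n ?expn_gt0 ?X0.
have lT2 : ln T <= k%:R * (ln 2 + ln (X%:R : R)).
  rewrite -lnM ?posrE// mulr_natl -lnXn ?mulr_gt0// -natrM -natrX.
  rewrite ler_ln ?posrE ?ltr0n ?expn_gt0 ?muln_gt0 ?X0//; apply: le_trans (ltW TX) _.
  by rewrite ler_nat leq_exp2r// mul2n -addnn -add1n leq_add2r.
have h0 : (0 < h (dd g))%N by apply: leq_ltn_trans hl.
have hR : 0 < (h (dd g))%:R :> R by rewrite ltr0n.
have lh1 : k%:R * ln 2 + j.+1%:R * ln (X%:R : R) <= ln ((h (dd g))%:R : R).
  rewrite !mulr_natl -!lnXn// -lnM ?posrE ?exprn_gt0// -!natrX -natrM.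
  by rewrite ler_ln ?posrE ?ltr0n ?muln_gt0 ?expn_gt0 ?X0// ler_nat ltnW.
have lh2 : ln ((h (dd g))%:R : R) <= (k%:R + 2) * ln (X%:R : R).
  rewrite -[2]/(2%:R) -natrD mulr_natl -lnXn// -natrX.
  rewrite ler_ln ?posrE ?ltr0n ?expn_gt0 ?X0// ler_nat; apply: leq_trans hu _.
  by rewrite addn2 [in leqRHS]expnS leq_mul2r cX orbT.
have kj : k%:R = j.+1%:R + 29 :> R by rewrite -[29]/(29%:R) -natrD /k addSnnS.
have etaL : 29 * ln (X%:R : R) <= eta * ln T.
  have eta0 : 0 <= eta by rewrite -(pmulr_rge0 _ (_ : 0 < k%:R)) ?ltr0n// (le_trans _ keta).
  apply: (@le_trans _ _ (eta * (k%:R * ln (X%:R : R)))); last by rewrite ler_wpM2l.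
  by rewrite mulrA [eta * _]mulrC ler_wpM2r.
rewrite ler_norml; apply/andP; split.
  rewrite lerBrDr ler_pdivlMr//; move: lT2 lh1 etaL; rewrite kj.
  move: (ln _) (ln _) (ln _) (ln _) => lh x y z; clear; nra.
rewrite lerBlDr ler_pdivrMr//; move: lT1 lh2 etaL lX0.
move: (ln _) (ln _) (ln _) => x y z; clear; nra.
Qed.

End Probability.

Section Convergence.
Variable R : realType.
Variable dd : 'M[int]_2 -> int.
Hypothesis ddP : forall g, \det g = 1 -> hyperbolic g -> order_of_trace g (dd g).

(** The ball contains the box of size N, with at least N^2 / 4 matrices; M provides its
    finiteness. *)
Lemma prob_le (T : R) (A : set 'M[int]_2) (N M n : nat) : (2 * N)%N%:R <= T -> T < M%:R ->
  (0 < N)%N -> atmost (SL2Z_ball T `&` A) n ->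
  prob T A <= (4 * n)%N%:R / (N ^ 2)%N%:R.
Proof.
move=> NT TM N0 An; rewrite /prob.
have [_ nA] := atmost_finite An.
have [fB _] := atmost_finite (atmost_sub (ball_sub_box TM) (@atmost_box M)).
have [s [us sB sN]] := SL2Z_box_lower N.
have sc : (size s <= #|` fset_set (SL2Z_ball T)|)%N.
  by apply: (atmost_fset fB) => // g /sB; apply: box_sub_ball.
have Bc : (N ^ 2 <= 4 * #|` fset_set (SL2Z_ball T)|)%N.
  by apply: leq_trans sN _; rewrite leq_mul2l.
have N2 : (0 < N ^ 2)%N by rewrite expn_gt0 N0.
have c0 : (0 < #|` fset_set (SL2Z_ball T)|)%N.
  by move: (leq_trans N2 Bc); rewrite muln_gt0.
rewrite ler_pdivrMr ?ltr0n// mulrAC ler_pdivlMr ?ltr0n// -!natrM ler_nat.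
by rewrite mulnAC [leqRHS]mulnC; apply: leq_mul => //; rewrite [leqRHS]mulnC.
Qed.

Lemma prob_class_number_cvg (eta : R) : 0 < eta ->
  prob T [set g | hyperbolic g /\ eta < `|ln ((h (dd g))%:R : R) / ln T - 1|]
    @[T --> +oo] --> (0 : R).
Proof.
move=> eta0.
pose j := Num.bound (29 / eta); pose k := (j + 30)%N.
have keta : 29 <= (j + 30)%:R * eta.
  rewrite -ler_pdivrMr//; apply: le_trans (ltW (archi_boundP _)) _.
    by rewrite divr_ge0 // ltW.
  by rewrite ler_nat leq_addr.
have k0 : (0 < k)%N by rewrite /k addnC.
have [cu cuP] := class_number_upper ddP k0.
have [cl clP] := atmost_small_class_number_power R ddP j.
pose S T := [set g : 'M[int]_2 | hyperbolic g /\ eta < `|ln ((h (dd g))%:R : R) / ln T - 1|].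
have main (T : R) (X : nat) : (1 < X)%N -> (cu <= X)%N -> (X ^ k)%N%:R <= T -> T < (X.+1 ^ k)%N%:R ->
    prob T (S T) <= (64 * cl)%N%:R / X%:R.
  move=> X1 cX XT TX; have X0 : (0 < X)%N by apply: ltnW.
  (* Entries at most N give a Frobenius norm at most 2 N <= X^k <= T. Since X^k <= 4 N, the quotient
     of 4 cl X^(2k - 1) by N^2 is at most 64 cl / X. *)
  pose N := (X ^ k)./2.
  have Xk : (2 <= X ^ k)%N.
    by apply: (leq_trans X1); rewrite -[X in (X <= _)%N]expn1 leq_pexp2l.
  have N0 : (0 < N)%N by rewrite /N; move: Xk; move: (X ^ k)%N => z; clear; lia.
  have N4 : (X ^ k <= 4 * N)%N by rewrite /N; move: Xk; move: (X ^ k)%N => z; clear; lia.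
  have NT : (2 * N)%N%:R <= T.
    apply: le_trans XT; rewrite ler_nat /N; move: (X ^ k)%N => z; clear; lia.
  have TM : T < ((2 * X) ^ k)%N%:R.
    by apply: lt_le_trans TX _; rewrite ler_nat leq_exp2r// mul2n -addnn -add1n leq_add2r.
  have An : atmost (SL2Z_ball T `&` S T) (cl * X ^ (j.*2 + 59)).
    apply: atmost_sub (clP X X0) => g [gB [hg ev]]; have gN := ball_sub_box TM gB.
    split=> //; exact: (log_class_number_bounds keta X1 cX XT TX (cuP X g X0 gN hg) ev).
  apply: le_trans (prob_le NT TM N0 An) _.
  have N2 : (0 < N ^ 2)%N by rewrite expn_gt0 N0.
  rewrite ler_pdivrMr ?ltr0n// mulrAC ler_pdivlMr ?ltr0n// -!natrM ler_nat.
  apply: (@leq_trans (4 * cl * (X ^ k) ^ 2)).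
    rewrite -expnM (_ : k * 2 = (j.*2 + 59).+1)%N; last by rewrite /k; clear; lia.
    by rewrite expnS; apply: eq_leq; ring.
  apply: (@leq_trans (4 * cl * (4 * N) ^ 2)); first by rewrite leq_mul2l leq_exp2r// N4 orbT.
  by apply: eq_leq; ring.
apply/cvgrPdist_lt => e e0.
(* Three requirements on X are met at once by X >= m: the quotient 64 cl / X is below e, cu <= X,
   and 1 < X. *)
pose m := (Num.bound ((64 * cl)%N%:R / e) + cu + 2)%N.
have me : (64 * cl)%N%:R / m%:R < e.
  have m0 : 0 < m%:R :> R by rewrite ltr0n /m addn2.
  rewrite ltr_pdivrMr// mulrC -ltr_pdivrMr//.
  apply: (lt_le_trans (archi_boundP _)); first by rewrite divr_ge0// ltW.
  by rewrite ler_nat /m -addnA leq_addr.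
near=> T.
have mT : (m ^ k)%N%:R <= T by near: T; apply: nbhs_pinfty_ge; rewrite num_real.
have mk : (0 < m ^ k)%N by rewrite expn_gt0 /m addn2.
have T1 : 1 <= T by apply: le_trans mT; rewrite ler1n.
have [X [X0 XT TX]] := root_floor k0 T1.
have mX : (m <= X)%N.
  have : (m ^ k)%N%:R < (X.+1 ^ k)%N%:R :> R by apply: le_lt_trans TX.
  by rewrite ltr_nat ltn_exp2r// ltnS.
have h : prob T (S T) <= (64 * cl)%N%:R / X%:R.
  apply: main => //; apply: leq_trans mX; rewrite /m; first by rewrite addn2.
  by rewrite -addnA addnC -addnA leq_addr.
rewrite sub0r normrN ger0_norm; last by rewrite /prob divr_ge0.
apply: le_lt_trans h _; apply: le_lt_trans me.
rewrite ler_wpM2l// lef_pV2 ?posrE ?ltr0n// ?ler_nat// /m addn2 //.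
Unshelve. all: by end_near. Qed.

End Convergence.

Theorem corollary1p5 (R : realType) :
  (forall eta : R, 0 < eta ->
     prob T [set g | hyperbolic g /\
       eta < `|ln ((h (disc_field g))%:R : R) / ln T - 1|]
     @[T --> +oo] --> (0 : R))
  /\
  (forall eta : R, 0 < eta ->
     prob T [set g | hyperbolic g /\
       eta < `|ln ((h (disc_multiplier g))%:R : R) / ln T - 1|]
     @[T --> +oo] --> (0 : R)).
Proof.
split=> eta eta0; apply: prob_class_number_cvg => //.
- exact: disc_field_order.
- exact: disc_multiplier_order.
Qed.
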